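(* Assume $D(0)<1$ and $\sup_{0<s<t<T}\|K_n^{-1}(t,t)K(t,s)\|_{\mathcal L(E_1\to E_1)}\le c<\infty$ for some constant $c$. Assume that all the operator-functions $K_i(t,s)$, $i=1,\dots,n$, are continuous and have continuous derivatives with respect to $t$, that $f$ has a continuous derivative, and that $f(0)=0$. Then the equation $$\int_0^t K(t,s)x(s)\,ds=f(t)$$ has a unique solution in the class of continuous functions $\mathbb C_{([0,T];E_1)}$. Moreover, the solution can be constructed using the step method combined with successive approximations (the procedure described in the context).
   Context: $E_1,E_2$ are Banach spaces, $T>0$; $\mathbb C_{([0,T];E_1)}$ is the space of continuous functions on $[0,T]$ with values in $E_1$; $\mathcal L(X\to Y)$ denotes the bounded linear operators from $X$ to $Y$. The function $f$ and its derivative $f'$, with values in $E_2$, are defined and continuous on $[0,T]$. The functions $\alpha_1,\dots,\alpha_{n-1}$ are continuous and have continuous derivatives for $t\in(0,T)$, with $\alpha_i(0)=0$, $0<\alpha_1(t)<\dots<\alpha_{n-1}(t)<t$ for $t\in(0,T)$, and $0<\alpha_1'(0)<\dots<\alpha_{n-1}'(0)<1$. Put $\alpha_0(t)=0$, $\alpha_n(t)=t$. These curves split the region $\{(t,s):0<s<t<T\}$ into the disjoint regions $D_1=\{(t,s):0\le s<\alpha_1(t)\}$ and $D_i=\{(t,s):\alpha_{i-1}(t)<s<\alpha_i(t)\}$, $i=2,\dots,n$. For each $i$, $K_i(t,s)\in\mathcal L(E_1\to E_2)$ is a continuous operator-function defined for $(t,s)\in\overline{D_i}$ and differentiable with respect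 to $t$, with $K_i^{(1)}(t,s)=\partial K_i(t,s)/\partial t\in\mathcal L(E_1\to E_2)$; the norms of $K_i(t,s)$ and of $K_i^{(1)}(t,s)$ are continuous functions on $\overline{D_i}$. The operator $K_n(t,t)$ has a bounded inverse $K_n^{-1}(t,t)$ for every $t\in[0,T]$. The piecewise kernel is $K(t,s)=K_i(t,s)$ for $(t,s)\in D_i$, its derivative with respect to $t$ is $K^{(1)}(t,s)=K_i^{(1)}(t,s)$ for $(t,s)\in D_i$, and $$\int_0^tK(t,s)x(s)\,ds:=\sum_{i=1}^n\int_{\alpha_{i-1}(t)}^{\alpha_i(t)}K_i(t,s)x(s)\,ds.$$ Define $$D(t)=\sum_{i=1}^{n-1}|\alpha_i'(t)|\,\bigl\|K_n^{-1}(t,t)\{K_i(t,\alpha_i(t))-K_{i+1}(t,\alpha_i(t))\}\bigr\|_{\mathcal L(E_1\to E_1)}.$$ Step method combined with successive approximations. Put $\overline f(t)=K_n^{-1}(t,t)f'(t)$, $$(Ax)(t)=K_n^{-1}(t,t)\sum_{i=1}^{n-1}\alpha_i'(t)\bigl(K_i(t,\alpha_i(t))-K_{i+1}(t,\alpha_i(t))\bigr)x(\alpha_i(t)),$$ $$(\mathcal Kx)(t)=\sum_{i=1}^n\int_{\alpha_{i-1}(t)}^{\alpha_i(t)}K_n^{-1}(t,t)K_i^{(1)}(t,s)x(s)\,ds ,$$ so that differentiating the equation and applying $K_n^{-1}(t,t)$ gives $x+Ax+\mathcal Kx=\overline f$. Fix $q<1$, choose $h_1>0$ with $\max_{0\le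 t\le h_1}D(t)=q$, and take $0<h<\min\{h_1,(1-q)/c\}$. Choose $\varepsilon\in(0,1]$ so that, with $h_m=(1+(m-1)\varepsilon)h$ and $I_m=[h_m,h_{m+1}]$, $m=1,2,\dots$, one has $\alpha_i(t)\in[0,h_m]$ for $t\in I_m$, $i=1,\dots,n-1$. (i) On $[0,h]$ the solution is the uniform limit of $x_0^k=-Ax_0^{k-1}-\mathcal Kx_0^{k-1}+\overline f$, $x_0^0=\overline f$. (ii) Successively for $m=1,2,\dots$, until $[0,T]$ is covered, once the solution $\overline x_{m-1}$ on $[0,h_m]$ is known, the solution on $I_m$ is found by successive approximations from the Volterra equation of the second kind $$x(t)+\int_{h_m}^tK_n^{-1}(t,t)K^{(1)}(t,s)x(s)\,ds=\overline f(t)-(A\overline x_{m-1})(t)-\int_0^{h_m}K_n^{-1}(t,t)K^{(1)}(t,s)\overline x_{m-1}(s)\,ds.$$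
   Formalization: The curves α_i are assumed continuously differentiable on the closed interval [0,T] (one-sided at the ends) and to satisfy α_i(T)<T; with these conditions only on (0,T), the claim fails, since solutions need not stay continuous or bounded at T. *)

(* Defs.v *)
(* Stdlib reals with Coquelicot.  A (real) Banach space is a
   [CompleteNormedModule R_AbsRing]; integrals of vector-valued functions are
   Coquelicot's [RInt].  A function on a subset of R or of R * R is represented
   by a total function, whose values outside that subset are never used. *)
From Stdlib Require Import Reals Lra Lia Arith.
From Stdlib Require Import FunctionalExtensionality ProofIrrelevance.
From Coquelicot Require Import Coquelicot.
Open Scope R_scope.

(* Coquelicot's [is_linear] includes boundedness. *)
Record blop (X Y : NormedModule R_AbsRing) : Type := Blop {
  blop_fun :> X -> Y;
  blop_linear : is_linear blop_fun
}.
Arguments Blop {X Y} _ _.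
Arguments blop_fun {X Y} _ _.
Arguments blop_linear {X Y} _.

Lemma blop_ext (X Y : NormedModule R_AbsRing) (a b : blop X Y) :
  (forall x, a x = b x) -> a = b.
Proof.
  destruct a as [a Ha], b as [b Hb]; simpl; intros H.
  assert (a = b) by (apply functional_extensionality; exact H).
  subst b; f_equal; apply proof_irrelevance.
Qed.

Lemma is_linear_plus_fun (X Y : NormedModule R_AbsRing) (a b : X -> Y) :
  is_linear a -> is_linear b -> is_linear (fun x => plus (a x) (b x)).
Proof.
  intros Ha Hb.
  apply (is_linear_comp (fun x => (a x, b x)) (fun p => plus (fst p) (snd p))).
  - apply is_linear_prod; assumption.
  - apply is_linear_plus.
Qed.

Lemma is_linear_opp_fun (X Y : NormedModule R_AbsRing) (a : X -> Y) :
  is_linear a -> is_linear (fun x => opp (a x)).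
Proof.
  intros Ha; apply (is_linear_comp a opp); [exact Ha | apply is_linear_opp].
Qed.

Lemma is_linear_scal_fun (X Y : NormedModule R_AbsRing) (k : R) (a : X -> Y) :
  is_linear a -> is_linear (fun x => scal k (a x)).
Proof.
  intros Ha; apply (is_linear_comp a (fun y => scal k y)); [exact Ha |].
  apply (@is_linear_scal_r R_AbsRing Y k); exact Rmult_comm.
Qed.

Definition blop_comp {X Y Z : NormedModule R_AbsRing}
    (b : blop Y Z) (a : blop X Y) : blop X Z :=
  Blop (fun x => b (a x)) (is_linear_comp a b (blop_linear a) (blop_linear b)).

Section BoundedOperators.

Context (X Y : NormedModule R_AbsRing).
Implicit Types a b : blop X Y.

Definition blop_zero : blop X Y := Blop (fun _ => zero) is_linear_zero.
Definition blop_plus a b : blop X Y :=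
  Blop (fun x => plus (a x) (b x))
    (is_linear_plus_fun X Y a b (blop_linear a) (blop_linear b)).
Definition blop_opp a : blop X Y :=
  Blop (fun x => opp (a x)) (is_linear_opp_fun X Y a (blop_linear a)).
Definition blop_scal (k : R) a : blop X Y :=
  Blop (fun x => scal k (a x)) (is_linear_scal_fun X Y k a (blop_linear a)).

(* ||a|| = sup { ||a x|| : ||x|| <= 1 }; the supremum is finite, see
   [blop_norm_lub]. *)
Definition blop_norm a : R :=
  real (Lub_Rbar (fun r => exists x : X, norm x <= 1 /\ r = norm (a x))).

Lemma blop_norm_lub a :
  is_lub_Rbar (fun r => exists x : X, norm x <= 1 /\ r = norm (a x))
    (Finite (blop_norm a)).
Proof.
  unfold blop_norm.
  set (S := fun r => exists x : X, norm x <= 1 /\ r = norm (a x)).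
  pose proof (Lub_Rbar_correct S) as [Hub Hleast].
  destruct (linear_norm _ (blop_linear a)) as [M [HM Ha]].
  assert (H1 : Rbar_le (Lub_Rbar S) M).
  { apply Hleast; intros r [x [Hx ->]]; simpl.
    apply Rle_trans with (1 := Ha x).
    rewrite <- (Rmult_1_r M) at 2; apply Rmult_le_compat_l; lra. }
  assert (H0 : Rbar_le 0 (Lub_Rbar S)).
  { apply Hub; exists zero; split.
    - rewrite norm_zero; lra.
    - rewrite (linear_zero _ (blop_linear a)), norm_zero; reflexivity. }
  destruct (Lub_Rbar S) as [l | |]; simpl in *; try contradiction.
  split; assumption.
Qed.

Lemma blop_norm_le_unit a x : norm x <= 1 -> norm (a x) <= blop_norm a.
Proof. intros Hx; apply (proj1 (blop_norm_lub a)); exists x; auto. Qed.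

Lemma blop_norm_ub a (M : R) :
  (forall x : X, norm x <= 1 -> norm (a x) <= M) -> blop_norm a <= M.
Proof.
  intros H; apply (proj2 (blop_norm_lub a) (Finite M)).
  intros r [x [Hx ->]]; simpl; auto.
Qed.

Lemma blop_norm_ge0 a : 0 <= blop_norm a.
Proof.
  apply Rle_trans with (norm (a zero)); [apply norm_ge_0 |].
  apply blop_norm_le_unit; rewrite norm_zero; lra.
Qed.

Lemma blop_norm_bound a x : norm (a x) <= blop_norm a * norm x.
Proof.
  destruct (Req_dec (norm x) 0) as [H0 | H0].
  - rewrite (norm_eq_zero _ H0), (linear_zero _ (blop_linear a)), !norm_zero; lra.
  - assert (Hp : 0 < norm x) by (pose proof (norm_ge_0 x); lra).
    assert (Hu : norm (scal (/ norm x) x) <= 1).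
    { apply Rle_trans with (1 := norm_scal (/ norm x) x).
      unfold abs; simpl; rewrite Rabs_pos_eq.
      - right; field; lra.
      - left; apply Rinv_0_lt_compat; exact Hp. }
    assert (Hx : x = scal (norm x) (scal (/ norm x) x)).
    { rewrite scal_assoc; unfold mult; simpl.
      rewrite Rinv_r by lra; symmetry; exact (scal_one x). }
    rewrite Hx at 1; rewrite (linear_scal _ (blop_linear a)).
    apply Rle_trans with (1 := norm_scal _ _).
    unfold abs; simpl; rewrite (Rabs_pos_eq (norm x)) by lra.
    rewrite Rmult_comm; apply Rmult_le_compat_r; [lra |].
    apply blop_norm_le_unit; exact Hu.
Qed.

Lemma blop_norm_triangle a b :
  blop_norm (blop_plus a b) <= blop_norm a + blop_norm b.
Proof.
  apply blop_norm_ub; intros x Hx; simpl.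
  apply Rle_trans with (1 := norm_triangle _ _).
  apply Rplus_le_compat; apply blop_norm_le_unit; exact Hx.
Qed.

Lemma blop_norm_scal (k : R) a :
  blop_norm (blop_scal k a) <= Rabs k * blop_norm a.
Proof.
  apply blop_norm_ub; intros x Hx; simpl.
  apply Rle_trans with (1 := norm_scal (V := Y) k (a x)).
  unfold abs; simpl; apply Rmult_le_compat_l; [apply Rabs_pos |].
  apply blop_norm_le_unit; exact Hx.
Qed.

Lemma blop_norm_eq0 a : blop_norm a = 0 -> a = blop_zero.
Proof.
  intros H; apply blop_ext; intros x; simpl.
  apply norm_eq_zero; apply Rle_antisym; [| apply norm_ge_0].
  apply Rle_trans with (1 := blop_norm_bound a x); rewrite H; lra.
Qed.

Lemma blop_norm_zero : blop_norm blop_zero = 0.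
Proof.
  apply Rle_antisym; [| apply blop_norm_ge0].
  apply blop_norm_ub; intros x _; simpl; rewrite norm_zero; lra.
Qed.

Definition blop_AbelianMonoid_mixin : AbelianMonoid.mixin_of (blop X Y).
Proof.
  apply (AbelianMonoid.Mixin _ blop_plus blop_zero).
  - intros a b; apply blop_ext; intros x; apply plus_comm.
  - intros a b d; apply blop_ext; intros x; apply plus_assoc.
  - intros a; apply blop_ext; intros x; apply plus_zero_r.
Defined.
Canonical blop_AbelianMonoid :=
  AbelianMonoid.Pack (blop X Y) blop_AbelianMonoid_mixin (blop X Y).

Definition blop_AbelianGroup_mixin : AbelianGroup.mixin_of blop_AbelianMonoid.
Proof.
  apply (AbelianGroup.Mixin _ blop_opp).
  intros a; apply blop_ext; intros x; apply (plus_opp_r (a x)).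
Defined.
Canonical blop_AbelianGroup :=
  AbelianGroup.Pack (blop X Y) (AbelianGroup.Class _ _ blop_AbelianGroup_mixin) (blop X Y).

Definition blop_ModuleSpace_mixin :
  ModuleSpace.mixin_of R_AbsRing blop_AbelianGroup.
Proof.
  apply (ModuleSpace.Mixin R_AbsRing blop_AbelianGroup blop_scal).
  - intros k l a; apply blop_ext; intros x; apply (scal_assoc k l (a x)).
  - intros a; apply blop_ext; intros x; apply (scal_one (a x)).
  - intros k a b; apply blop_ext; intros x; apply (scal_distr_l k (a x) (b x)).
  - intros k l a; apply blop_ext; intros x; apply (scal_distr_r k l (a x)).
Defined.
Canonical blop_ModuleSpace :=
  ModuleSpace.Pack R_AbsRing (blop X Y)
    (ModuleSpace.Class R_AbsRing _ _ blop_ModuleSpace_mixin) (blop X Y).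

Definition blop_ball a (e : R) b : Prop := blop_norm (minus b a) < e.

Lemma blop_minus_sym a b : blop_norm (minus a b) = blop_norm (minus b a).
Proof.
  assert (H : forall a b : blop X Y,
            blop_norm (minus a b) <= blop_norm (minus b a)).
  { intros a' b'.
    replace (minus a' b') with (blop_scal (-1) (minus b' a')).
    - apply Rle_trans with (1 := blop_norm_scal _ _).
      rewrite Rabs_left by lra; lra.
    - apply blop_ext; intros x.
      change (scal (opp (one : R_AbsRing)) (minus (b' x) (a' x)) =
              minus (a' x) (b' x)).
      apply (eq_trans (scal_opp_one (minus (b' x) (a' x)))); apply opp_minus. }
  apply Rle_antisym; apply H.
Qed.

Definition blop_UniformSpace_mixin : UniformSpace.mixin_of (blop X Y).
Proof.
  apply (UniformSpace.Mixin _ blop_zero blop_ball); unfold blop_ball.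
  - intros a e.
    replace (minus a a) with blop_zero by (symmetry; apply (minus_eq_zero a)).
    rewrite blop_norm_zero; apply cond_pos.
  - intros a b e; rewrite blop_minus_sym; auto.
  - intros a b d e1 e2 H1 H2.
    rewrite (minus_trans b d a).
    apply Rle_lt_trans with (1 := blop_norm_triangle (minus d b) (minus b a)); lra.
Defined.
Canonical blop_UniformSpace :=
  UniformSpace.Pack (blop X Y) blop_UniformSpace_mixin (blop X Y).

Canonical blop_NormedModuleAux :=
  NormedModuleAux.Pack R_AbsRing (blop X Y)
    (NormedModuleAux.Class R_AbsRing _
       (ModuleSpace.class _ blop_ModuleSpace) blop_UniformSpace_mixin) (blop X Y).

Definition blop_NormedModule_mixin :
  NormedModule.mixin_of R_AbsRing blop_NormedModuleAux.
Proof.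
  apply (NormedModule.Mixin R_AbsRing blop_NormedModuleAux blop_norm 1).
  - exact blop_norm_triangle.
  - exact blop_norm_scal.
  - intros a b e H; exact H.
  - intros a b e H; rewrite Rmult_1_l; exact H.
  - exact blop_norm_eq0.
Defined.
Canonical blop_NormedModule :=
  NormedModule.Pack R_AbsRing (blop X Y)
    (NormedModule.Class R_AbsRing _
       (NormedModuleAux.class _ blop_NormedModuleAux) blop_NormedModule_mixin)
    (blop X Y).

End BoundedOperators.

Definition blop_is_inverse {X Y : NormedModule R_AbsRing}
    (a : blop X Y) (b : blop Y X) : Prop :=
  (forall x, b (a x) = x) /\ (forall y, a (b y) = y).

Definition Icc (a b t : R) : Prop := a <= t <= b.

Definition closure {U : UniformSpace} (A : U -> Prop) (p : U) : Prop :=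
  forall e : posreal, exists q, ball p e q /\ A q.

(* One-sided at the end points when D is an interval. *)
Definition is_derive_within {V : NormedModule R_AbsRing}
    (D : R -> Prop) (g : R -> V) (t : R) (l : V) : Prop :=
  filterdiff g (within D (locally t)) (fun y : R => scal y l).

(* dg is the derivative of g on [a,b], and it is continuous there. *)
Definition C1_on {V : NormedModule R_AbsRing} (a b : R) (g dg : R -> V) : Prop :=
  (forall t, Icc a b t -> is_derive_within (Icc a b) g t (dg t)) /\
  continuous_on (Icc a b) dg.

Definition unif_lim_on {V : NormedModule R_AbsRing}
    (D : R -> Prop) (u : nat -> R -> V) (l : R -> V) : Prop :=
  forall e : posreal, exists N : nat, forall k : nat, (N <= k)%nat ->
    forall t, D t -> norm (minus (u k t) (l t)) < e.

(* The curves alpha_0 = 0, alpha_1, ..., alpha_(n-1), alpha_n = id. *)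
Definition curve (n : nat) (alpha : nat -> R -> R) (i : nat) (t : R) : R :=
  if Nat.eqb i 0 then 0 else if Nat.eqb i n then t else alpha i t.

Definition dcurve (n : nat) (dalpha : nat -> R -> R) (i : nat) (t : R) : R :=
  if Nat.eqb i 0 then 0 else if Nat.eqb i n then 1 else dalpha i t.

(* The ordering of the curves is required on the open interval only; at t = T
   the curves may meet each other, but must stay below the diagonal (and be C^1
   up to T), since otherwise solutions need not stay bounded near T. *)
Definition admissible_curves (T : R) (n : nat) (alpha dalpha : nat -> R -> R) :
    Prop :=
  (forall i, (1 <= i < n)%nat ->
     C1_on 0 T (alpha i) (dalpha i) /\ alpha i 0 = 0 /\ alpha i T < T) /\
  (forall t i, 0 < t < T -> (i < n)%nat ->
     curve n alpha i t < curve n alpha (S i) t) /\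
  (forall i, (i < n)%nat -> dcurve n dalpha i 0 < dcurve n dalpha (S i) 0).

(* D_1 contains the points with s = 0, the other D_i are open. *)
Definition region (T : R) (n : nat) (alpha : nat -> R -> R) (i : nat)
    (p : R * R) : Prop :=
  let (t, s) := p in
  0 < t < T /\
  (if Nat.eqb i 1 then 0 <= s else curve n alpha (i - 1) t < s) /\
  s < curve n alpha i t.

Section Operators.

Context {E1 E2 : CompleteNormedModule R_AbsRing}.
Context (n : nat) (alpha dalpha : nat -> R -> R).
Context (K K1 : nat -> R -> R -> blop E1 E2) (Kinv : R -> blop E2 E1).

Definition first_kind_int (x : R -> E1) (t : R) : E2 :=
  sum_n_m (fun i => RInt (fun s => K i t s (x s))
                         (curve n alpha (i - 1) t) (curve n alpha i t)) 1 n.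

Definition Dfun (t : R) : R :=
  sum_n_m (fun i => Rabs (dalpha i t) *
             norm (blop_comp (Kinv t)
                     (minus (K i t (alpha i t)) (K (S i) t (alpha i t)))))
          1 (n - 1).

Definition Aop (x : R -> E1) (t : R) : E1 :=
  Kinv t (sum_n_m (fun i => scal (dalpha i t)
             (minus (K i t (alpha i t)) (K (S i) t (alpha i t)) (x (alpha i t))))
          1 (n - 1)).

Definition Kop (x : R -> E1) (t : R) : E1 :=
  sum_n_m (fun i => RInt (fun s => Kinv t (K1 i t s (x s)))
                         (curve n alpha (i - 1) t) (curve n alpha i t)) 1 n.

(* The integral over a <= s <= b of K_n^{-1}(t,t) K^{(1)}(t,s) x(s) for the
   piecewise K^{(1)}: the i-th piece is integrated over the intersection of
   [alpha_(i-1)(t), alpha_i(t)] with [a,b]. *)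
Definition Kop_on (a b : R) (x : R -> E1) (t : R) : E1 :=
  sum_n_m (fun i => RInt (fun s => Kinv t (K1 i t s (x s)))
                         (Rmax a (Rmin b (curve n alpha (i - 1) t)))
                         (Rmax a (Rmin b (curve n alpha i t)))) 1 n.

Definition hstep (h eps : R) (m : nat) : R := (1 + (INR m - 1) * eps) * h.

(* The admissible choices of q, h_1 (here h1), h and eps.  The condition
   h < (1 - q) / c is written c * h < 1 - q, so that it is void for c = 0
   (which is possible only when E1 is trivial). *)
Definition step_parameters (T c q h1 h eps : R) : Prop :=
  q < 1 /\
  0 < h1 <= T /\
  ((forall t, 0 <= t <= h1 -> Dfun t <= q) /\
   (exists t, 0 <= t <= h1 /\ Dfun t = q)) /\
  0 < h < h1 /\ c * h < 1 - q /\
  0 < eps <= 1 /\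
  (forall m t i, (1 <= m)%nat -> hstep h eps m <= t <= hstep h eps (S m) ->
     t <= T -> (1 <= i < n)%nat -> 0 <= alpha i t <= hstep h eps m).

Fixpoint iter0 (fbar : R -> E1) (k : nat) : R -> E1 :=
  match k with
  | O => fbar
  | S k' => fun t =>
      plus (minus (opp (Aop (iter0 fbar k') t)) (Kop (iter0 fbar k') t)) (fbar t)
  end.

(* The right-hand side of the Volterra equation of the second kind on
   [hm, hm'], given the solution y on [0,hm]. *)
Definition step_rhs (fbar : R -> E1) (hm : R) (y : R -> E1) (t : R) : E1 :=
  minus (minus (fbar t) (Aop y t)) (Kop_on 0 hm y t).

Fixpoint volterra_iter (hm : R) (g x0 : R -> E1) (k : nat) : R -> E1 :=
  match k with
  | O => x0
  | S k' => fun t => minus (g t) (Kop_on hm t (volterra_iter hm g x0 k') t)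
  end.

(* xbar 0, ..., xbar M are produced by the step method, and [0,T] is covered
   after step M: xbar 0 is the limit on [0,h] of [iter0], and xbar m extends
   xbar (m-1) from [0,h_m] to the part in [0,T] of I_m = [h_m, h_(m+1)] by the
   limit of the successive approximations for the Volterra equation, started
   from an arbitrary continuous function. *)
Definition step_method (T h eps : R) (fbar : R -> E1)
    (M : nat) (xbar : nat -> R -> E1) : Prop :=
  (1 <= M)%nat /\ hstep h eps M < T <= hstep h eps (S M) /\
  unif_lim_on (Icc 0 h) (iter0 fbar) (xbar 0%nat) /\
  forall m, (1 <= m <= M)%nat ->
    let hm := hstep h eps m in
    let Im := Icc hm (Rmin (hstep h eps (S m)) T) in
    let g := step_rhs fbar hm (xbar (m - 1)%nat) in
    (forall t, Icc 0 hm t -> xbar m t = xbar (m - 1)%nat t) /\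
    (forall t, Im t -> plus (xbar m t) (Kop_on hm t (xbar m) t) = g t) /\
    (forall x0, continuous_on Im x0 ->
       unif_lim_on Im (volterra_iter hm g x0) (xbar m)).

End Operators.

(* Main.v *)
(* Differentiating the equation and applying K_n^{-1}(t,t) turns it into
   x + Ax + Kx = fbar.  In the weighted norm sup exp(- lam t) ||x(t)|| the
   operator A + K is a contraction on the whole of [0,T] when lam is large: near
   t = 0 the norm of A is at most D(t) < 1; away from 0 the delays
   t - alpha_i(t) are bounded below, so the weight makes A small; and the
   Volterra part K is O(1/lam).  Hence the iterates x_0^k converge uniformly on
   [0,T], not only on [0,h], and every xbar_m may be taken to be the global
   solution; the Volterra iterations on each I_m converge by the same estimate.
   The two equations are equivalent by the Leibniz rule, whose proof has to cope
   with kernels that are differentiable only strictly between the curves. *)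
Require Import Defs.
From Stdlib Require Import Reals Lra Lia Arith List Classical ClassicalEpsilon.
From Coquelicot Require Import Coquelicot.
Open Scope R_scope.

(** * Normal forms in real modules *)

(** The kernels are known on the closures of the regions only. Each K_i is therefore composed with a
    continuous retraction of the plane onto the closed strip between its two curves ([pext]), and
    functions on a segment are composed with [clamp]; continuity and integrals then concern total
    functions. The price is that an extended kernel need not be differentiable in t across the
    curves. Since the curves are Lipschitz near t, the points that a curve can meet during an
    increment u - t fill a strip of width O(|u - t|), and that strip is estimated by continuity
    alone. The boundary terms of the Leibniz rule regroup curve by curve into jumps of the kernel,
    which is where A comes from; the outermost term is K_n(t,t) x(t), and the invertibility of
    K_n(t,t) makes the equation one of the second kind. The weighted norm occurs only through
    inequalities norm (x t - y t) <= B * w t on a segment. No space of functions is built, and the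
    values outside the segment stay arbitrary; this is why fixed points and limits are always stated
    on the segment. *)

Inductive vexpr : Type :=
  | VZero
  | VAtom (i : nat)
  | VPlus (a b : vexpr)
  | VOpp (a : vexpr)
  | VScal (k : R) (a : vexpr).

Fixpoint vcoef (e : vexpr) (i : nat) : R :=
  match e with
  | VZero => 0
  | VAtom j => if Nat.eqb i j then 1 else 0
  | VPlus a b => vcoef a i + vcoef b i
  | VOpp a => - vcoef a i
  | VScal k a => k * vcoef a i
  end.

(** An explicit finite conjunction instead of a quantified statement, so that after [cbv] there is
    one goal over R for each atom. *)
Fixpoint vcoef_eq (a b : vexpr) (k len : nat) : Prop :=
  match len with
  | O => True
  | S len' => vcoef a k = vcoef b k /\ vcoef_eq a b (S k) len'
  end.

Section VectorNormalForm.

Context {V : ModuleSpace R_AbsRing}.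

Fixpoint veval (env : list V) (e : vexpr) : V :=
  match e with
  | VZero => zero
  | VAtom i => nth i env zero
  | VPlus a b => plus (veval env a) (veval env b)
  | VOpp a => opp (veval env a)
  | VScal k a => scal k (veval env a)
  end.

Fixpoint vlin (env : list V) (u : nat -> R) (k : nat) : V :=
  match env with
  | nil => zero
  | v :: env' => plus (scal (u k) v) (vlin env' u (S k))
  end.

Lemma vlin_ext env u v k :
  (forall i, (k <= i < k + length env)%nat -> u i = v i) ->
  vlin env u k = vlin env v k.
Proof.
  revert k; induction env as [|w env IH]; intros k H; simpl; [reflexivity |].
  rewrite (H k) by (simpl; lia); rewrite (IH (S k)); [reflexivity |].
  intros i Hi; apply H; simpl; lia.
Qed.

Lemma vlin_zero env k : vlin env (fun _ => 0) k = zero.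
Proof.
  revert k; induction env as [|w env IH]; intros k; simpl; [reflexivity |].
  rewrite IH, plus_zero_r; exact (scal_zero_l w).
Qed.

Lemma vlin_plus env u v k :
  vlin env (fun i => u i + v i) k = plus (vlin env u k) (vlin env v k).
Proof.
  revert k; induction env as [|w env IH]; intros k; simpl.
  - symmetry; apply plus_zero_r.
  - rewrite IH.
    rewrite (scal_distr_r (u k) (v k) w : scal (u k + v k) w = _).
    rewrite <- !plus_assoc; f_equal; rewrite !plus_assoc; f_equal; apply plus_comm.
Qed.

Lemma vlin_scal env (a : R) u k :
  vlin env (fun i => a * u i) k = scal a (vlin env u k).
Proof.
  revert k; induction env as [|w env IH]; intros k; simpl.
  - symmetry; exact (scal_zero_r a).
  - rewrite IH, scal_distr_l; f_equal; symmetry; exact (scal_assoc a (u k) w).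
Qed.

Lemma vlin_opp env u k : vlin env (fun i => - u i) k = opp (vlin env u k).
Proof.
  rewrite <- (scal_opp_one (vlin env u k) : scal (-1) _ = _), <- vlin_scal.
  apply vlin_ext; intros; ring.
Qed.

Lemma vlin_atom env i k :
  vlin env (fun j => if Nat.eqb j (k + i) then 1 else 0) k = nth i env zero.
Proof.
  revert i k; induction env as [|w env IH]; intros i k; simpl.
  - destruct i; reflexivity.
  - destruct i as [|i].
    + rewrite Nat.add_0_r, Nat.eqb_refl.
      rewrite (vlin_ext env _ (fun _ => 0)).
      * rewrite vlin_zero, plus_zero_r; exact (scal_one w).
      * intros j Hj; destruct (Nat.eqb_spec j k); [lia | reflexivity].
    + destruct (Nat.eqb_spec k (k + S i)) as [H|_]; [lia |].
      rewrite (scal_zero_l w : scal 0 w = zero), plus_zero_l, <- (IH i (S k)).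
      apply vlin_ext; intros j _; replace (k + S i)%nat with (S k + i)%nat by lia.
      reflexivity.
Qed.

Lemma veval_vlin env e : veval env e = vlin env (vcoef e) 0.
Proof.
  induction e as [| i | a IHa b IHb | a IHa | k a IHa]; simpl.
  - symmetry; apply vlin_zero.
  - symmetry; apply (vlin_atom env i 0).
  - rewrite IHa, IHb; symmetry; apply vlin_plus.
  - rewrite IHa; symmetry; apply vlin_opp.
  - rewrite IHa; symmetry; apply vlin_scal.
Qed.

Lemma vcoef_eqP a b k len i :
  vcoef_eq a b k len -> (k <= i < k + len)%nat -> vcoef a i = vcoef b i.
Proof.
  revert k; induction len as [|len IH]; simpl; intros k H Hi; [lia |].
  destruct H as [H1 H2]; destruct (Nat.eq_dec i k) as [->|Hk]; [exact H1 |].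
  apply (IH (S k)); [exact H2 | lia].
Qed.

(** Soundness of the reflection: the atoms may be linearly dependent, so equality of the
    coefficients is sufficient, not necessary. *)
Lemma veval_eq env a b :
  vcoef_eq a b 0 (length env) -> veval env a = veval env b.
Proof.
  intros H; rewrite !veval_vlin; apply vlin_ext; intros i Hi.
  apply (vcoef_eqP a b 0 (length env)); assumption.
Qed.

End VectorNormalForm.

Ltac vatom_index a l :=
  lazymatch l with
  | nil => constr:(O)
  | a :: _ => constr:(O)
  | _ :: ?l' => let i := vatom_index a l' in constr:(S i)
  end.

Ltac vatom_add a l :=
  lazymatch l with
  | nil => constr:(a :: nil)
  | a :: _ => l
  | ?b :: ?l' => let l'' := vatom_add a l' in constr:(b :: l'')
  end.

Ltac vatoms e l :=
  lazymatch e with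
  | plus ?a ?b => let l' := vatoms a l in vatoms b l'
  | minus ?a ?b => let l' := vatoms a l in vatoms b l'
  | opp ?a => vatoms a l
  | scal _ ?a => vatoms a l
  | zero => l
  | _ => vatom_add e l
  end.

Ltac vreify e l :=
  lazymatch e with
  | plus ?a ?b =>
      let a' := vreify a l in let b' := vreify b l in constr:(VPlus a' b')
  | minus ?a ?b =>
      let a' := vreify a l in let b' := vreify b l in constr:(VPlus a' (VOpp b'))
  | opp ?a => let a' := vreify a l in constr:(VOpp a')
  | scal ?k ?a => let a' := vreify a l in constr:(VScal k a')
  | zero => constr:(VZero)
  | _ => let i := vatom_index e l in constr:(VAtom i)
  end.

(* Decides identities of the real module V, comparing the coefficients of the
   atoms by [ring] or [field]. *)
Ltac vector V :=
  cbv beta;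
  match goal with
  | |- ?a = ?b =>
      let l0 := constr:(@nil (ModuleSpace.sort R_AbsRing V)) in
      let l1 := vatoms a l0 in
      let l := vatoms b l1 in
      let a' := vreify a l in
      let b' := vreify b l in
      change (@veval V l a' = @veval V l b');
      apply veval_eq; cbv [vcoef_eq vcoef Nat.eqb length];
      repeat split; try ring; try field
  end.


Ltac norm_as V z :=
  match goal with
  | |- norm ?x <= _ =>
      let H := fresh in assert (H : x = z) by vector V; rewrite H; clear H
  | |- norm ?x < _ =>
      let H := fresh in assert (H : x = z) by vector V; rewrite H; clear H
  end.

(** * Continuity of operator-valued functions *)

Lemma filterlim_norm_iff {S : Type} {V : NormedModule R_AbsRing}
    (F : (S -> Prop) -> Prop) {FF : Filter F} (g : S -> V) (l : V) :
  filterlim g F (locally l) <->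
  (forall e, 0 < e -> F (fun p => norm (minus (g p) l) < e)).
Proof.
  rewrite filterlim_locally_ball_norm; split.
  - intros H e He; exact (H (mkposreal e He)).
  - intros H e; apply H; apply cond_pos.
Qed.

Lemma continuous_plane_iff {V : NormedModule R_AbsRing} (g : R * R -> V) (t s : R) :
  continuous g (t, s) <->
  (forall e, 0 < e -> exists d, 0 < d /\ forall t' s',
     Rabs (t' - t) < d -> Rabs (s' - s) < d ->
     norm (minus (g (t', s')) (g (t, s))) < e).
Proof.
  split; [intros H e He | intros H; apply (filterlim_norm_iff _); intros e He].
  - destruct (proj1 (filterlim_norm_iff _ _ _) H e He) as [d Hd].
    exists d; split; [apply cond_pos |].
    intros t' s' Ht Hs; apply Hd; split; [exact Ht | exact Hs].
  - destruct (H e He) as [d [Hd Hd']]; exists (mkposreal d Hd).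
    intros [t' s'] [Ht Hs]; apply Hd'; [exact Ht | exact Hs].
Qed.

Lemma continuous_line_iff {V : NormedModule R_AbsRing} (g : R -> V) (t : R) :
  continuous g t <->
  (forall e, 0 < e -> exists d, 0 < d /\ forall t',
     Rabs (t' - t) < d -> norm (minus (g t') (g t)) < e).
Proof.
  split; [intros H e He | intros H; apply (filterlim_norm_iff _); intros e He].
  - destruct (proj1 (filterlim_norm_iff _ _ _) H e He) as [d Hd].
    exists d; split; [apply cond_pos |].
    intros t' Ht; apply Hd; exact Ht.
  - destruct (H e He) as [d [Hd Hd']]; exists (mkposreal d Hd).
    intros t' Ht; apply Hd'; exact Ht.
Qed.

(** Stated for an abstract product, so that one estimate serves both the application of an operator
    to a vector and the composition of two operators. *)
Lemma filterlim_bilinear {S : Type} {X Y Z : NormedModule R_AbsRing}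
    (F : (S -> Prop) -> Prop) {FF : Filter F} (B : X -> Y -> Z)
    (HB : forall a b, norm (B a b) <= norm a * norm b)
    (Hm : forall a b a' b',
       minus (B a b) (B a' b') = plus (B (minus a a') b) (B a' (minus b b')))
    (u : S -> X) (v : S -> Y) (a : X) (b : Y) :
  filterlim u F (locally a) -> filterlim v F (locally b) ->
  filterlim (fun p => B (u p) (v p)) F (locally (B a b)).
Proof.
  intros Hu Hv; apply (filterlim_norm_iff F); intros e He.
  pose proof (proj1 (filterlim_norm_iff F u a) Hu) as Hu'.
  pose proof (proj1 (filterlim_norm_iff F v b) Hv) as Hv'.
  pose proof (norm_ge_0 a) as Ha; pose proof (norm_ge_0 b) as Hb.
  set (N := norm a + norm b + 1).
  assert (HN : 0 < N) by (unfold N; lra).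
  (* If both factors are within d of their limits, then d <= 1 gives norm (v p) <= norm b + 1, and
     the two terms of [Hm] add up to at most d * N <= e / 2. *)
  set (d := Rmin 1 (e / (2 * N))).
  assert (Hd : 0 < d).
  { unfold d; apply Rmin_pos; [lra |].
    apply Rdiv_lt_0_compat; lra. }
  assert (Hd1 : d <= 1) by apply Rmin_l.
  assert (Hd2 : d * (2 * N) <= e).
  { apply Rle_trans with (e / (2 * N) * (2 * N)).
    - apply Rmult_le_compat_r; [lra | apply Rmin_r].
    - right; field; lra. }
  generalize (filter_and _ _ (Hu' d Hd) (Hv' d Hd)); apply filter_imp.
  intros p [H1 H2]; rewrite Hm.
  apply Rle_lt_trans with (1 := norm_triangle _ _).
  assert (Hvp : norm (v p) <= norm b + 1).
  { replace (v p) with (plus (minus (v p) b) b) by vector Y.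
    apply Rle_trans with (1 := norm_triangle _ _); lra. }
  pose proof (HB (minus (u p) a) (v p)) as H3.
  pose proof (HB a (minus (v p) b)) as H4.
  pose proof (norm_ge_0 (minus (u p) a)).
  pose proof (norm_ge_0 (minus (v p) b)).
  pose proof (norm_ge_0 (v p)).
  assert (norm (minus (u p) a) * norm (v p) <= d * (norm b + 1))
    by (apply Rmult_le_compat; lra).
  assert (norm a * norm (minus (v p) b) <= norm a * d)
    by (apply Rmult_le_compat_l; lra).
  assert (0 < d * N) by (apply Rmult_lt_0_compat; lra).
  unfold N in *; lra.
Qed.

Lemma blop_norm_app_le {X Y : NormedModule R_AbsRing} (L : blop X Y) x :
  norm (L x) <= norm L * norm x.
Proof. exact (blop_norm_bound X Y L x). Qed.

Lemma blop_minus_arg {X Y : NormedModule R_AbsRing} (L : blop X Y) x y :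
  L (minus x y) = minus (L x) (L y).
Proof.
  unfold minus; rewrite (linear_plus _ (blop_linear L)); f_equal.
  exact (linear_opp _ _ (blop_linear L)).
Qed.

Lemma blop_comp_norm_le {X Y Z : NormedModule R_AbsRing}
    (b : blop Y Z) (a : blop X Y) :
  norm (blop_comp b a) <= norm b * norm a.
Proof.
  apply (blop_norm_ub X Z (blop_comp b a)); intros x Hx; simpl.
  apply Rle_trans with (1 := blop_norm_app_le b (a x)).
  apply Rmult_le_compat_l; [apply norm_ge_0 |].
  exact (blop_norm_le_unit X Y a x Hx).
Qed.

Lemma filterlim_blop_app {S : Type} {X Y : NormedModule R_AbsRing}
    (F : (S -> Prop) -> Prop) {FF : Filter F}
    (L : S -> blop X Y) (v : S -> X) (l : blop X Y) (w : X) :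
  filterlim L F (locally l) -> filterlim v F (locally w) ->
  filterlim (fun p => L p (v p)) F (locally (l w)).
Proof.
  apply (filterlim_bilinear F (fun (a : blop X Y) (b : X) => a b)).
  - intros a b; apply blop_norm_app_le.
  - intros a b a' b'; rewrite blop_minus_arg.
    change (minus a a' b) with (minus (a b) (a' b)); vector Y.
Qed.

Lemma filterlim_blop_comp {S : Type} {X Y Z : NormedModule R_AbsRing}
    (F : (S -> Prop) -> Prop) {FF : Filter F}
    (L : S -> blop Y Z) (M : S -> blop X Y) (l : blop Y Z) (m : blop X Y) :
  filterlim L F (locally l) -> filterlim M F (locally m) ->
  filterlim (fun p => blop_comp (L p) (M p)) F (locally (blop_comp l m)).
Proof.
  apply (filterlim_bilinear F (fun (a : blop Y Z) (b : blop X Y) => blop_comp a b)).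
  - intros a b; apply blop_comp_norm_le.
  - intros a b a' b'; apply blop_ext; intros x.
    change (minus (a (b x)) (a' (b' x)) =
            plus (minus (a (b x)) (a' (b x))) (a' (minus (b x) (b' x)))).
    rewrite blop_minus_arg; vector Z.
Qed.

Lemma continuous_blop_app {U : UniformSpace} {X Y : NormedModule R_AbsRing}
    (L : U -> blop X Y) (v : U -> X) p :
  continuous L p -> continuous v p -> continuous (fun q => L q (v q)) p.
Proof. apply filterlim_blop_app; apply locally_filter. Qed.

Lemma continuous_norm {U : UniformSpace} {X : NormedModule R_AbsRing}
    (v : U -> X) p :
  continuous v p -> continuous (fun q => norm (v q)) p.
Proof. intros H; apply (filterlim_comp _ _ _ v norm _ _ _ H); apply filterlim_norm. Qed.

(** Rests on the identity j u - j t = - j u (k u - k t) j t. It is used twice: to bound j u near t,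
    and then, with this bound, to make the difference small. *)
Lemma continuous_inverse {X Y : NormedModule R_AbsRing}
    (k : R -> blop X Y) (j : R -> blop Y X) (t : R) :
  (forall u, blop_is_inverse (k u) (j u)) -> continuous k t -> continuous j t.
Proof.
  intros Hi Hk; apply (@continuous_line_iff (blop_NormedModule Y X) j t); intros e He.
  pose proof (proj1 (@continuous_line_iff (blop_NormedModule X Y) k t) Hk) as Hk'.
  set (N := norm (j t)).
  assert (HN : 0 <= N) by apply norm_ge_0.
  (* The first entry makes d * N <= 1 / 2, so that norm (j u) <= N + norm (j u) / 2 and hence norm
     (j u) <= 2 * N. The second makes the resulting bound 2 * N * (d * N) smaller than e. *)
  set (d := Rmin (/ (2 * (N + 1))) (e / (2 * (N * N + 1)))).
  assert (Hd : 0 < d).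
  { apply Rmin_pos; [apply Rinv_0_lt_compat; lra |].
    apply Rdiv_lt_0_compat; nra. }
  assert (Hd1 : d * (N + 1) <= / 2).
  { apply Rle_trans with (/ (2 * (N + 1)) * (N + 1)).
    - apply Rmult_le_compat_r; [lra | apply Rmin_l].
    - right; field; lra. }
  assert (Hd2 : 2 * (N * N + 1) * d <= e).
  { apply Rle_trans with (2 * (N * N + 1) * (e / (2 * (N * N + 1)))).
    - apply Rmult_le_compat_l; [nra | apply Rmin_r].
    - right; field; nra. }
  destruct (Hk' d Hd) as [r [Hr Hr']]; exists r; split; [exact Hr |].
  intros u Hu; specialize (Hr' u Hu).
  set (m := minus (k u) (k t)) in *.
  assert (Heq : minus (j u) (j t) =
                opp (blop_comp (j u) (blop_comp m (j t)))).
  { apply blop_ext; intros y.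
    change (minus (j u y) (j t y) =
            opp (j u (minus (k u (j t y)) (k t (j t y))))).
    rewrite blop_minus_arg, (proj1 (Hi u)), (proj2 (Hi t)); vector X. }
  assert (Hle : norm (minus (j u) (j t)) <= norm (j u) * (d * N)).
  { rewrite Heq.
    rewrite (@norm_opp _ (blop_NormedModule Y X) _ : norm (opp _) = _).
    apply Rle_trans with (1 := blop_comp_norm_le _ _).
    apply Rmult_le_compat_l; [apply norm_ge_0 |].
    apply Rle_trans with (1 := blop_comp_norm_le _ _).
    apply Rmult_le_compat_r; [exact HN | left; exact Hr']. }
  assert (Hju : norm (j u) <= 2 * N).
  { assert (norm (j u) <= N + norm (minus (j u) (j t))).
    { replace (j u) with (plus (j t) (minus (j u) (j t))) at 1
        by vector (blop_ModuleSpace Y X).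
      exact (@norm_triangle _ (blop_NormedModule Y X) (j t) _). }
    assert (norm (j u) * (d * N) <= norm (j u) * / 2).
    { apply Rmult_le_compat_l; [apply norm_ge_0 | lra]. }
    lra. }
  apply Rle_lt_trans with (1 := Hle).
  apply Rle_lt_trans with (2 * N * (d * N)).
  - apply Rmult_le_compat_r; [nra | exact Hju].
  - nra.
Qed.

(** * Truncation to a segment, and bounds obtained by compactness *)

Definition clamp (a b s : R) : R := Rmax a (Rmin b s).

Lemma clamp_id a b s : a <= s <= b -> clamp a b s = s.
Proof. intros H; unfold clamp; rewrite Rmin_right, Rmax_right; lra. Qed.

Lemma clamp_in a b s : a <= b -> a <= clamp a b s <= b.
Proof.
  intros H; unfold clamp; split; [apply Rmax_l |].
  apply Rmax_lub; [exact H | apply Rmin_l].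
Qed.

(** Truncation is nonexpansive jointly in the end points and the argument; the end points matter
    because they will be values of curves that move with t. *)
Lemma clamp_close a b a' b' s s' e :
  Rabs (a' - a) < e -> Rabs (b' - b) < e -> Rabs (s' - s) < e ->
  Rabs (clamp a' b' s' - clamp a b s) < e.
Proof.
  intros Ha Hb Hs.
  apply Rabs_def2 in Ha; apply Rabs_def2 in Hb; apply Rabs_def2 in Hs.
  unfold clamp, Rmax, Rmin; apply Rabs_def1;
    repeat destruct Rle_dec; lra.
Qed.

Lemma continuous_clamp {U : UniformSpace} (a b s : U -> R) p :
  continuous a p -> continuous b p -> continuous s p ->
  continuous (fun q => clamp (a q) (b q) (s q)) p.
Proof.
  intros Ha Hb Hs; apply (proj2 (filterlim_locally _ _)); intros e.
  pose proof (proj1 (filterlim_locally a (a p)) Ha e) as Ha'.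
  pose proof (proj1 (filterlim_locally b (b p)) Hb e) as Hb'.
  pose proof (proj1 (filterlim_locally s (s p)) Hs e) as Hs'.
  generalize (filter_and _ _ Ha' (filter_and _ _ Hb' Hs')); apply filter_imp.
  intros q [H1 [H2 H3]]; apply clamp_close; assumption.
Qed.

Lemma continuous_clamp_id a b t : continuous (clamp a b) t.
Proof.
  apply (continuous_clamp (fun _ => a) (fun _ => b) (fun s => s));
    [apply continuous_const | apply continuous_const | apply continuous_id].
Qed.

Lemma continuous_on_comp {U W Z : UniformSpace} (D : W -> Prop)
    (g : W -> Z) (phi : U -> W) p :
  continuous_on D g -> (forall q, D (phi q)) -> continuous phi p ->
  continuous (fun q => g (phi q)) p.
Proof.
  intros Hg HD Hphi P HP.
  specialize (Hg (phi p) (HD p) P HP); unfold filtermap, within in Hg.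
  specialize (Hphi _ Hg); unfold filtermap in *.
  revert Hphi; apply filter_imp; intros q Hq; apply Hq, HD.
Qed.

(** Trades continuity relative to a segment, one-sided at its ends, for ordinary continuity of a
    total function. Nearly every continuity argument below passes through this equivalence. *)
Lemma continuous_on_clamp {U : UniformSpace} (a b : R) (g : R -> U) :
  a <= b -> (continuous_on (Icc a b) g <->
             forall t, continuous (fun u => g (clamp a b u)) t).
Proof.
  intros Hab; split.
  - intros Hg t; apply (continuous_on_comp (Icc a b) g (clamp a b)); [exact Hg | |].
    + intros q; apply clamp_in, Hab.
    + apply continuous_clamp_id.
  - intros Hg t Ht P HP.
    rewrite <- (clamp_id a b t Ht) in HP.
    specialize (Hg t P HP); unfold filtermap, within in *.
    revert Hg; apply filter_imp; intros u Hu Hin.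
    rewrite clamp_id in Hu by exact Hin; exact Hu.
Qed.

(* The minimum with [/ (M + 1)] makes the uniform radius given by compactness
   control the local bounds [M] as well. *)
Lemma bounded_on_rectangle {V : NormedModule R_AbsRing} (g : R * R -> V) (a b a' b' : R) :
  (forall t s : R, continuous g (t, s)) ->
  exists C, 0 < C /\ forall t s, a <= t <= b -> a' <= s <= b' -> norm (g (t, s)) <= C.
Proof.
  intros Hg.
  assert (Hloc : forall t s, exists d : posreal, forall t' s',
            Rabs (t' - t) < d -> Rabs (s' - s) < d ->
            norm (g (t', s')) <= / d).
  { intros t s.
    destruct (proj1 (continuous_plane_iff g t s) (Hg t s) 1 Rlt_0_1) as [r [Hr Hr']].
    set (M := norm (g (t, s)) + 1).
    assert (HM : 0 < M) by (pose proof (norm_ge_0 (g (t, s))); unfold M; lra).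
    assert (Hd : 0 < Rmin r (/ M)).
    { apply Rmin_pos; [exact Hr | apply Rinv_0_lt_compat; exact HM]. }
    exists (mkposreal _ Hd); simpl; intros t' s' Ht Hs.
    apply Rle_trans with M.
    - replace (g (t', s')) with (plus (minus (g (t', s')) (g (t, s))) (g (t, s)))
        by vector V.
      apply Rle_trans with (1 := norm_triangle _ _).
      assert (norm (minus (g (t', s')) (g (t, s))) < 1); [| unfold M; lra].
      apply Hr'; eapply Rlt_le_trans; try eassumption; apply Rmin_l.
    - apply Rle_trans with (/ / M); [rewrite Rinv_inv; lra |].
      apply Rinv_le_contravar; [exact Hd | apply Rmin_r]. }
  set (delta := fun t s => epsilon (inhabits (mkposreal 1 Rlt_0_1))
         (fun d : posreal => forall t' s', Rabs (t' - t) < d -> Rabs (s' - s) < d ->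
            norm (g (t', s')) <= / d)).
  assert (Hdelta : forall t s t' s', Rabs (t' - t) < delta t s ->
            Rabs (s' - s) < delta t s -> norm (g (t', s')) <= / delta t s).
  { intros t s; unfold delta; apply epsilon_spec, Hloc. }
  destruct (compactness_value_2d a b a' b' delta) as [d Hd].
  exists (/ d); split; [apply Rinv_0_lt_compat, cond_pos |].
  intros t s Ht Hs; apply NNPP; intros Hn.
  apply (Hd t s Ht Hs); intros [u [v [Hu [Hv [Hut [Hvs Hle]]]]]]; apply Hn.
  apply Rle_trans with (1 := Hdelta u v t s Hut Hvs).
  apply Rinv_le_contravar; [apply cond_pos | exact Hle].
Qed.

Lemma bounded_on_segment {V : NormedModule R_AbsRing} (g : R -> V) (a b : R) :
  (forall t : R, continuous g t) ->
  exists C, 0 < C /\ forall t, a <= t <= b -> norm (g t) <= C.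
Proof.
  intros Hg; destruct (bounded_continuity g a b (fun t _ => Hg t)) as [M HM].
  exists (Rabs M + 1); split; [pose proof (Rabs_pos M); lra |].
  intros t Ht; pose proof (HM t Ht); pose proof (Rle_abs M); lra.
Qed.

(** A tube argument along the compact slice {t} x [a,b]. Both values are compared with the one at
    the centre (t,u) of a covering box, hence the tolerance e / 2. *)
Lemma uniform_near_slice {V : NormedModule R_AbsRing} (g : R * R -> V) (t a b e : R) :
  (forall s : R, continuous g (t, s)) -> 0 < e ->
  exists d, 0 < d /\ forall t' s, Rabs (t' - t) < d -> a <= s <= b ->
    norm (minus (g (t', s)) (g (t, s))) < e.
Proof.
  intros Hg He.
  assert (Hloc : forall s, exists d : posreal, forall t' s',
            Rabs (t' - t) < d -> Rabs (s' - s) < d ->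
            norm (minus (g (t', s')) (g (t, s))) < e / 2).
  { intros s.
    destruct (proj1 (continuous_plane_iff g t s) (Hg s) (e / 2) ltac:(lra))
      as [r [Hr Hr']]; exists (mkposreal r Hr); exact Hr'. }
  (* [compactness_value_1d] expects a function that gives a radius at every centre; [epsilon]
     selects one, and the default radius 1 never matters because [Hloc] holds at every s. *)
  set (delta := fun s => epsilon (inhabits (mkposreal 1 Rlt_0_1))
         (fun d : posreal => forall t' s', Rabs (t' - t) < d -> Rabs (s' - s) < d ->
            norm (minus (g (t', s')) (g (t, s))) < e / 2)).
  assert (Hdelta : forall s t' s', Rabs (t' - t) < delta s -> Rabs (s' - s) < delta s ->
            norm (minus (g (t', s')) (g (t, s))) < e / 2).
  { intros s; unfold delta; apply epsilon_spec, Hloc. }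
  destruct (compactness_value_1d a b delta) as [d Hd].
  exists d; split; [apply cond_pos |].
  (* The covering centre is provided only under a double negation, so the estimate itself is proved
     by contradiction. *)
  intros t' s Ht Hs; apply NNPP; intros Hn.
  apply (Hd s Hs); intros [u [Hu [Hsu Hle]]]; apply Hn.
  replace (minus (g (t', s)) (g (t, s))) with
    (minus (minus (g (t', s)) (g (t, u))) (minus (g (t, s)) (g (t, u)))) by vector V.
  unfold minus at 1; apply Rle_lt_trans with (1 := norm_triangle _ _).
  rewrite norm_opp.
  assert (Ht0 : Rabs (t - t) < delta u).
  { rewrite Rminus_diag, Rabs_R0; apply cond_pos. }
  assert (Ht' : Rabs (t' - t) < delta u) by (apply Rlt_le_trans with (1 := Ht), Hle).
  pose proof (Hdelta u t' s Ht' Hsu).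
  pose proof (Hdelta u t s Ht0 Hsu). lra.
Qed.

(** * Parameter-dependent integrals and the Leibniz rule *)

Lemma continuous_slice_r {U : UniformSpace} (g : R * R -> U) (t s : R) :
  continuous g (t, s) -> continuous (fun s' : R => g (t, s')) s.
Proof.
  intros Hg; apply (continuous_comp_2 (fun _ => t) (fun s' : R => s') (fun u v => g (u, v))).
  - apply continuous_const.
  - apply continuous_id.
  - apply continuous_ext with (2 := Hg); intros [u v]; reflexivity.
Qed.

Lemma continuous_slice_l {U : UniformSpace} (g : R * R -> U) (t s : R) :
  continuous g (t, s) -> continuous (fun t' : R => g (t', s)) t.
Proof.
  intros Hg; apply (continuous_comp_2 (fun t' : R => t') (fun _ => s) (fun u v => g (u, v))).
  - apply continuous_id.
  - apply continuous_const.
  - apply continuous_ext with (2 := Hg); intros [u v]; reflexivity.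
Qed.

Lemma is_derive_line_iff {V : NormedModule R_AbsRing} (g : R -> V) (t : R) (l : V) :
  is_derive g t l <->
  (forall e, 0 < e -> exists d, 0 < d /\ forall t', Rabs (t' - t) < d ->
     norm (minus (minus (g t') (g t)) (scal (t' - t) l)) <= e * Rabs (t' - t)).
Proof.
  split.
  - intros [_ H] e He.
    destruct (H t (fun P HP => HP) (mkposreal e He)) as [d Hd].
    exists d; split; [apply cond_pos |]; intros t' Ht; exact (Hd t' Ht).
  - intros H; split; [apply is_linear_scal_l |].
    intros u Hu; rewrite <- (is_filter_lim_locally_unique t u Hu).
    intros e; destruct (H e (cond_pos e)) as [d [Hd Hd']].
    exists (mkposreal d Hd); intros t' Ht; exact (Hd' t' Ht).
Qed.

Lemma is_derive_continuous {V : NormedModule R_AbsRing} (g : R -> V) (t : R) (l : V) :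
  is_derive g t l -> continuous g t.
Proof. intros H; apply ex_derive_continuous; exists l; exact H. Qed.

(** At a single small increment h the remainder reduces to - h l, so h * norm l <= e * h for every e
    > 0. *)
Lemma is_derive_locally_zero {V : NormedModule R_AbsRing} (g : R -> V) (t d : R) (l : V) :
  0 < d -> (forall u, Rabs (u - t) < d -> g u = zero) -> is_derive g t l -> l = zero.
Proof.
  intros Hd Hg Hl; apply norm_eq_zero, Rle_antisym; [| apply norm_ge_0].
  apply le_epsilon; intros e He; rewrite Rplus_0_l.
  destruct (proj1 (is_derive_line_iff g t l) Hl e He) as [r [Hr Hr']].
  set (h := Rmin d r / 2).
  assert (Hm : 0 < Rmin d r) by (apply Rmin_pos; assumption).
  assert (Hh : 0 < h) by (unfold h; lra).
  assert (Ha : Rabs (t + h - t) = h).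
  { replace (t + h - t) with h by ring; apply Rabs_pos_eq; lra. }
  pose proof (Rmin_l d r); pose proof (Rmin_r d r).
  specialize (Hr' (t + h)); rewrite Ha in Hr'.
  rewrite (Hg (t + h)) in Hr' by (rewrite Ha; unfold h; lra).
  rewrite (Hg t) in Hr' by (rewrite Rminus_diag, Rabs_R0; exact Hd).
  specialize (Hr' ltac:(unfold h; lra)).
  replace (t + h - t) with h in Hr' by ring.
  assert (Hl' : l = scal (- / h) (minus (minus zero zero) (scal h l))).
  { vector V; lra. }
  apply Rle_trans with (1 := Req_le _ _ (f_equal norm Hl')).
  apply Rle_trans with (1 := @norm_scal R_AbsRing V (- / h) _).
  unfold abs; simpl; rewrite Rabs_Ropp, Rabs_pos_eq
    by (left; apply Rinv_0_lt_compat; exact Hh).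
  apply Rle_trans with (/ h * (e * h)).
  - apply Rmult_le_compat_l; [left; apply Rinv_0_lt_compat; exact Hh | exact Hr'].
  - right; field; lra.
Qed.

Section Integrals.

Context {V : CompleteNormedModule R_AbsRing}.
Implicit Types (f : R -> V) (g p q : R * R -> V).

Lemma ex_RInt_cont f a b : (forall s : R, continuous f s) -> ex_RInt f a b.
Proof. intros H; apply ex_RInt_continuous; intros s _; apply H. Qed.

Lemma norm_RInt_le_abs f a b M :
  (forall s : R, continuous f s) ->
  (forall s, Rmin a b <= s <= Rmax a b -> norm (f s) <= M) ->
  norm (RInt f a b) <= M * Rabs (b - a).
Proof.
  intros Hf HM; destruct (Rle_dec a b) as [Hab | Hab].
  - rewrite Rmin_left, Rmax_right in HM by lra; rewrite Rabs_pos_eq, Rmult_comm by lra.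
    apply (norm_RInt_le_const f a b _ M Hab HM).
    apply RInt_correct, ex_RInt_cont, Hf.
  - rewrite Rmin_right, Rmax_left in HM by lra.
    assert (Hsw : norm (RInt f a b) = norm (RInt f b a)).
    { rewrite <- opp_RInt_swap by (apply ex_RInt_cont, Hf).
      exact (@norm_opp _ V (RInt f b a)). }
    rewrite Hsw.
    rewrite Rabs_left1, Ropp_minus_distr, Rmult_comm by lra.
    apply (norm_RInt_le_const f b a _ M); [lra | exact HM |].
    apply RInt_correct, ex_RInt_cont, Hf.
Qed.

(** By the fundamental theorem: u |-> L (RInt f a u) has derivative L (f u), since L is its own
    differential, and it vanishes at u = a. *)
Lemma RInt_blop {W : CompleteNormedModule R_AbsRing} (L : blop V W) f a b :
  (forall s : R, continuous f s) -> RInt (fun s : R => L (f s)) a b = L (RInt f a b).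
Proof.
  intros Hf; apply is_RInt_unique.
  replace (L (RInt f a b)) with (minus (L (RInt f a b)) (L (RInt f a a))).
  - apply (is_RInt_derive (fun u : R => L (RInt f a u)) (fun u : R => L (f u))).
    + intros u _.
      assert (Hd : is_derive (fun u : R => RInt f a u) u (f u)).
      { apply (is_derive_RInt f (fun u : R => RInt f a u) a u); [| apply Hf].
        apply filter_forall; intros v; apply RInt_correct, ex_RInt_cont, Hf. }
      apply filterdiff_ext_lin with (fun y : R => L (scal y (f u))).
      * apply (filterdiff_comp _ L _ L Hd).
        apply filterdiff_linear, blop_linear.
      * intros y; apply (linear_scal _ (blop_linear L)).
    + intros u _; apply (continuous_comp f L); [apply Hf |].
      exact (@linear_cont R_AbsRing V W L (f u) (blop_linear L)).
  - assert (H0 : L (RInt f a a) = zero).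
    { rewrite RInt_point; exact (linear_zero _ (blop_linear L)). }
    rewrite H0; vector W.
Qed.

(** Separates the change of the integrand from the motion of the end points: the middle integral has
    fixed limits, and the two strips shrink as a', b' approach a, b. *)
Lemma RInt_param_split g (t t' a b a' b' : R) :
  (forall u s : R, continuous g (u, s)) ->
  RInt (fun s : R => g (t', s)) a' b' =
  plus (RInt (fun s : R => g (t', s)) a b)
    (minus (RInt (fun s : R => g (t', s)) b b') (RInt (fun s : R => g (t', s)) a a')).
Proof.
  intros Hg.
  assert (H : forall u v, ex_RInt (fun s : R => g (t', s)) u v).
  { intros u v; apply ex_RInt_cont; intros s; apply continuous_slice_r, Hg. }
  rewrite <- (RInt_Chasles _ a' b b' (H _ _) (H _ _)).
  rewrite <- (RInt_Chasles _ a' a b (H _ _) (H _ _)).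
  rewrite <- (opp_RInt_swap _ a a' (H _ _)).
  vector V.
Qed.

Lemma RInt_strip_le g (t t' b b' e : R) :
  (forall u s : R, continuous g (u, s)) ->
  (forall s, Rabs (s - b) <= Rabs (b' - b) ->
     norm (minus (g (t', s)) (g (t, b))) <= e) ->
  norm (minus (RInt (fun s : R => g (t', s)) b b') (scal (b' - b) (g (t, b))))
    <= e * Rabs (b' - b).
Proof.
  intros Hg He.
  assert (H : forall s : R, continuous (fun s : R => g (t', s)) s).
  { intros s; apply continuous_slice_r, Hg. }
  rewrite <- RInt_const, <- RInt_minus.
  - apply (norm_RInt_le_abs (fun s : R => minus (g (t', s)) (g (t, b)))).
    + intros s; apply (continuous_minus (fun s : R => g (t', s)) (fun _ => g (t, b)));
        [apply H | apply continuous_const].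
    + intros s Hs; apply He; revert Hs.
      unfold Rmin, Rmax, Rabs; repeat destruct Rle_dec; repeat destruct Rcase_abs; lra.
  - apply ex_RInt_cont, H.
  - apply ex_RInt_const.
Qed.

(** Three contributions of size e / 3: the integral with frozen limits, controlled uniformly along
    the slice, and the two end strips, whose lengths tend to 0 while the integrand stays bounded
    near (t, a t) and (t, b t). *)
Lemma continuous_RInt_param g (a b : R -> R) (t : R) :
  (forall u s : R, continuous g (u, s)) -> continuous a t -> continuous b t ->
  continuous (fun u : R => RInt (fun s : R => g (u, s)) (a u) (b u)) t.
Proof.
  intros Hg Ha Hb; apply (@continuous_line_iff V); intros e He.
  assert (Hslice : forall u s : R, continuous (fun s : R => g (u, s)) s).
  { intros u s; apply continuous_slice_r, Hg. }
  assert (Hstrip : forall (c : R -> R) (r : R), continuous c t -> 0 < r ->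
            exists d, 0 < d /\ forall u, Rabs (u - t) < d ->
              norm (RInt (fun s : R => g (u, s)) (c t) (c u)) < r).
  (* N bounds the integrand on a box around (t, c t), so a strip shorter than r / N contributes less
     than r. *)
  { intros c r Hc Hr; set (N := norm (g (t, c t)) + 1).
    assert (HN : 0 < N) by (pose proof (norm_ge_0 (g (t, c t))); unfold N; lra).
    destruct (proj1 (continuous_plane_iff g t (c t)) (Hg t (c t)) 1 Rlt_0_1)
      as [d1 [Hd1 Hd1']].
    destruct (proj1 (continuous_line_iff c t) Hc (Rmin d1 (r / N))) as [d2 [Hd2 Hd2']].
    { apply Rmin_pos; [exact Hd1 | apply Rdiv_lt_0_compat; assumption]. }
    exists (Rmin d1 d2); split; [apply Rmin_pos; assumption |].
    intros u Hu.
    assert (Hu1 : Rabs (u - t) < d1) by (apply Rlt_le_trans with (1 := Hu), Rmin_l).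
    assert (Hu2 : Rabs (u - t) < d2) by (apply Rlt_le_trans with (1 := Hu), Rmin_r).
    specialize (Hd2' u Hu2); change (Rabs (c u - c t) < Rmin d1 (r / N)) in Hd2'.
    assert (Hc1 : Rabs (c u - c t) < d1) by (apply Rlt_le_trans with (1 := Hd2'), Rmin_l).
    assert (Hc2 : Rabs (c u - c t) < r / N) by (apply Rlt_le_trans with (1 := Hd2'), Rmin_r).
    apply Rle_lt_trans with (N * Rabs (c u - c t)).
    - apply norm_RInt_le_abs; [apply Hslice |]; intros s Hs.
      replace (g (u, s)) with (plus (minus (g (u, s)) (g (t, c t))) (g (t, c t)))
        by vector V.
      apply Rle_trans with (1 := @norm_triangle _ V _ _).
      assert (norm (minus (g (u, s)) (g (t, c t))) < 1); [| unfold N; lra].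
      apply Hd1'; [exact Hu1 |]; apply Rle_lt_trans with (2 := Hc1); revert Hs.
      unfold Rmin, Rmax, Rabs; repeat destruct Rle_dec; repeat destruct Rcase_abs; lra.
    - apply Rlt_le_trans with (N * (r / N)).
      + apply Rmult_lt_compat_l; assumption.
      + right; field; lra. }
  set (N := Rabs (b t - a t) + 1).
  assert (HN : 0 < N) by (pose proof (Rabs_pos (b t - a t)); unfold N; lra).
  destruct (uniform_near_slice g t (Rmin (a t) (b t)) (Rmax (a t) (b t)) (e / 3 / N)
              (fun s : R => Hg t s)) as [d1 [Hd1 Hd1']].
  { apply Rdiv_lt_0_compat; lra. }
  destruct (Hstrip a (e / 3) Ha ltac:(lra)) as [d2 [Hd2 Hd2']].
  destruct (Hstrip b (e / 3) Hb ltac:(lra)) as [d3 [Hd3 Hd3']].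
  exists (Rmin d1 (Rmin d2 d3)); split; [repeat apply Rmin_pos; assumption |].
  intros u Hu.
  assert (Hu1 : Rabs (u - t) < d1) by (apply Rlt_le_trans with (1 := Hu), Rmin_l).
  assert (Hu2 : Rabs (u - t) < d2).
  { apply Rlt_le_trans with (1 := Hu); rewrite Rmin_r; apply Rmin_l. }
  assert (Hu3 : Rabs (u - t) < d3).
  { apply Rlt_le_trans with (1 := Hu); rewrite Rmin_r; apply Rmin_r. }
  specialize (Hd2' u Hu2); specialize (Hd3' u Hu3).
  cbv beta; rewrite (RInt_param_split g t u (a t) (b t) (a u) (b u) Hg).
  set (B := RInt _ (b t) (b u)) in *; set (A := RInt _ (a t) (a u)) in *.
  assert (Hmid : norm (minus (RInt (fun s : R => g (u, s)) (a t) (b t))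
                             (RInt (fun s : R => g (t, s)) (a t) (b t))) < e / 3).
  { rewrite <- RInt_minus by (apply ex_RInt_cont, Hslice).
    apply Rle_lt_trans with (e / 3 / N * Rabs (b t - a t)).
    - apply (norm_RInt_le_abs (fun s : R => minus (g (u, s)) (g (t, s)))).
      + intros s; apply (continuous_minus (fun s : R => g (u, s)) (fun s : R => g (t, s)));
          apply Hslice.
      + intros s Hs; left; apply Hd1'; assumption.
    - apply Rlt_le_trans with (e / 3 / N * N).
      + apply Rmult_lt_compat_l; [apply Rdiv_lt_0_compat; lra | unfold N; lra].
      + right; field; lra. }
  match type of Hmid with norm (minus ?X ?Y) < _ =>
    norm_as V (plus (minus X Y) (plus B (opp A))) end.
  apply Rle_lt_trans with (1 := @norm_triangle _ V _ _).
  pose proof (@norm_triangle _ V B (opp A)) as HBA; rewrite (@norm_opp _ V A : norm (opp A) = norm A) in HBA.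
  replace e with (e / 3 + (e / 3 + e / 3)) by field.
  apply Rplus_lt_compat; [exact Hmid |].
  apply Rle_lt_trans with (1 := HBA), Rplus_lt_compat; assumption.
Qed.

(** On the strip the integrand is close to l = g (t, b t), so the integral is (b u - b t) l up to r
    |b u - b t|, and b u - b t is (u - t) db up to r |u - t|. The strip is empty at u = t, so
    continuity of g is enough: no derivative of g enters. *)
Lemma is_derive_RInt_strip g (b : R -> R) (t db : R) :
  (forall u s : R, continuous g (u, s)) -> is_derive b t db ->
  is_derive (fun u : R => RInt (fun s : R => g (u, s)) (b t) (b u)) t (scal db (g (t, b t))).
Proof.
  intros Hg Hb; apply is_derive_line_iff; intros e He.
  set (l := g (t, b t)).
  (* The two errors add up to at most r * (|db| + 1 + norm l) * |u - t|, which r * N <= e / 2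
     absorbs. *)
  set (N := norm l + Rabs db + 2).
  pose proof (norm_ge_0 l) as Hl; pose proof (Rabs_pos db) as Hdb.
  assert (HN : 0 < N) by (unfold N; lra).
  set (r := Rmin 1 (e / (2 * N))).
  assert (Hr : 0 < r) by (apply Rmin_pos; [| apply Rdiv_lt_0_compat]; lra).
  assert (Hr1 : r <= 1) by apply Rmin_l.
  assert (HrN : r * (2 * N) <= e).
  { apply Rle_trans with (e / (2 * N) * (2 * N)).
    - apply Rmult_le_compat_r; [lra | apply Rmin_r].
    - right; field; lra. }
  destruct (proj1 (continuous_plane_iff g t (b t)) (Hg t (b t)) r Hr) as [d1 [Hd1 Hd1']].
  destruct (proj1 (continuous_line_iff b t) (is_derive_continuous b t db Hb) d1 Hd1)
    as [d2 [Hd2 Hd2']].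
  destruct (proj1 (is_derive_line_iff b t db) Hb r Hr) as [d3 [Hd3 Hd3']].
  exists (Rmin d1 (Rmin d2 d3)); split; [repeat apply Rmin_pos; assumption |].
  intros u Hu.
  assert (Hu1 : Rabs (u - t) < d1) by (apply Rlt_le_trans with (1 := Hu), Rmin_l).
  assert (Hu2 : Rabs (u - t) < d2).
  { apply Rlt_le_trans with (1 := Hu); rewrite Rmin_r; apply Rmin_l. }
  assert (Hu3 : Rabs (u - t) < d3).
  { apply Rlt_le_trans with (1 := Hu); rewrite Rmin_r; apply Rmin_r. }
  specialize (Hd2' u Hu2); specialize (Hd3' u Hu3).
  change (Rabs (b u - b t) < d1) in Hd2'.
  change (Rabs ((b u - b t) - (u - t) * db) <= r * Rabs (u - t)) in Hd3'.
  rewrite RInt_point.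
  assert (H1 : norm (minus (RInt (fun s : R => g (u, s)) (b t) (b u)) (scal (b u - b t) l))
               <= r * Rabs (b u - b t)).
  { apply RInt_strip_le; [exact Hg |]; intros s Hs; left; apply Hd1'; [exact Hu1 |].
    apply Rle_lt_trans with (1 := Hs), Hd2'. }
  assert (H2 : norm (scal (b u - b t - (u - t) * db) l) <= r * Rabs (u - t) * norm l).
  { apply Rle_trans with (1 := @norm_scal _ V _ _).
    apply Rmult_le_compat_r; [exact Hl | exact Hd3']. }
  assert (H3 : Rabs (b u - b t) <= (Rabs db + 1) * Rabs (u - t)).
  { replace (b u - b t) with ((b u - b t - (u - t) * db) + (u - t) * db) by ring.
    apply Rle_trans with (1 := Rabs_triang _ _); rewrite Rabs_mult.
    pose proof (Rabs_pos (u - t)); nra. }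
  norm_as V
    (plus (minus (RInt (fun s : R => g (u, s)) (b t) (b u)) (scal (b u - b t) l))
          (scal (b u - b t - (u - t) * db) l)).
  apply Rle_trans with (1 := @norm_triangle _ V _ _).
  pose proof (Rabs_pos (u - t)) as Hut.
  assert (r * Rabs (b u - b t) <= r * ((Rabs db + 1) * Rabs (u - t)))
    by (apply Rmult_le_compat_l; lra).
  assert (r * (2 * N) * Rabs (u - t) <= e * Rabs (u - t))
    by (apply Rmult_le_compat_r; lra).
  assert (H4 : 0 <= r * Rabs (u - t)) by (apply Rmult_le_pos; lra).
  assert (H5 : 0 <= r * Rabs (u - t) * N) by (apply Rmult_le_pos; lra).
  unfold N in *.
  apply Rle_trans with (1 := Rplus_le_compat _ _ _ _ H1 H2); lra.
Qed.

(** A mean value inequality for vector values: the increment of p is the integral of q from t to u,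
    and the subtracted linear term is the integral of the constant q (t, s). *)
Lemma increment_le p q (t u s e : R) :
  (forall u s : R, continuous q (u, s)) ->
  (forall v, Rmin t u <= v <= Rmax t u ->
     is_derive (fun v : R => p (v, s)) v (q (v, s)) /\
     norm (minus (q (v, s)) (q (t, s))) <= e) ->
  norm (minus (minus (p (u, s)) (p (t, s))) (scal (u - t) (q (t, s))))
    <= e * Rabs (u - t).
Proof.
  intros Hq H.
  assert (Hc : forall v : R, continuous (fun v : R => q (v, s)) v).
  { intros v; apply continuous_slice_l, Hq. }
  assert (HI : is_RInt (fun v : R => q (v, s)) t u (minus (p (u, s)) (p (t, s)))).
  { apply (is_RInt_derive (fun v : R => p (v, s))); intros v Hv; [apply H, Hv | apply Hc]. }
  rewrite <- (is_RInt_unique _ _ _ _ HI), <- RInt_const, <- RInt_minus.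
  - apply (norm_RInt_le_abs (fun v : R => minus (q (v, s)) (q (t, s)))).
    + intros v; apply (continuous_minus (fun v : R => q (v, s)) (fun _ => q (t, s)));
        [apply Hc | apply continuous_const].
    + intros v Hv; apply H, Hv.
  - apply ex_RInt_cont, Hc.
  - apply ex_RInt_const.
Qed.

(* Near the end points of [a,b], on strips of width L |u - t|, only the
   continuity of p and q is used; their contribution is o(|u - t|) since
   p(u,s) - p(t,s) tends to 0. *)
Lemma is_derive_RInt_cone p q (t a b L d0 : R) :
  (forall u s : R, continuous p (u, s)) -> (forall u s : R, continuous q (u, s)) ->
  a < b -> 0 < L -> 0 < d0 ->
  (forall u s, u <> t -> Rabs (u - t) < d0 ->
     a + L * Rabs (u - t) <= s <= b - L * Rabs (u - t) ->
     forall v, Rmin t u <= v <= Rmax t u ->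
       is_derive (fun v : R => p (v, s)) v (q (v, s))) ->
  is_derive (fun u : R => RInt (fun s : R => p (u, s)) a b) t (RInt (fun s : R => q (t, s)) a b).
Proof.
  intros Hp Hq Hab HL Hd0 Hder; apply is_derive_line_iff; intros e He.
  set (r := fun u s => minus (minus (p (u, s)) (p (t, s))) (scal (u - t) (q (t, s)))).
  assert (Hr : forall u s : R, continuous (r u) s).
  { intros u s.
    apply (continuous_minus (fun s : R => minus (p (u, s)) (p (t, s)))
             (fun s : R => scal (u - t) (q (t, s)))).
    - apply (continuous_minus (fun s : R => p (u, s)) (fun s : R => p (t, s)));
        apply continuous_slice_r, Hp.
    - apply (continuous_scal_r (u - t) (fun s : R => q (t, s))), continuous_slice_r, Hq. }
  destruct (bounded_on_segment (fun s : R => q (t, s)) a b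
              (fun s : R => continuous_slice_r q t s (Hq t s))) as [C [HC HC']].
  set (N := (b - a) + 4 * L + 1).
  set (e1 := e / N).
  assert (HN : 0 < N) by (unfold N; lra).
  assert (He1 : 0 < e1) by (apply Rdiv_lt_0_compat; assumption).
  assert (HeN : e1 * N = e) by (unfold e1; field; lra).
  destruct (uniform_near_slice p t a b e1 (fun s : R => Hp t s) He1) as [d1 [Hd1 Hd1']].
  destruct (uniform_near_slice q t a b e1 (fun s : R => Hq t s) He1) as [d2 [Hd2 Hd2']].
  set (d3 := Rmin (e1 / C) ((b - a) / (2 * L))).
  assert (Hd3 : 0 < d3) by (apply Rmin_pos; apply Rdiv_lt_0_compat; lra).
  exists (Rmin (Rmin d0 d1) (Rmin d2 d3)); split; [apply Rmin_pos; apply Rmin_pos; assumption |].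
  intros u Hu; destruct (Req_dec u t) as [-> | Hut].
  { rewrite !Rminus_diag, Rabs_R0, Rmult_0_r.
    norm_as V (@zero V); exact (Req_le _ _ (@norm_zero _ V)). }
  assert (Hu' : Rabs (u - t) < d0 /\ Rabs (u - t) < d1 /\ Rabs (u - t) < d2 /\
                Rabs (u - t) < d3).
  { revert Hu; generalize (Rabs (u - t)); intros y.
    unfold Rmin; repeat destruct Rle_dec; lra. }
  destruct Hu' as [Hu0 [Hu1 [Hu2 Hu3]]].
  set (h := Rabs (u - t)) in *.
  assert (Hh : 0 <= h) by apply Rabs_pos.
  assert (Hh1 : h * C <= e1).
  { apply Rle_trans with (e1 / C * C).
    - apply Rmult_le_compat_r; [lra |].
      apply Rle_trans with d3; [lra | apply Rmin_l].
    - right; field; lra. }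
  assert (Hh2 : 2 * (L * h) <= b - a).
  { apply Rle_trans with (2 * (L * ((b - a) / (2 * L)))).
    - apply Rmult_le_compat_l; [lra |]; apply Rmult_le_compat_l; [lra |].
      apply Rle_trans with d3; [lra | apply Rmin_r].
    - right; field; lra. }
  assert (HLh : 0 <= L * h) by (apply Rmult_le_pos; lra).
  assert (Hx : forall v w, ex_RInt (r u) v w) by (intros; apply ex_RInt_cont, Hr).
  assert (Hxp : forall w v1 v2, ex_RInt (fun s : R => p (w, s)) v1 v2).
  { intros; apply ex_RInt_cont; intros s; apply continuous_slice_r, Hp. }
  assert (Hxq : ex_RInt (fun s : R => q (t, s)) a b).
  { apply ex_RInt_cont; intros s; apply continuous_slice_r, Hq. }
  assert (Heq : minus (minus (RInt (fun s : R => p (u, s)) a b) (RInt (fun s : R => p (t, s)) a b))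
                  (scal (u - t) (RInt (fun s : R => q (t, s)) a b)) = RInt (r u) a b).
  { rewrite <- RInt_minus by apply Hxp.
    rewrite <- RInt_scal by exact Hxq.
    rewrite <- RInt_minus; [reflexivity | |].
    - apply (@ex_RInt_minus V (fun s : R => p (u, s)) (fun s : R => p (t, s))); apply Hxp.
    - apply (@ex_RInt_scal V (fun s : R => q (t, s))); exact Hxq. }
  apply Rle_trans with (norm (RInt (r u) a b)); [exact (Req_le _ _ (f_equal norm Heq)) |].
  rewrite <- (RInt_Chasles (r u) a (a + L * h) b (Hx _ _) (Hx _ _)).
  rewrite <- (RInt_Chasles (r u) (a + L * h) (b - L * h) b (Hx _ _) (Hx _ _)).
  assert (Hedge : forall s, a <= s <= b -> norm (r u s) <= 2 * e1).
  { intros s Hs; unfold r.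
    apply Rle_trans with (1 := @norm_triangle _ V _ _).
    rewrite (@norm_opp _ V _ : norm (opp _) = _).
    replace (2 * e1) with (e1 + e1) by ring; apply Rplus_le_compat.
    - left; exact (Hd1' u s Hu1 Hs).
    - apply Rle_trans with (1 := @norm_scal _ V (u - t) _).
      apply Rle_trans with (2 := Hh1), Rmult_le_compat_l; [exact Hh | apply HC', Hs]. }
  assert (H1 : norm (RInt (r u) a (a + L * h)) <= 2 * e1 * (L * h)).
  { replace (L * h) with (Rabs (a + L * h - a)) at 2
      by (replace (a + L * h - a) with (L * h) by ring; apply Rabs_pos_eq; lra).
    apply norm_RInt_le_abs; [apply Hr |]; intros s Hs.
    rewrite Rmin_left, Rmax_right in Hs by lra; apply Hedge; lra. }
  assert (H3 : norm (RInt (r u) (b - L * h) b) <= 2 * e1 * (L * h)).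
  { replace (L * h) with (Rabs (b - (b - L * h))) at 2
      by (replace (b - (b - L * h)) with (L * h) by ring; apply Rabs_pos_eq; lra).
    apply norm_RInt_le_abs; [apply Hr |]; intros s Hs.
    rewrite Rmin_left, Rmax_right in Hs by lra; apply Hedge; lra. }
  assert (H2 : norm (RInt (r u) (a + L * h) (b - L * h)) <= e1 * h * (b - a)).
  { apply Rle_trans with (e1 * h * Rabs (b - L * h - (a + L * h))).
    - apply norm_RInt_le_abs; [apply Hr |]; intros s Hs.
      rewrite Rmin_left, Rmax_right in Hs by lra.
      apply increment_le; [exact Hq |]; intros v Hv; split.
      + apply (Hder u s); [exact Hut | exact Hu0 | exact Hs | exact Hv].
      + left; apply Hd2'; [| lra].
        apply Rle_lt_trans with (2 := Hu2); unfold h; revert Hv.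
        unfold Rmin, Rmax, Rabs; repeat destruct Rle_dec; repeat destruct Rcase_abs; lra.
    - apply Rmult_le_compat_l; [apply Rmult_le_pos; lra |].
      rewrite Rabs_pos_eq; lra. }
  apply Rle_trans with (1 := @norm_triangle _ V _ _).
  apply Rle_trans with (2 * e1 * (L * h) + (e1 * h * (b - a) + 2 * e1 * (L * h))).
  - apply Rplus_le_compat; [exact H1 |].
    apply Rle_trans with (1 := @norm_triangle _ V _ _).
    apply Rplus_le_compat; assumption.
  - assert (0 <= e1 * h) by (apply Rmult_le_pos; lra).
    rewrite <- HeN; unfold N; lra.
Qed.

Lemma is_derive_lipschitz (c : R -> R) (t dc : R) :
  is_derive c t dc ->
  exists d, 0 < d /\ forall u, Rabs (u - t) < d ->
    Rabs (c u - c t) <= (Rabs dc + 1) * Rabs (u - t).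
Proof.
  intros Hc; destruct (proj1 (is_derive_line_iff c t dc) Hc 1 Rlt_0_1) as [d [Hd Hd']].
  exists d; split; [exact Hd |]; intros u Hu; specialize (Hd' u Hu).
  change (Rabs ((c u - c t) - (u - t) * dc) <= 1 * Rabs (u - t)) in Hd'.
  replace (c u - c t) with ((c u - c t - (u - t) * dc) + (u - t) * dc) by ring.
  apply Rle_trans with (1 := Rabs_triang _ _); rewrite Rabs_mult; lra.
Qed.

(** Differentiability of p is assumed strictly between the moving curves only. If s keeps a distance
    L |u - t| from a t and from b t, the Lipschitz bounds keep it between a v and b v for every v
    from t to u; this is the cone condition of [is_derive_RInt_cone]. The two moving strips are
    handled separately and give the boundary terms. *)
Lemma is_derive_RInt_leibniz p q (a b : R -> R) (t da db d0 : R) :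
  (forall u s : R, continuous p (u, s)) -> (forall u s : R, continuous q (u, s)) ->
  is_derive a t da -> is_derive b t db -> a t < b t -> 0 < d0 ->
  (forall u s, Rabs (u - t) < d0 -> a u < s < b u ->
     is_derive (fun v : R => p (v, s)) u (q (u, s))) ->
  is_derive (fun u : R => RInt (fun s : R => p (u, s)) (a u) (b u)) t
    (plus (RInt (fun s : R => q (t, s)) (a t) (b t))
       (minus (scal db (p (t, b t))) (scal da (p (t, a t))))).
Proof.
  intros Hp Hq Ha Hb Hab Hd0 Hder.
  apply is_derive_ext with
    (fun u : R => plus (RInt (fun s : R => p (u, s)) (a t) (b t))
       (minus (RInt (fun s : R => p (u, s)) (b t) (b u))
              (RInt (fun s : R => p (u, s)) (a t) (a u)))).
  { intros u; symmetry; apply (RInt_param_split p t u); exact Hp. }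
  apply @is_derive_plus; [| apply @is_derive_minus; apply is_derive_RInt_strip; assumption].
  destruct (is_derive_lipschitz a t da Ha) as [d1 [Hd1 Hd1']].
  destruct (is_derive_lipschitz b t db Hb) as [d2 [Hd2 Hd2']].
  (* Strictly larger than both Lipschitz constants |da| + 1 and |db| + 1, which yields the strict
     inequalities a v < s < b v. *)
  set (L := Rabs da + Rabs db + 2).
  pose proof (Rabs_pos da); pose proof (Rabs_pos db).
  assert (HL : 0 < L) by (unfold L; lra).
  set (d := Rmin d0 (Rmin d1 d2)).
  assert (Hd : 0 < d) by (repeat apply Rmin_pos; assumption).
  apply (is_derive_RInt_cone p q t (a t) (b t) L d Hp Hq Hab HL Hd).
  intros u s Hut Hu Hs v Hv.
  assert (Hh : 0 < Rabs (u - t)) by (apply Rabs_pos_lt; lra).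
  assert (Hvu : Rabs (v - t) <= Rabs (u - t)).
  { revert Hv; unfold Rmin, Rmax, Rabs;
      repeat destruct Rle_dec; repeat destruct Rcase_abs; lra. }
  assert (Hvd : Rabs (v - t) < d0 /\ Rabs (v - t) < d1 /\ Rabs (v - t) < d2).
  { revert Hu Hvu; generalize (Rabs (u - t)), (Rabs (v - t)); intros y z.
    unfold d, Rmin; repeat destruct Rle_dec; lra. }
  destruct Hvd as [Hv0 [Hv1 Hv2]].
  specialize (Hd1' v Hv1); specialize (Hd2' v Hv2).
  assert (Hda : (Rabs da + 1) * Rabs (v - t) <= (Rabs da + 1) * Rabs (u - t))
    by (apply Rmult_le_compat_l; lra).
  assert (Hdb : (Rabs db + 1) * Rabs (v - t) <= (Rabs db + 1) * Rabs (u - t))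
    by (apply Rmult_le_compat_l; lra).
  assert (HLa : (Rabs da + 1) * Rabs (u - t) < L * Rabs (u - t))
    by (apply Rmult_lt_compat_r; unfold L; lra).
  assert (HLb : (Rabs db + 1) * Rabs (u - t) < L * Rabs (u - t))
    by (apply Rmult_lt_compat_r; unfold L; lra).
  apply Rabs_le_between in Hd1'; apply Rabs_le_between in Hd2'.
  apply Hder; [exact Hv0 | lra].
Qed.

End Integrals.

(** * Weighted contractions *)

Lemma norm_minus_sym {V : NormedModule R_AbsRing} (x y : V) :
  norm (minus x y) = norm (minus y x).
Proof. rewrite <- norm_opp; f_equal; vector V. Qed.

Lemma norm_minus_trans {V : NormedModule R_AbsRing} (x y z : V) :
  norm (minus x z) <= norm (minus x y) + norm (minus y z).
Proof.
  norm_as V (plus (minus x y) (minus y z)); apply norm_triangle.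
Qed.

Lemma pow_small theta (M e : R) :
  0 <= theta < 1 -> 0 < e ->
  exists N : nat, forall k : nat, (N <= k)%nat -> theta ^ k * M < e.
Proof.
  intros Hth He.
  assert (HM : 0 < Rabs M + 1) by (pose proof (Rabs_pos M); lra).
  destruct (pow_lt_1_zero theta ltac:(rewrite Rabs_pos_eq; lra) (e / (Rabs M + 1)))
    as [N HN]; [apply Rdiv_lt_0_compat; lra |].
  exists N; intros k Hk; specialize (HN k Hk).
  assert (Hp : 0 <= theta ^ k) by (apply pow_le; lra).
  rewrite Rabs_pos_eq in HN by exact Hp.
  apply Rle_lt_trans with (theta ^ k * (Rabs M + 1)).
  - apply Rmult_le_compat_l; [exact Hp | pose proof (Rle_abs M); lra].
  - apply Rlt_le_trans with (e / (Rabs M + 1) * (Rabs M + 1)).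
    + apply Rmult_lt_compat_r; assumption.
    + right; field; lra.
Qed.

Section WeightedContraction.

Context {V : CompleteNormedModule R_AbsRing}.
Context (a b theta W : R) (w : R -> R) (F : (R -> V) -> R -> V).
Context (Hab : a <= b).
Context (Htheta : 0 <= theta < 1).
Context (Hw : forall t, a <= t <= b -> 1 <= w t <= W).
Context (Fcont : forall x : R -> V, continuous_on (Icc a b) x -> continuous_on (Icc a b) (F x)).
Context (Fcontr : forall (x y : R -> V) (B : R),
  continuous_on (Icc a b) x -> continuous_on (Icc a b) y ->
  (forall t, a <= t <= b -> norm (minus (x t) (y t)) <= B * w t) ->
  forall t, a <= t <= b -> norm (minus (F x t) (F y t)) <= theta * B * w t).

Implicit Types x y : R -> V.

Lemma iter_continuous_on k x :
  continuous_on (Icc a b) x -> continuous_on (Icc a b) (Nat.iter k F x).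
Proof. intros Hx; induction k as [|k IH]; simpl; auto. Qed.

Lemma iter_contr k x y B :
  continuous_on (Icc a b) x -> continuous_on (Icc a b) y ->
  (forall t, a <= t <= b -> norm (minus (x t) (y t)) <= B * w t) ->
  forall t, a <= t <= b ->
    norm (minus (Nat.iter k F x t) (Nat.iter k F y t)) <= theta ^ k * B * w t.
Proof.
  intros Hx Hy HB; induction k as [|k IH]; intros t Ht; simpl.
  - rewrite Rmult_1_l; apply HB, Ht.
  - rewrite (Rmult_assoc theta).
    apply Fcontr; [apply iter_continuous_on, Hx | apply iter_continuous_on, Hy | exact IH | exact Ht].
Qed.

Lemma weighted_distance x y :
  continuous_on (Icc a b) x -> continuous_on (Icc a b) y ->
  exists B, 0 < B /\ forall t, a <= t <= b -> norm (minus (x t) (y t)) <= B * w t.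
Proof.
  intros Hx Hy.
  destruct (bounded_on_segment (fun t : R => minus (x (clamp a b t)) (y (clamp a b t))) a b)
    as [B [HB HB']].
  - intros t; apply (@continuous_minus _ _ V (fun t : R => x (clamp a b t)) (fun t : R => y (clamp a b t)));
      [revert t; apply continuous_on_clamp; [exact Hab | exact Hx]
      | revert t; apply continuous_on_clamp; [exact Hab | exact Hy]].
  - exists B; split; [exact HB |]; intros t Ht; specialize (HB' t Ht); cbv beta in HB'.
    rewrite clamp_id in HB' by exact Ht.
    apply Rle_trans with (1 := HB'); destruct (Hw t Ht) as [H1 _].
    rewrite <- (Rmult_1_r B) at 1; apply Rmult_le_compat_l; lra.
Qed.

Lemma iter_fixed k x :
  continuous_on (Icc a b) x -> (forall t, a <= t <= b -> F x t = x t) ->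
  forall t, a <= t <= b -> Nat.iter k F x t = x t.
Proof.
  intros Hx Hfix; induction k as [|k IH]; intros t Ht; simpl; [reflexivity |].
  rewrite <- (Hfix t Ht).
  (* The iterate and x agree on [a,b] only and may differ elsewhere. The contraction estimate with B
     = 0 shows that F does not see this difference. *)
  assert (H : norm (minus (F (Nat.iter k F x) t) (F x t)) <= theta * 0 * w t).
  { apply Fcontr; [apply iter_continuous_on, Hx | exact Hx | | exact Ht].
    intros u Hu; rewrite (IH u Hu), Rmult_0_l.
    norm_as V (@zero V); exact (Req_le _ _ (@norm_zero _ V)). }
  rewrite Rmult_0_r, Rmult_0_l in H.
  assert (H0 : minus (F (Nat.iter k F x) t) (F x t) = zero).
  { apply (@norm_eq_zero _ V), Rle_antisym; [exact H | apply (@norm_ge_0 _ V)]. }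
  replace (F (Nat.iter k F x) t)
    with (plus (minus (F (Nat.iter k F x) t) (F x t)) (F x t)) by vector V.
  rewrite H0; vector V.
Qed.

Lemma iter_unif_lim x x0 :
  continuous_on (Icc a b) x -> (forall t, a <= t <= b -> F x t = x t) ->
  continuous_on (Icc a b) x0 ->
  unif_lim_on (Icc a b) (fun k => Nat.iter k F x0) x.
Proof.
  intros Hx Hfix Hx0 e.
  destruct (weighted_distance x0 x Hx0 Hx) as [B [HB HB']].
  destruct (pow_small theta (B * W) e Htheta (cond_pos e)) as [N HN].
  exists N; intros k Hk t Ht; specialize (HN k Hk).
  pose proof (iter_contr k x0 x B Hx0 Hx HB' t Ht) as H.
  rewrite (iter_fixed k x Hx Hfix t Ht) in H.
  apply Rle_lt_trans with (1 := H); apply Rle_lt_trans with (2 := HN).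
  rewrite <- Rmult_assoc; apply Rmult_le_compat_l; [| apply Hw, Ht].
  apply Rmult_le_pos; [apply pow_le |]; lra.
Qed.

Lemma fixed_point_unique x y :
  continuous_on (Icc a b) x -> (forall t, a <= t <= b -> F x t = x t) ->
  continuous_on (Icc a b) y -> (forall t, a <= t <= b -> F y t = y t) ->
  forall t, a <= t <= b -> y t = x t.
Proof.
  intros Hx Hfx Hy Hfy t Ht.
  assert (H0 : minus (y t) (x t) = zero).
  { apply (@norm_eq_zero _ V), Rle_antisym; [| apply (@norm_ge_0 _ V)].
    apply le_epsilon; intros e He; rewrite Rplus_0_l.
    destruct (iter_unif_lim x y Hx Hfx Hy (mkposreal e He)) as [N HN].
    specialize (HN N (le_n N) t Ht); rewrite (iter_fixed N y Hy Hfy t Ht) in HN.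
    left; exact HN. }
  replace (y t) with (plus (minus (y t) (x t)) (x t)) by vector V.
  rewrite H0; vector V.
Qed.

Lemma unif_lim_continuous_on (u : nat -> R -> V) x :
  (forall k, continuous_on (Icc a b) (u k)) -> unif_lim_on (Icc a b) u x ->
  continuous_on (Icc a b) x.
Proof.
  intros Hu Hlim; apply continuous_on_clamp; [exact Hab |]; intros t.
  apply (@continuous_line_iff V); intros e He.
  destruct (Hlim (mkposreal (e / 3) ltac:(lra))) as [N HN]; simpl in HN.
  specialize (HN N (le_n N)).
  pose proof (proj1 (continuous_on_clamp a b (u N) Hab) (Hu N) t) as Hc.
  destruct (proj1 (@continuous_line_iff V _ t) Hc (e / 3) ltac:(lra)) as [d [Hd Hd']].
  exists d; split; [exact Hd |]; intros s Hs; specialize (Hd' s Hs); cbv beta in *.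
  pose proof (HN _ (clamp_in a b s Hab)) as H1.
  pose proof (HN _ (clamp_in a b t Hab)) as H2.
  rewrite (@norm_minus_sym V) in H1.
  apply Rle_lt_trans with (1 := @norm_minus_trans V _ (u N (clamp a b s)) _).
  replace e with (e / 3 + (e / 3 + e / 3)) by field.
  apply Rplus_lt_compat; [exact H1 |].
  apply Rle_lt_trans with (1 := @norm_minus_trans V _ (u N (clamp a b t)) _).
  apply Rplus_lt_compat; assumption.
Qed.

Lemma iter_cauchy x0 :
  continuous_on (Icc a b) x0 ->
  exists B, 0 < B /\ forall k m t, a <= t <= b ->
    norm (minus (Nat.iter (k + m) F x0 t) (Nat.iter k F x0 t)) <= theta ^ k * B * w t.
Proof.
  intros Hx0.
  destruct (weighted_distance (F x0) x0 (Fcont x0 Hx0) Hx0) as [B [HB HB']].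
  (* The sum of the geometric series with first term B. It solves theta * C + B = C, so the
     induction on m closes without partial sums. *)
  exists (B / (1 - theta)); split; [apply Rdiv_lt_0_compat; lra |].
  assert (Hsum : forall m t, a <= t <= b ->
            norm (minus (Nat.iter m F x0 t) (x0 t)) <= B / (1 - theta) * w t).
  { induction m as [|m IH]; intros t Ht; simpl.
    - norm_as V (@zero V); apply Rle_trans with 0; [exact (Req_le _ _ (@norm_zero _ V)) |].
      apply Rmult_le_pos; [apply Rlt_le, Rdiv_lt_0_compat; lra |].
      destruct (Hw t Ht); lra.
    - apply Rle_trans with (1 := @norm_minus_trans V _ (F x0 t) _).
      replace (B / (1 - theta) * w t) with (theta * (B / (1 - theta)) * w t + B * w t)
        by (field; lra).
      apply Rplus_le_compat; [| apply HB', Ht].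
      apply Fcontr; [apply iter_continuous_on, Hx0 | exact Hx0 | exact IH | exact Ht]. }
  intros k m t Ht.
  replace (Nat.iter (k + m) F x0) with (Nat.iter k F (Nat.iter m F x0)).
  - apply iter_contr; [apply iter_continuous_on, Hx0 | exact Hx0 | apply Hsum | exact Ht].
  - clear; induction k as [|k IH]; simpl; [reflexivity | rewrite IH; reflexivity].
Qed.

(** The limit is taken pointwise, by completeness of V. The weighted Cauchy estimate makes the
    convergence uniform, hence the limit continuous, and only then may the contraction property be
    applied to it. *)
Lemma fixed_point_exists x0 :
  continuous_on (Icc a b) x0 ->
  exists x : R -> V, continuous_on (Icc a b) x /\ forall t, a <= t <= b -> F x t = x t.
Proof.
  intros Hx0; destruct (iter_cauchy x0 Hx0) as [B [HB HC]].
  assert (HW : 0 <= B * W).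
  { destruct (Hw a ltac:(lra)); apply Rmult_le_pos; lra. }
  assert (HCW : forall k m t, a <= t <= b ->
    norm (minus (Nat.iter (k + m) F x0 t) (Nat.iter k F x0 t)) <= theta ^ k * (B * W)).
  { intros k m t Ht; apply Rle_trans with (1 := HC k m t Ht).
    rewrite <- Rmult_assoc; apply Rmult_le_compat_l; [| apply Hw, Ht].
    apply Rmult_le_pos; [apply pow_le |]; lra. }
  (* Stated for all t, with an arbitrary value outside [a,b], so that [epsilon] can select a total
     limit function. *)
  assert (Hlim : forall t, exists y : V, a <= t <= b ->
            forall e, 0 < e -> exists N, forall k, (N <= k)%nat ->
              norm (minus (Nat.iter k F x0 t) y) < e).
  { intros t; destruct (classic (a <= t <= b)) as [Ht | Ht];
      [| exists zero; intros; contradiction].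
    assert (Hy : exists y : V, filterlim (fun k => Nat.iter k F x0 t) eventually (locally y)).
    { apply (@filterlim_locally_cauchy nat V eventually _); intros e.
      destruct (pow_small theta (B * W) (e / 2) Htheta) as [N HN];
        [pose proof (cond_pos e); lra |].
      exists (fun k => (N <= k)%nat); split; [exists N; auto |].
      assert (HN' : forall k, (N <= k)%nat ->
                norm (minus (Nat.iter k F x0 t) (Nat.iter N F x0 t)) < e / 2).
      { intros k Hk; replace k with (N + (k - N))%nat by lia.
        apply Rle_lt_trans with (1 := HCW N (k - N)%nat t Ht), HN; lia. }
      intros u v Hu Hv; apply (@norm_compat1 _ V).
      apply Rle_lt_trans with (1 := @norm_minus_trans V _ (Nat.iter N F x0 t) _).
      replace (pos e) with (e / 2 + e / 2) by field.
      apply Rplus_lt_compat; [apply HN', Hv |].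
      rewrite (@norm_minus_sym V); apply HN', Hu. }
    destruct Hy as [y Hy]; exists y; intros _ e He.
    exact (proj1 (@filterlim_norm_iff nat V eventually _ _ y) Hy e He). }
  set (x := fun t : R => epsilon (inhabits (zero : V)) (fun y : V => a <= t <= b ->
            forall e, 0 < e -> exists N, forall k, (N <= k)%nat ->
              norm (minus (Nat.iter k F x0 t) y) < e)).
  assert (Hx : forall t, a <= t <= b -> forall e, 0 < e -> exists N, forall k, (N <= k)%nat ->
              norm (minus (Nat.iter k F x0 t) (x t)) < e).
  { intros t; unfold x; apply (epsilon_spec _ _ (Hlim t)). }
  assert (Hdist : forall k t, a <= t <= b ->
            norm (minus (x t) (Nat.iter k F x0 t)) <= theta ^ k * B * w t).
  { intros k t Ht; apply le_epsilon; intros e He.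
    destruct (Hx t Ht e He) as [N HN].
    specialize (HN (k + N)%nat ltac:(lia)); rewrite (@norm_minus_sym V) in HN.
    apply Rle_trans with (1 := @norm_minus_trans V _ (Nat.iter (k + N) F x0 t) _).
    rewrite Rplus_comm; apply Rplus_le_compat; [apply HC, Ht | left; exact HN]. }
  assert (Hu : unif_lim_on (Icc a b) (fun k => Nat.iter k F x0) x).
  { intros e; destruct (pow_small theta (B * W) e Htheta (cond_pos e)) as [N HN].
    exists N; intros k Hk t Ht; rewrite (@norm_minus_sym V).
    apply Rle_lt_trans with (2 := HN k Hk).
    apply Rle_trans with (1 := Hdist k t Ht).
    rewrite <- Rmult_assoc; apply Rmult_le_compat_l; [| apply Hw, Ht].
    apply Rmult_le_pos; [apply pow_le |]; lra. }
  assert (Hxc : continuous_on (Icc a b) x).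
  { apply (unif_lim_continuous_on (fun k => Nat.iter k F x0)); [| exact Hu].
    intros k; apply iter_continuous_on, Hx0. }
  exists x; split; [exact Hxc |]; intros t Ht.
  assert (H0 : minus (F x t) (x t) = zero).
  { apply (@norm_eq_zero _ V), Rle_antisym; [| apply (@norm_ge_0 _ V)].
    apply le_epsilon; intros e He; rewrite Rplus_0_l.
    (* F x and x both lie within theta ^ N * (B * W) of the iterate of rank N + 1, whence the factor
       2. *)
    destruct (pow_small theta (2 * (B * W)) e Htheta He) as [N HN].
    specialize (HN N (le_n N)).
    assert (Hp : 0 <= theta ^ N) by (apply pow_le; lra).
    assert (HWt : theta ^ N * B * w t <= theta ^ N * (B * W)).
    { rewrite <- Rmult_assoc; apply Rmult_le_compat_l; [| apply Hw, Ht].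
      apply Rmult_le_pos; lra. }
    assert (HWt0 : 0 <= theta ^ N * B * w t).
    { destruct (Hw t Ht); apply Rmult_le_pos; [apply Rmult_le_pos |]; lra. }
    apply Rle_trans with (1 := @norm_minus_trans V _ (F (Nat.iter N F x0) t) _).
    apply Rle_trans with (theta ^ N * (B * W) + theta ^ N * (B * W)); [| lra].
    apply Rplus_le_compat.
    - apply Rle_trans with (theta * (theta ^ N * B) * w t).
      + apply Fcontr; [exact Hxc | apply iter_continuous_on, Hx0 | apply Hdist | exact Ht].
      + nra.
    - rewrite (@norm_minus_sym V).
      apply Rle_trans with (1 := Hdist (S N) t Ht); simpl; nra. }
  replace (F x t) with (plus (minus (F x t) (x t)) (x t)) by vector V.
  rewrite H0; vector V.
Qed.

End WeightedContraction.

(** * The curves and the regions between them *)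

Lemma strictly_inside a b s e :
  a < b -> a <= s <= b -> 0 < e -> exists s', a < s' < b /\ Rabs (s' - s) < e.
Proof.
  intros Hab Hs He.
  set (mu := Rmin (1 / 2) (e / (b - a))).
  assert (Hmu : 0 < mu) by (apply Rmin_pos; [lra | apply Rdiv_lt_0_compat; lra]).
  assert (Hmu1 : mu <= 1 / 2) by apply Rmin_l.
  assert (Hmu2 : mu * (b - a) <= e).
  { apply Rle_trans with (e / (b - a) * (b - a)).
    - apply Rmult_le_compat_r; [lra | apply Rmin_r].
    - right; field; lra. }
  (* A convex combination with positive weight on the midpoint is interior, and it moves s by at
     most mu * (b - a) / 2 <= e / 2. *)
  exists (s + mu * ((a + b) / 2 - s)); split; [split; nra |].
  replace (s + mu * ((a + b) / 2 - s) - s) with (mu * ((a + b) / 2 - s)) by ring.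
  apply Rabs_def1; nra.
Qed.

(** Carries identities obtained by differentiation on the open interval over to the end points,
    where no two-sided derivative is at hand. *)
Lemma zero_on_closure {V : CompleteNormedModule R_AbsRing} (g : R -> V) T :
  0 < T -> continuous_on (Icc 0 T) g -> (forall t, 0 < t < T -> g t = zero) ->
  forall t, 0 <= t <= T -> g t = zero.
Proof.
  intros hT Hg H t Ht; apply (@norm_eq_zero _ V), Rle_antisym; [| apply (@norm_ge_0 _ V)].
  apply le_epsilon; intros e He; rewrite Rplus_0_l.
  pose proof (proj1 (continuous_on_clamp 0 T g ltac:(lra)) Hg t) as Hc.
  destruct (proj1 (@continuous_line_iff V _ t) Hc e He) as [d [Hd Hd']].
  destruct (strictly_inside 0 T t d hT Ht Hd) as [s [Hs Hst]].
  specialize (Hd' s Hst); cbv beta in Hd'.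
  rewrite !clamp_id, (H s Hs) in Hd' by lra.
  left; apply Rle_lt_trans with (2 := Hd').
  apply Req_le; rewrite (@norm_minus_sym V); f_equal; vector V.
Qed.

(** By density of (0,T). It turns the strict ordering of the curves on the open interval into the
    weak ordering at 0 and at T. *)
Lemma le_on_closure (g k : R -> R) T :
  0 < T -> continuous_on (Icc 0 T) g -> continuous_on (Icc 0 T) k ->
  (forall t, 0 < t < T -> g t <= k t) -> forall t, 0 <= t <= T -> g t <= k t.
Proof.
  intros hT Hg Hk H t Ht; apply le_epsilon; intros e He.
  pose proof (proj1 (continuous_on_clamp 0 T g ltac:(lra)) Hg t) as Hcg.
  pose proof (proj1 (continuous_on_clamp 0 T k ltac:(lra)) Hk t) as Hck.
  destruct (proj1 (continuous_line_iff _ t) Hcg (e / 2) ltac:(lra)) as [d1 [Hd1 Hd1']].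
  destruct (proj1 (continuous_line_iff _ t) Hck (e / 2) ltac:(lra)) as [d2 [Hd2 Hd2']].
  destruct (strictly_inside 0 T t (Rmin d1 d2) hT Ht) as [s [Hs Hst]];
    [apply Rmin_pos; assumption |].
  specialize (Hd1' s (Rlt_le_trans _ _ _ Hst (Rmin_l _ _))).
  specialize (Hd2' s (Rlt_le_trans _ _ _ Hst (Rmin_r _ _))).
  rewrite !clamp_id in Hd1', Hd2' by lra.
  change (Rabs (g s - g t) < e / 2) in Hd1'.
  change (Rabs (k s - k t) < e / 2) in Hd2'.
  apply Rabs_def2 in Hd1'; apply Rabs_def2 in Hd2'; specialize (H s Hs); lra.
Qed.

Lemma is_derive_within_interior {V : NormedModule R_AbsRing} a b (g : R -> V) t l :
  a < t < b -> is_derive_within (Icc a b) g t l -> is_derive g t l.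
Proof.
  intros Ht H; apply is_derive_line_iff; intros e He.
  destruct H as [_ H].
  assert (Hlim : is_filter_lim (within (Icc a b) (locally t)) t).
  { intros P HP; unfold within; revert HP; apply filter_imp; auto. }
  destruct (H t Hlim (mkposreal e He)) as [d Hd].
  exists (Rmin d (Rmin (t - a) (b - t))); split.
  - apply Rmin_pos; [apply cond_pos | apply Rmin_pos; lra].
  - intros t' Ht'; apply (Hd t').
    + apply Rlt_le_trans with (1 := Ht'), Rmin_l.
    + assert (H1 : Rabs (t' - t) < Rmin (t - a) (b - t))
        by (apply Rlt_le_trans with (1 := Ht'), Rmin_r).
      pose proof (Rlt_le_trans _ _ _ H1 (Rmin_l _ _)) as H2.
      pose proof (Rlt_le_trans _ _ _ H1 (Rmin_r _ _)) as H3.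
      apply Rabs_def2 in H2; apply Rabs_def2 in H3; unfold Icc; lra.
Qed.

Lemma is_derive_within_limit {V : NormedModule R_AbsRing} a b (g : R -> V) t l :
  a <= t <= b -> is_derive_within (Icc a b) g t l ->
  filterlim g (within (Icc a b) (locally t)) (locally (g t)).
Proof.
  intros Ht [_ H]; apply (filterlim_norm_iff _); intros e He.
  assert (Hlim : is_filter_lim (within (Icc a b) (locally t)) t).
  { intros P HP; unfold within; revert HP; apply filter_imp; auto. }
  destruct (H t Hlim (mkposreal 1 Rlt_0_1)) as [d Hd].
  pose proof (norm_ge_0 l) as Hl.
  assert (Hr : 0 < Rmin d (e / (norm l + 2))).
  { apply Rmin_pos; [apply cond_pos | apply Rdiv_lt_0_compat; lra]. }
  exists (mkposreal _ Hr); intros u Hu Hab.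
  change (Rabs (u - t) < Rmin d (e / (norm l + 2))) in Hu.
  specialize (Hd u (Rlt_le_trans _ _ _ Hu (Rmin_l _ _)) Hab).
  change (norm (minus (minus (g u) (g t)) (scal (u - t) l)) <= 1 * Rabs (u - t)) in Hd.
  pose proof (Rlt_le_trans _ _ _ Hu (Rmin_r _ _)) as Hu'.
  norm_as V (plus (minus (minus (g u) (g t)) (scal (u - t) l)) (scal (u - t) l)).
  apply Rle_lt_trans with (1 := norm_triangle _ _).
  pose proof (norm_scal (V := V) (u - t) l) as Hs.
  change (abs (u - t)) with (Rabs (u - t)) in Hs.
  apply Rle_lt_trans with (1 * Rabs (u - t) + Rabs (u - t) * norm l);
    [apply Rplus_le_compat; assumption |].
  apply Rle_lt_trans with (Rabs (u - t) * (norm l + 2)).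
  - pose proof (Rabs_pos (u - t)); nra.
  - apply Rlt_le_trans with (e / (norm l + 2) * (norm l + 2)).
    + apply Rmult_lt_compat_r; lra.
    + right; field; lra.
Qed.

Lemma C1_on_continuous {V : NormedModule R_AbsRing} a b (g dg : R -> V) :
  C1_on a b g dg -> continuous_on (Icc a b) g.
Proof. intros [H _] t Ht; exact (is_derive_within_limit a b g t _ Ht (H t Ht)). Qed.

Section Curves.

Context (T : R) (n : nat) (alpha dalpha : nat -> R -> R).
Context (hT : 0 < T) (hn : (1 <= n)%nat).
Context (halpha : admissible_curves T n alpha dalpha).

Lemma curve_first t : curve n alpha 0 t = 0.
Proof. reflexivity. Qed.

Lemma curve_last t : curve n alpha n t = t.
Proof.
  unfold curve; destruct (Nat.eqb_spec n 0); [lia |].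
  rewrite Nat.eqb_refl; reflexivity.
Qed.

Lemma dcurve_last t : dcurve n dalpha n t = 1.
Proof.
  unfold dcurve; destruct (Nat.eqb_spec n 0); [lia |].
  rewrite Nat.eqb_refl; reflexivity.
Qed.

Lemma curve_mid i t : (1 <= i < n)%nat -> curve n alpha i t = alpha i t.
Proof.
  intros Hi; unfold curve; destruct (Nat.eqb_spec i 0); [lia |].
  destruct (Nat.eqb_spec i n); [lia | reflexivity].
Qed.

Lemma dcurve_mid i t : (1 <= i < n)%nat -> dcurve n dalpha i t = dalpha i t.
Proof.
  intros Hi; unfold dcurve; destruct (Nat.eqb_spec i 0); [lia |].
  destruct (Nat.eqb_spec i n); [lia | reflexivity].
Qed.

Lemma curve_index_cases i :
  (i <= n)%nat -> i = 0%nat \/ i = n \/ (1 <= i < n)%nat.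
Proof. lia. Qed.

Lemma curve_continuous_on i : (i <= n)%nat -> continuous_on (Icc 0 T) (curve n alpha i).
Proof.
  intros Hi; destruct (curve_index_cases i Hi) as [-> | [-> | Hm]].
  - apply (continuous_on_ext _ (fun _ => 0)); [reflexivity |].
    apply continuous_on_forall; intros; apply continuous_const.
  - apply (continuous_on_ext _ (fun t => t)); [intros; symmetry; apply curve_last |].
    apply continuous_on_forall; intros; apply continuous_id.
  - apply (continuous_on_ext _ (alpha i)); [intros; symmetry; apply curve_mid, Hm |].
    destruct (proj1 halpha i Hm) as [H _]; exact (C1_on_continuous 0 T _ _ H).
Qed.

Lemma curve_continuous i t :
  (i <= n)%nat -> continuous (fun u : R => curve n alpha i (clamp 0 T u)) t.
Proof.
  intros Hi; revert t; apply continuous_on_clamp; [lra | apply curve_continuous_on, Hi].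
Qed.

Lemma curve_derive i t :
  (i <= n)%nat -> 0 < t < T -> is_derive (curve n alpha i) t (dcurve n dalpha i t).
Proof.
  intros Hi Ht; destruct (curve_index_cases i Hi) as [-> | [-> | Hm]].
  - apply (is_derive_ext (fun _ => 0)); [reflexivity |].
    apply (@is_derive_const _ R_NormedModule).
  - rewrite dcurve_last.
    apply (is_derive_ext (fun t => t)); [intros; symmetry; apply curve_last |].
    apply (@is_derive_id R_AbsRing).
  - rewrite dcurve_mid by exact Hm.
    apply (is_derive_ext (alpha i)); [intros; symmetry; apply curve_mid, Hm |].
    destruct (proj1 halpha i Hm) as [[H _] _].
    apply (is_derive_within_interior 0 T); [exact Ht | apply H; unfold Icc; lra].
Qed.

Lemma curve_at_0 i : (i <= n)%nat -> curve n alpha i 0 = 0.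
Proof.
  intros Hi; destruct (curve_index_cases i Hi) as [-> | [-> | Hm]].
  - reflexivity.
  - apply curve_last.
  - rewrite curve_mid by exact Hm; apply (proj1 halpha i Hm).
Qed.

Lemma curve_le_S i t : (i < n)%nat -> 0 <= t <= T -> curve n alpha i t <= curve n alpha (S i) t.
Proof.
  intros Hi; revert t; apply le_on_closure; [exact hT | | |].
  - apply curve_continuous_on; lia.
  - apply curve_continuous_on; lia.
  - intros t Ht; left; apply (proj1 (proj2 halpha) t i Ht Hi).
Qed.

Lemma curve_mono i j t :
  (i <= j <= n)%nat -> 0 <= t <= T -> curve n alpha i t <= curve n alpha j t.
Proof.
  intros [Hij Hj] Ht; induction Hij as [|j Hij IH]; [lra |].
  apply Rle_trans with (1 := IH ltac:(lia)); apply curve_le_S; [lia | exact Ht].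
Qed.

Lemma curve_bounds i t : (i <= n)%nat -> 0 <= t <= T -> 0 <= curve n alpha i t <= t.
Proof.
  intros Hi Ht; split.
  - rewrite <- (curve_first t); apply curve_mono; [lia | exact Ht].
  - rewrite <- (curve_last t) at 2; apply curve_mono; [lia | exact Ht].
Qed.

(** For t < T the next curve separates alpha_i from the diagonal; at T the ordering may degenerate,
    and the condition alpha_i(T) < T takes over. Including T is what allows a positive minimum of
    the delay on a closed segment. *)
Lemma curve_lt_diag i t : (1 <= i < n)%nat -> 0 < t <= T -> alpha i t < t.
Proof.
  intros Hi Ht; destruct (Rle_lt_or_eq_dec t T (proj2 Ht)) as [HtT | ->].
  - rewrite <- (curve_mid i t Hi).
    apply Rlt_le_trans with (curve n alpha (S i) t).
    + apply (proj1 (proj2 halpha)); [lra | lia].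
    + rewrite <- (curve_last t) at 2; apply curve_mono; [lia | lra].
  - apply (proj1 halpha i Hi).
Qed.

(** The slices of a region at t = 0 and t = T are empty, so t is moved to t' inside (0,T); then s is
    truncated to the slice at t', a small move because the curves are continuous, and pushed
    strictly inside that slice. This makes the kernels available up to the curves and at both end
    times. *)
Lemma closure_region i t s :
  (1 <= i <= n)%nat -> 0 <= t <= T ->
  curve n alpha (i - 1) t <= s <= curve n alpha i t ->
  closure (region T n alpha i) (t, s).
Proof.
  intros Hi Ht Hs e; pose proof (cond_pos e) as He.
  destruct (proj1 (continuous_line_iff _ t) (curve_continuous (i - 1) t ltac:(lia))
              (e / 2) ltac:(lra)) as [d1 [Hd1 Hd1']].
  destruct (proj1 (continuous_line_iff _ t) (curve_continuous i t ltac:(lia))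
              (e / 2) ltac:(lra)) as [d2 [Hd2 Hd2']].
  destruct (strictly_inside 0 T t (Rmin e (Rmin d1 d2)) hT Ht) as [t' [Ht' Htt]].
  { repeat apply Rmin_pos; assumption. }
  pose proof (Rlt_le_trans _ _ _ Htt (Rmin_l _ _)) as Htt0.
  pose proof (Rlt_le_trans _ _ _ Htt (Rmin_r _ _)) as Htt'.
  specialize (Hd1' t' (Rlt_le_trans _ _ _ Htt' (Rmin_l _ _))).
  specialize (Hd2' t' (Rlt_le_trans _ _ _ Htt' (Rmin_r _ _))).
  rewrite !clamp_id in Hd1', Hd2' by lra.
  set (a := curve n alpha (i - 1)) in *; set (b := curve n alpha i) in *.
  assert (Hab : a t' < b t').
  { unfold a, b; replace i with (S (i - 1)) at 2 by lia.
    apply (proj1 (proj2 halpha)); [exact Ht' | lia]. }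
  assert (Hcl : Rabs (clamp (a t') (b t') s - s) < e / 2).
  { rewrite <- (clamp_id (a t) (b t) s Hs) at 2.
    apply clamp_close; [exact Hd1' | exact Hd2' |].
    rewrite Rminus_diag, Rabs_R0; lra. }
  destruct (strictly_inside (a t') (b t') (clamp (a t') (b t') s) (e / 2) Hab)
    as [s' [Hs' Hss]]; [apply clamp_in; lra | lra |].
  exists (t', s'); split.
  - split; [exact Htt0 |]; change (Rabs (s' - s) < e).
    apply Rabs_def2 in Hcl; apply Rabs_def2 in Hss; apply Rabs_def1; lra.
  - split; [exact Ht' |]; split; [| apply Hs'].
    destruct (Nat.eqb_spec i 1) as [Hi1 |]; [| apply Hs'].
    assert (a t' = 0) by (unfold a; rewrite Hi1; reflexivity); lra.
Qed.

(** * Continuous extension of the kernels to the plane *)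

Section Extension.

Context {X : UniformSpace} (G : nat -> R -> R -> X).

(* A continuous extension to the plane of the restriction of [G i] to the
   closure of the i-th region. *)
Definition pext (i : nat) (p : R * R) : X :=
  let t := clamp 0 T (fst p) in
  G i t (clamp (curve n alpha (i - 1) t) (curve n alpha i t) (snd p)).

Lemma pext_eq i t s :
  0 <= t <= T -> curve n alpha (i - 1) t <= s <= curve n alpha i t ->
  pext i (t, s) = G i t s.
Proof.
  intros Ht Hs; unfold pext; simpl fst; simpl snd.
  rewrite (clamp_id 0 T t Ht), clamp_id by exact Hs; reflexivity.
Qed.

(** [phi] takes its values in the closure of the region and is continuous, because the curves are
    continuous after truncation of the time to [0,T]. *)
Lemma pext_continuous i p :
  (1 <= i <= n)%nat ->
  continuous_on (closure (region T n alpha i)) (fun p : R * R => G i (fst p) (snd p)) ->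
  continuous (pext i) p.
Proof.
  intros Hi HG.
  set (phi := fun q : R * R => let t := clamp 0 T (fst q) in
         (t, clamp (curve n alpha (i - 1) t) (curve n alpha i t) (snd q))).
  apply (continuous_on_comp (closure (region T n alpha i))
           (fun p : R * R => G i (fst p) (snd p)) phi); [exact HG | |].
  - intros q; unfold phi; cbv zeta.
    pose proof (clamp_in 0 T (fst q) ltac:(lra)) as Hc.
    apply closure_region; [exact Hi | exact Hc |].
    apply clamp_in, curve_mono; [lia | exact Hc].
  - assert (Hfst : continuous (fun q : R * R => clamp 0 T (fst q)) p).
    { apply (continuous_comp fst (clamp 0 T)); [apply continuous_fst | apply continuous_clamp_id]. }
    assert (Hcurve : forall j, (j <= n)%nat ->
              continuous (fun q : R * R => curve n alpha j (clamp 0 T (fst q))) p).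
    { intros j Hj; apply (continuous_comp fst (fun u : R => curve n alpha j (clamp 0 T u)));
        [apply continuous_fst | apply curve_continuous, Hj]. }
    apply (continuous_comp_2 (fun q : R * R => clamp 0 T (fst q))
             (fun q : R * R => snd (phi q)) (fun u v : R => (u, v))); [exact Hfst | |];
      [| apply continuous_ext with (fun q : R * R => q);
         [intros [u v]; reflexivity | apply continuous_id]].
    apply (continuous_clamp (fun q : R * R => curve n alpha (i - 1) (clamp 0 T (fst q)))
             (fun q : R * R => curve n alpha i (clamp 0 T (fst q))) (fun q : R * R => snd q)).
    + apply Hcurve; lia.
    + apply Hcurve; lia.
    + apply continuous_snd.
Qed.

End Extension.

End Curves.

(** * Finite sums and exponential weights *)

Lemma sum_n_m_morph {G H : AbelianMonoid} (L : G -> H) (u : nat -> G) (v : nat -> H) a b :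
  L zero = zero -> (forall x y, L (plus x y) = plus (L x) (L y)) ->
  (forall k, (a <= k <= b)%nat -> L (u k) = v k) ->
  L (sum_n_m u a b) = sum_n_m v a b.
Proof.
  intros H0 HL Huv.
  transitivity (sum_n_m (fun k => L (u k)) a b).
  2: { apply sum_n_m_ext_loc, Huv. }
  clear Huv; revert a; induction b as [|b IH]; intros a.
  - destruct a as [|a]; [rewrite !sum_n_n; reflexivity |].
    rewrite !sum_n_m_zero by lia; exact H0.
  - destruct (le_lt_dec a (S b)) as [Ha | Ha].
    + rewrite !sum_n_Sm by exact Ha; rewrite HL, IH; reflexivity.
    + rewrite !sum_n_m_zero by exact Ha; exact H0.
Qed.

Lemma blop_sum {X Y : NormedModule R_AbsRing} (L : blop X Y) (u : nat -> X) a b :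
  L (sum_n_m u a b) = sum_n_m (fun k => L (u k)) a b.
Proof.
  apply (sum_n_m_morph (blop_fun L)); [| | reflexivity].
  - exact (linear_zero _ (blop_linear L)).
  - exact (linear_plus _ (blop_linear L)).
Qed.

Lemma sum_n_m_minus {V : NormedModule R_AbsRing} (u v : nat -> V) a b :
  minus (sum_n_m u a b) (sum_n_m v a b) = sum_n_m (fun k => minus (u k) (v k)) a b.
Proof.
  induction b as [|b IH].
  - destruct a as [|a]; [rewrite !sum_n_n; reflexivity |].
    rewrite !sum_n_m_zero by lia; vector V.
  - destruct (le_lt_dec a (S b)) as [Ha | Ha].
    + rewrite !sum_n_Sm by exact Ha; rewrite <- IH; vector V.
    + rewrite !sum_n_m_zero by exact Ha; vector V.
Qed.

Lemma continuous_sum_n_m {U : UniformSpace} {V : NormedModule R_AbsRing}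
    (g : nat -> U -> V) a b p :
  (forall k, (a <= k <= b)%nat -> continuous (g k) p) ->
  continuous (fun q => sum_n_m (fun k => g k q) a b) p.
Proof.
  induction b as [|b IH]; intros H.
  - destruct a as [|a].
    + apply (continuous_ext (g O)); [intros; rewrite sum_n_n; reflexivity | apply H; lia].
    + apply (continuous_ext (fun _ => @zero V)); [| apply continuous_const].
      intros; rewrite sum_n_m_zero by lia; reflexivity.
  - destruct (le_lt_dec a (S b)) as [Ha | Ha].
    + apply (continuous_ext (fun q => plus (sum_n_m (fun k => g k q) a b) (g (S b) q))).
      * intros q; rewrite sum_n_Sm by exact Ha; reflexivity.
      * apply (@continuous_plus U R_AbsRing V); [apply IH; intros k Hk; apply H; lia |].
        apply H; lia.
    + apply (continuous_ext (fun _ => @zero V)); [| apply continuous_const].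
      intros; rewrite sum_n_m_zero by exact Ha; reflexivity.
Qed.

Lemma is_derive_sum_n_m {V : NormedModule R_AbsRing}
    (g : nat -> R -> V) (dg : nat -> V) a b (t : R) :
  (forall k, (a <= k <= b)%nat -> is_derive (g k) t (dg k)) ->
  is_derive (fun u => sum_n_m (fun k => g k u) a b) t (sum_n_m dg a b).
Proof.
  induction b as [|b IH]; intros H.
  - destruct a as [|a].
    + rewrite sum_n_n; apply (is_derive_ext (g O)); [intros; rewrite sum_n_n; reflexivity |].
      apply H; lia.
    + rewrite sum_n_m_zero by lia.
      apply (is_derive_ext (fun _ => @zero V)); [| apply @is_derive_const].
      intros; rewrite sum_n_m_zero by lia; reflexivity.
  - destruct (le_lt_dec a (S b)) as [Ha | Ha].
    + rewrite sum_n_Sm by exact Ha.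
      apply (is_derive_ext (fun q => plus (sum_n_m (fun k => g k q) a b) (g (S b) q))).
      * intros q; rewrite sum_n_Sm by exact Ha; reflexivity.
      * apply @is_derive_plus; [apply IH; intros k Hk; apply H; lia |].
        apply H; lia.
    + rewrite sum_n_m_zero by exact Ha.
      apply (is_derive_ext (fun _ => @zero V)); [| apply @is_derive_const].
      intros; rewrite sum_n_m_zero by exact Ha; reflexivity.
Qed.

Lemma sum_n_m_le_loc (u v : nat -> R) a b :
  (forall k, (a <= k <= b)%nat -> u k <= v k) -> sum_n_m u a b <= sum_n_m v a b.
Proof.
  induction b as [|b IH]; intros H.
  - destruct a as [|a]; [rewrite !sum_n_n; apply H; lia |].
    rewrite !sum_n_m_zero by lia; apply Rle_refl.
  - destruct (le_lt_dec a (S b)) as [Ha | Ha].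
    + rewrite !sum_n_Sm by exact Ha; apply Rplus_le_compat; [| apply H; lia].
      apply IH; intros k Hk; apply H; lia.
    + rewrite !sum_n_m_zero by exact Ha; apply Rle_refl.
Qed.

Lemma sum_n_m_le_const (u : nat -> R) (C : R) m :
  (forall k, (1 <= k <= m)%nat -> u k <= C) -> sum_n_m u 1 m <= INR m * C.
Proof.
  intros H; apply Rle_trans with (1 := sum_n_m_le_loc u (fun _ => C) 1 m H).
  rewrite sum_n_m_const; apply Req_le; do 2 f_equal; lia.
Qed.

Lemma uniform_constant (P : nat -> R -> Prop) m :
  (forall i C C', P i C -> C <= C' -> P i C') ->
  (forall i, (1 <= i <= m)%nat -> exists C, 0 < C /\ P i C) ->
  exists C, 0 < C /\ forall i, (1 <= i <= m)%nat -> P i C.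
Proof.
  intros Hmono; induction m as [|m IH]; intros H.
  - exists 1; split; [lra | intros; lia].
  - destruct IH as [C [HC HC']]; [intros i Hi; apply H; lia |].
    destruct (H (S m) ltac:(lia)) as [C1 [HC1 HC1']].
    exists (Rmax C C1); split; [apply Rlt_le_trans with (1 := HC), Rmax_l |].
    intros i Hi; destruct (Nat.eq_dec i (S m)) as [-> | Hne].
    + apply Hmono with (1 := HC1'), Rmax_r.
    + apply Hmono with C; [apply HC'; lia | apply Rmax_l].
Qed.

Lemma continuous_along {U : UniformSpace} (g : R * R -> U) (a b : R -> R) (t : R) :
  continuous g (a t, b t) -> continuous a t -> continuous b t ->
  continuous (fun u : R => g (a u, b u)) t.
Proof.
  intros Hg Ha Hb; apply (continuous_comp_2 a b (fun u v => g (u, v))); [exact Ha | exact Hb |].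
  apply continuous_ext with (2 := Hg); intros [u v]; reflexivity.
Qed.

Lemma is_RInt_scaled_exp lam M u v :
  0 < lam ->
  is_RInt (fun s : R => M * exp (lam * s)) u v (M / lam * exp (lam * v) - M / lam * exp (lam * u)).
Proof.
  intros Hlam; apply (is_RInt_derive (fun s : R => M / lam * exp (lam * s))).
  - intros s _; auto_derive; [trivial | field; lra].
  - intros s _; apply (ex_derive_continuous (fun s : R => M * exp (lam * s))).
    auto_derive; trivial.
Qed.

Lemma exp_opp_le y : 0 < y -> exp (- y) <= / y.
Proof.
  intros Hy; rewrite exp_Ropp; apply Rinv_le_contravar; [exact Hy |].
  pose proof (exp_ineq1_le y); lra.
Qed.

Lemma exp_mono y z : y <= z -> exp y <= exp z.
Proof.
  intros [H | ->]; [left; apply exp_increasing, H | apply Rle_refl].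
Qed.

Lemma is_derive_blop_eval {X Y : NormedModule R_AbsRing} (L : R -> blop X Y) (t : R)
    (D : blop X Y) (w : X) :
  is_derive L t D -> is_derive (fun u : R => L u w) t (D w).
Proof.
  intros HL; apply is_derive_line_iff; intros e He.
  assert (Hw : 0 < norm w + 1) by (pose proof (norm_ge_0 w); lra).
  destruct (proj1 (@is_derive_line_iff (blop_NormedModule X Y) L t D) HL (e / (norm w + 1)))
    as [d [Hd Hd']]; [apply Rdiv_lt_0_compat; lra |].
  exists d; split; [exact Hd |]; intros u Hu; specialize (Hd' u Hu).
  change (norm ((minus (minus (L u) (L t)) (scal (u - t) D) : blop X Y) w)
            <= e * Rabs (u - t)).
  apply Rle_trans with (1 := blop_norm_app_le _ w).
  apply Rle_trans with (e / (norm w + 1) * Rabs (u - t) * norm w).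
  - apply Rmult_le_compat_r; [apply norm_ge_0 | exact Hd'].
  - apply Rle_trans with (e / (norm w + 1) * Rabs (u - t) * (norm w + 1)).
    + apply Rmult_le_compat_l; [| lra].
      apply Rmult_le_pos; [left; apply Rdiv_lt_0_compat; lra | apply Rabs_pos].
    + right; field; lra.
Qed.

(** Regroups boundary terms by curve: the term at the upper end of piece i meets the one at the
    lower end of piece i + 1, both taken on the i-th curve; only the two outermost terms stay
    alone. *)
Lemma sum_n_m_telescope {V : NormedModule R_AbsRing} (u v : nat -> V) m :
  sum_n_m (fun i => minus (u i) (v i)) 1 (S m) =
  plus (minus (u (S m)) (v 1%nat)) (sum_n_m (fun i => minus (u i) (v (S i))) 1 m).
Proof.
  induction m as [|m IH].
  - rewrite sum_n_n, sum_n_m_zero by lia; vector V.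
  - rewrite sum_n_Sm, IH by lia; rewrite (sum_n_Sm _ 1 m) by lia; vector V.
Qed.

(** The derivative is given on the open interval only, so g t is compared with g u for a small u >
    0, and continuity at 0 finishes. *)
Lemma zero_of_derive {V : CompleteNormedModule R_AbsRing} (g : R -> V) T :
  0 < T -> continuous_on (Icc 0 T) g -> g 0 = zero ->
  (forall t, 0 < t < T -> is_derive g t zero) ->
  forall t, 0 <= t <= T -> g t = zero.
Proof.
  intros hT Hg H0 Hd; apply zero_on_closure; [exact hT | exact Hg |].
  intros t Ht; apply (@norm_eq_zero _ V), Rle_antisym; [| apply (@norm_ge_0 _ V)].
  apply le_epsilon; intros e He; rewrite Rplus_0_l.
  pose proof (proj1 (continuous_on_clamp 0 T g ltac:(lra)) Hg 0) as Hc.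
  destruct (proj1 (@continuous_line_iff V _ 0) Hc e He) as [d [Hd0 Hd']].
  set (u := Rmin (d / 2) (t / 2)).
  assert (Hu : 0 < u) by (apply Rmin_pos; lra).
  pose proof (Rmin_l (d / 2) (t / 2) : u <= d / 2) as Hu1.
  pose proof (Rmin_r (d / 2) (t / 2) : u <= t / 2) as Hu2.
  specialize (Hd' u); rewrite Rminus_0_r, Rabs_pos_eq in Hd' by lra.
  specialize (Hd' ltac:(lra)); cbv beta in Hd'; rewrite !clamp_id in Hd' by lra.
  rewrite <- (@eq_is_derive V g u t) by (intros; try apply Hd; lra).
  left; apply Rle_lt_trans with (2 := Hd'); apply Req_le, f_equal; rewrite H0; vector V.
Qed.

(** * The equation of the second kind *)

Section SecondKind.

Context {E1 E2 : CompleteNormedModule R_AbsRing}.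
Context (T : R) (n : nat) (alpha dalpha : nat -> R -> R).
Context (K K1 : nat -> R -> R -> blop E1 E2) (Kinv : R -> blop E2 E1).
Context (hT : 0 < T) (hn : (1 <= n)%nat).
Context (halpha : admissible_curves T n alpha dalpha).
Context (hK : forall i, (1 <= i <= n)%nat ->
     continuous_on (closure (region T n alpha i))
       (fun p : R * R => K i (fst p) (snd p))).
Context (hK1 : forall i, (1 <= i <= n)%nat ->
     continuous_on (closure (region T n alpha i))
       (fun p : R * R => K1 i (fst p) (snd p))).
Context (hKinv : forall t, 0 <= t <= T -> blop_is_inverse (K n t t) (Kinv t)).
Context (hD0 : Dfun n alpha dalpha K Kinv 0 < 1).

Implicit Types x y : R -> E1.

Local Notation cl := (clamp 0 T).
Local Notation A := (Aop n alpha dalpha K Kinv).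
Local Notation Kon := (Kop_on n alpha K1 Kinv).

Lemma cl_in t : 0 <= cl t <= T.
Proof. apply clamp_in; lra. Qed.

Lemma cl_id t : 0 <= t <= T -> cl t = t.
Proof. apply clamp_id. Qed.

Lemma diagonal_continuous (t : R) : continuous (fun u : R => K n (cl u) (cl u)) t.
Proof.
  apply (continuous_ext (fun u : R => pext T n alpha K n (cl u, cl u))).
  - intros u; pose proof (cl_in u) as Hu; apply pext_eq; [exact Hu |].
    rewrite (curve_last n alpha hn); split; [| lra].
    apply (curve_bounds T n alpha dalpha hT hn halpha); [lia | exact Hu].
  - apply (continuous_along (pext T n alpha K n) cl cl);
      [| apply continuous_clamp_id | apply continuous_clamp_id].
    apply (pext_continuous T n alpha dalpha hT hn halpha); [lia | apply hK; lia].
Qed.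

(** The inverses are given pointwise in t. Their continuity in operator norm comes from that of K_n
    on the diagonal, which is the upper boundary of the last region. *)
Lemma Kinv_continuous (t : R) : continuous (fun u : R => Kinv (cl u)) t.
Proof.
  apply (continuous_inverse (fun u : R => K n (cl u) (cl u))).
  - intros u; apply hKinv, cl_in.
  - apply diagonal_continuous.
Qed.

Lemma alpha_in i t : (1 <= i < n)%nat -> 0 <= t <= T -> 0 <= alpha i t <= t.
Proof.
  intros Hi Ht; rewrite <- (curve_mid n alpha hn i t Hi).
  apply (curve_bounds T n alpha dalpha hT hn halpha); [lia | exact Ht].
Qed.

Lemma alpha_continuous i (t : R) :
  (1 <= i < n)%nat -> continuous (fun u : R => alpha i (cl u)) t.
Proof.
  intros Hi; apply (continuous_ext (fun u : R => curve n alpha i (cl u))).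
  - intros u; apply curve_mid; [exact hn | exact Hi].
  - apply (curve_continuous T n alpha dalpha hT hn halpha); lia.
Qed.

Lemma dalpha_continuous i (t : R) :
  (1 <= i < n)%nat -> continuous (fun u : R => dalpha i (cl u)) t.
Proof.
  intros Hi; revert t; apply (continuous_on_clamp 0 T (dalpha i)); [lra |].
  apply (proj1 halpha i Hi).
Qed.

(** The i-th curve bounds the regions i and i + 1, so either trace is the restriction of a
    continuous extension. *)
Lemma trace_continuous i j (t : R) :
  (1 <= i < n)%nat -> j = i \/ j = S i ->
  continuous (fun u : R => K j (cl u) (alpha i (cl u))) t.
Proof.
  intros Hi Hj.
  apply (continuous_ext (fun u : R => pext T n alpha K j (cl u, alpha i (cl u)))).
  - intros u; pose proof (cl_in u) as Hu; apply pext_eq; [exact Hu |].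
    rewrite <- (curve_mid n alpha hn i (cl u) Hi).
    destruct Hj as [-> | ->].
    + split; [| lra]; apply (curve_mono T n alpha dalpha hT hn halpha); [lia | exact Hu].
    + replace (S i - 1)%nat with i by lia; split; [lra |].
      apply (curve_mono T n alpha dalpha hT hn halpha); [lia | exact Hu].
  - apply (continuous_along (pext T n alpha K j) cl (fun u : R => alpha i (cl u)));
      [| apply continuous_clamp_id | apply alpha_continuous, Hi].
    apply (pext_continuous T n alpha dalpha hT hn halpha); [lia | apply hK; lia].
Qed.

Definition jump i t : blop E1 E2 := minus (K i t (alpha i t)) (K (S i) t (alpha i t)).

Lemma jump_continuous i (t : R) :
  (1 <= i < n)%nat -> continuous (fun u : R => jump i (cl u)) t.
Proof.
  intros Hi; unfold jump.
  apply (@continuous_minus _ _ (blop_NormedModule E1 E2)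
           (fun u : R => K i (cl u) (alpha i (cl u)))
           (fun u : R => K (S i) (cl u) (alpha i (cl u))));
    apply trace_continuous; auto.
Qed.

(** The i-th term of D(t), not to be confused with the exponential weight of the norm. *)
Definition weight i t : R := Rabs (dalpha i t) * norm (blop_comp (Kinv t) (jump i t)).

Lemma weight_continuous i (t : R) :
  (1 <= i < n)%nat -> continuous (fun u : R => weight i (cl u)) t.
Proof.
  intros Hi; unfold weight.
  apply (@continuous_scal _ _ R_NormedModule (fun u : R => Rabs (dalpha i (cl u)))
           (fun u : R => norm (blop_comp (Kinv (cl u)) (jump i (cl u))))).
  - apply (@continuous_norm _ R_NormedModule (fun u : R => dalpha i (cl u))).
    apply dalpha_continuous, Hi.
  - apply (@continuous_norm _ (blop_NormedModule E1 E1)).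
    apply (filterlim_blop_comp (locally t)); [apply Kinv_continuous | apply jump_continuous, Hi].
Qed.

Lemma weight_ge0 i t : 0 <= weight i t.
Proof.
  apply Rmult_le_pos; [apply Rabs_pos | apply (@norm_ge_0 _ (blop_NormedModule E1 E1))].
Qed.

Lemma Dfun_sum t : Dfun n alpha dalpha K Kinv t = sum_n_m (fun i => weight i t) 1 (n - 1).
Proof. reflexivity. Qed.

Lemma Dfun_ge0 t : 0 <= Dfun n alpha dalpha K Kinv t.
Proof.
  rewrite Dfun_sum; apply Rle_trans with (sum_n_m (fun _ => 0) 1 (n - 1)).
  - apply Req_le; symmetry; apply (@sum_n_m_const_zero R_AbelianMonoid).
  - apply sum_n_m_le_loc; intros; apply weight_ge0.
Qed.

Lemma Dfun_continuous (t : R) :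
  continuous (fun u : R => Dfun n alpha dalpha K Kinv (cl u)) t.
Proof.
  apply (@continuous_sum_n_m _ R_NormedModule (fun i (u : R) => weight i (cl u))).
  intros i Hi; apply weight_continuous; lia.
Qed.

(** [Kinv t] is moved under the sum before norms are taken, so that the norm of the composite with
    each jump appears, exactly as in D(t), instead of a product of norms. *)
Lemma Aop_minus_le x y t :
  0 <= t <= T ->
  norm (minus (A x t) (A y t)) <=
  sum_n_m (fun i => weight i t * norm (minus (x (alpha i t)) (y (alpha i t)))) 1 (n - 1).
Proof.
  intros Ht.
  assert (Hsum : minus (A x t) (A y t) =
            sum_n_m (fun i => Kinv t (minus (scal (dalpha i t) (jump i t (x (alpha i t))))
                                       (scal (dalpha i t) (jump i t (y (alpha i t))))))
              1 (n - 1)).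
  { transitivity (Kinv t (minus
        (sum_n_m (fun i => scal (dalpha i t) (jump i t (x (alpha i t)))) 1 (n - 1))
        (sum_n_m (fun i => scal (dalpha i t) (jump i t (y (alpha i t)))) 1 (n - 1)))).
    - symmetry; exact (blop_minus_arg (Kinv t) _ _).
    - rewrite (@sum_n_m_minus E2 _ _ 1 (n - 1)); exact (blop_sum (Kinv t) _ _ _). }
  apply Rle_trans with (1 := Req_le _ _ (f_equal norm Hsum)).
  apply Rle_trans with (1 := @norm_sum_n_m _ E1 _ 1 (n - 1)).
  apply sum_n_m_le_loc; intros i Hi.
  assert (Heq : Kinv t (minus (scal (dalpha i t) (jump i t (x (alpha i t))))
                              (scal (dalpha i t) (jump i t (y (alpha i t))))) =
                scal (dalpha i t) (blop_comp (Kinv t) (jump i t)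
                                     (minus (x (alpha i t)) (y (alpha i t))))).
  { change (blop_comp (Kinv t) (jump i t) (minus (x (alpha i t)) (y (alpha i t))))
      with (Kinv t (jump i t (minus (x (alpha i t)) (y (alpha i t))))).
    rewrite (blop_minus_arg (jump i t) _ _ : jump i t (minus _ _) = minus (jump i t _) (jump i t _)).
    transitivity (Kinv t (scal (dalpha i t)
        (minus (jump i t (x (alpha i t))) (jump i t (y (alpha i t)))))).
    - f_equal; vector E2.
    - exact (linear_scal _ (blop_linear (Kinv t)) _ _). }
  apply Rle_trans with (1 := Req_le _ _ (f_equal norm Heq)).
  apply Rle_trans with (1 := @norm_scal _ E1 (dalpha i t) _).
  unfold weight; rewrite Rmult_assoc.
  apply Rmult_le_compat_l; [apply Rabs_pos |].
  apply (@blop_norm_app_le E1 E1).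
Qed.

Lemma Aop_continuous_on x :
  continuous_on (Icc 0 T) x -> continuous_on (Icc 0 T) (A x).
Proof.
  intros Hx; apply continuous_on_clamp; [lra |]; intros t.
  apply (@continuous_blop_app _ E2 E1 (fun u : R => Kinv (cl u))); [apply Kinv_continuous |].
  apply (@continuous_sum_n_m _ E2 (fun i (u : R) =>
           scal (dalpha i (cl u)) (jump i (cl u) (x (alpha i (cl u)))))).
  intros i Hi.
  apply (@continuous_scal _ _ E2 (fun u : R => dalpha i (cl u))
           (fun u : R => jump i (cl u) (x (alpha i (cl u)))));
    [apply dalpha_continuous; lia |].
  apply (@continuous_blop_app _ E1 E2 (fun u : R => jump i (cl u)));
    [apply jump_continuous; lia |].
  apply (continuous_on_comp (Icc 0 T) x (fun u : R => alpha i (cl u))); [exact Hx | |].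
  - intros u; pose proof (cl_in u).
    pose proof (alpha_in i (cl u) ltac:(lia) (cl_in u)); unfold Icc; lra.
  - apply alpha_continuous; lia.
Qed.

(** The continuous function t - alpha_i(t) attains a positive minimum on [h,T]. The lower bound is
    written [/ C] because it weakens as C grows, which is the monotonicity that [uniform_constant]
    requires. *)
Lemma delay_bound h :
  0 < h <= T -> exists C, 0 < C /\ forall i, (1 <= i <= n - 1)%nat ->
    forall t, h <= t <= T -> / C <= t - alpha i t.
Proof.
  intros Hh.
  destruct (uniform_constant
    (fun i C => 0 < C /\ forall t, h <= t <= T -> / C <= t - alpha i t) (n - 1))
    as [C [HC H]].
  - intros i C C' [HC H] HCC; split; [lra |]; intros t Ht.
    apply Rle_trans with (2 := H t Ht), Rinv_le_contravar; assumption.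
  - intros i Hi.
    destruct (continuity_ab_min (fun u => cl u - alpha i (cl u)) h T) as [m [Hm Hm']]; [lra | |].
    + intros u Hu; apply continuity_pt_filterlim.
      apply (@continuous_minus _ _ R_NormedModule cl (fun u : R => alpha i (cl u))).
      * apply continuous_clamp_id.
      * apply alpha_continuous; lia.
    + set (d := m - alpha i m).
      assert (Hd : 0 < d).
      { pose proof (curve_lt_diag T n alpha dalpha hT hn halpha i m ltac:(lia) ltac:(lra)).
        unfold d; lra. }
      exists (/ d); pose proof (Rinv_0_lt_compat d Hd).
      split; [assumption |]; split; [assumption |].
      intros t Ht; specialize (Hm t Ht); cbv beta in Hm.
      rewrite !cl_id in Hm by lra; rewrite Rinv_inv; exact Hm.
  - exists C; split; [exact HC |]; intros i Hi; apply H, Hi.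
Qed.

Lemma weight_bound :
  exists W, 0 < W /\ forall i, (1 <= i <= n - 1)%nat ->
    forall t, 0 <= t <= T -> weight i t <= W.
Proof.
  apply (uniform_constant (fun i W => forall t, 0 <= t <= T -> weight i t <= W)).
  - intros i C C' H HCC t Ht; specialize (H t Ht); lra.
  - intros i Hi.
    destruct (@bounded_on_segment R_NormedModule (fun u : R => weight i (cl u)) 0 T)
      as [C [HC HC']].
    + intros t; apply weight_continuous; lia.
    + exists C; split; [exact HC |]; intros t Ht; specialize (HC' t Ht).
      cbv beta in HC'; rewrite cl_id in HC' by exact Ht.
      apply Rle_trans with (2 := HC'), Rle_abs.
Qed.

(* For small t the factor is D(t), close to D(0) < 1; for larger t the delay
   t - alpha_i(t) is bounded below, so exp (- lam * (t - alpha_i(t))) is small. *)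
Lemma exp_weight_sum :
  exists rho lam0, 0 <= rho < 1 /\ 0 < lam0 /\ forall lam t, lam0 <= lam -> 0 <= t <= T ->
    sum_n_m (fun i => weight i t * exp (lam * alpha i t)) 1 (n - 1) <= rho * exp (lam * t).
Proof.
  set (rho := (1 + Dfun n alpha dalpha K Kinv 0) / 2).
  pose proof (Dfun_ge0 0) as HD.
  assert (Hrho : 1 / 2 <= rho < 1) by (unfold rho; lra).
  destruct (proj1 (continuous_line_iff _ 0) (Dfun_continuous 0) (1 - rho) ltac:(lra))
    as [d [Hd Hd']].
  set (h := Rmin (d / 2) T).
  assert (Hh : 0 < h) by (apply Rmin_pos; lra).
  assert (HhT : h <= T) by apply Rmin_r.
  assert (Hhd : h <= d / 2) by apply Rmin_l.
  destruct (delay_bound h (conj Hh HhT)) as [C [HC HC']].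
  destruct weight_bound as [W [HW HW']].
  set (N := INR (n - 1) * (W * C)).
  assert (HN : 0 <= N).
  { apply Rmult_le_pos; [apply pos_INR |]; apply Rmult_le_pos; lra. }
  exists rho, (N / rho + 1); split; [lra |]; split.
  { assert (0 <= N / rho); [apply Rmult_le_pos; [exact HN |] | lra].
    left; apply Rinv_0_lt_compat; lra. }
  intros lam t Hlam Ht.
  assert (HNr : 0 <= N / rho).
  { apply Rmult_le_pos; [exact HN |]; left; apply Rinv_0_lt_compat; lra. }
  assert (Hlam0 : 0 < lam) by lra.
  assert (HNlam : N <= rho * lam).
  { apply Rle_trans with (rho * (N / rho)); [right; field; lra |].
    apply Rmult_le_compat_l; lra. }
  destruct (Rle_dec t h) as [Hth | Hth].
  - apply Rle_trans with (sum_n_m (fun i => mult (weight i t) (exp (lam * t) : R_Ring)) 1 (n - 1)).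
    + apply sum_n_m_le_loc; intros i Hi; apply Rmult_le_compat_l; [apply weight_ge0 |].
      apply exp_mono, Rmult_le_compat_l; [lra |].
      apply alpha_in; [lia | exact Ht].
    + rewrite (@sum_n_m_mult_r R_Ring).
      apply Rmult_le_compat_r; [left; apply exp_pos |].
      specialize (Hd' t); rewrite Rminus_0_r, Rabs_pos_eq in Hd' by lra.
      specialize (Hd' ltac:(lra)); cbv beta in Hd'; rewrite !cl_id in Hd' by lra.
      change (Rabs (Dfun n alpha dalpha K Kinv t - Dfun n alpha dalpha K Kinv 0) < 1 - rho) in Hd'.
      apply Rabs_def2 in Hd'.
      change (sum_n_m (fun i => weight i t) 1 (n - 1)) with (Dfun n alpha dalpha K Kinv t).
      unfold rho in *; lra.
  - apply Rle_trans with (INR (n - 1) * (W * (C / lam) * exp (lam * t))).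
    + apply sum_n_m_le_const; intros i Hi.
      pose proof (HC' i Hi) as HC''; specialize (HC'' t ltac:(lra)).
      rewrite Rmult_assoc; apply Rmult_le_compat; [apply weight_ge0 | left; apply exp_pos | |].
      * apply HW'; [exact Hi | exact Ht].
      * replace (lam * alpha i t) with (- (lam * (t - alpha i t)) + lam * t) by ring.
        rewrite exp_plus; apply Rmult_le_compat_r; [left; apply exp_pos |].
        assert (HiC : 0 < / C) by (apply Rinv_0_lt_compat; exact HC).
        apply Rle_trans with (/ (lam * (t - alpha i t))).
        { apply exp_opp_le, Rmult_lt_0_compat; lra. }
        replace (C / lam) with (/ (lam * / C)) by (field; lra).
        apply Rinv_le_contravar; [apply Rmult_lt_0_compat; lra |].
        apply Rmult_le_compat_l; lra.
    + replace (INR (n - 1) * (W * (C / lam) * exp (lam * t)))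
        with (N / lam * exp (lam * t)) by (unfold N; field; lra).
      apply Rmult_le_compat_r; [left; apply exp_pos |].
      apply Rle_trans with (rho * lam / lam); [| right; field; lra].
      apply Rmult_le_compat_r; [left; apply Rinv_0_lt_compat; lra | exact HNlam].
Qed.

(** * The Volterra operator *)

Lemma kernel_continuous i x (t s : R) :
  (1 <= i <= n)%nat -> (forall s : R, continuous x s) ->
  continuous (fun p : R * R => pext T n alpha K1 i p (x (snd p))) (t, s).
Proof.
  intros Hi Hx.
  apply (@continuous_blop_app _ E1 E2 (fun p : R * R => pext T n alpha K1 i p)).
  - apply (pext_continuous T n alpha dalpha hT hn halpha); [exact Hi | apply hK1, Hi].
  - apply (continuous_comp snd x); [apply continuous_snd | apply Hx].
Qed.

Lemma RInt_pext (G : nat -> R -> R -> blop E1 E2) i x t u v :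
  0 <= t <= T -> u <= v ->
  (u < v -> curve n alpha (i - 1) t <= u /\ v <= curve n alpha i t) ->
  RInt (fun s => G i t s (x s)) u v = RInt (fun s => pext T n alpha G i (t, s) (x s)) u v.
Proof.
  intros Ht Huv H; apply RInt_ext; rewrite Rmin_left, Rmax_right by exact Huv; intros s Hs.
  rewrite pext_eq; [reflexivity | exact Ht |].
  destruct (H ltac:(lra)); lra.
Qed.

Lemma clamp_mono a b c c' : c <= c' -> clamp a b c <= clamp a b c'.
Proof. intros H; unfold clamp; apply Rle_max_compat_l, Rle_min_compat_l, H. Qed.

Lemma clamp_interval a b c c' :
  clamp a b c < clamp a b c' -> c <= clamp a b c /\ clamp a b c' <= c'.
Proof. unfold clamp, Rmax, Rmin; repeat destruct Rle_dec; lra. Qed.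

(** The limits are those of [Kop_on], which are convertible to [clamp]. The operator [Kinv t] is
    left out because it does not depend on s and comes out of the integral. *)
Definition piece x t a b i : E2 :=
  RInt (fun s => pext T n alpha K1 i (t, s) (x s))
    (clamp a b (curve n alpha (i - 1) t)) (clamp a b (curve n alpha i t)).

Lemma Kop_on_eq x a b t :
  (forall s : R, continuous x s) -> 0 <= t <= T ->
  Kon a b x t = Kinv t (sum_n_m (piece x t a b) 1 n).
Proof.
  intros Hx Ht; rewrite (blop_sum (Kinv t) _ 1 n); apply sum_n_m_ext_loc; intros i Hi.
  assert (Hc : curve n alpha (i - 1) t <= curve n alpha i t).
  { apply (curve_mono T n alpha dalpha hT hn halpha); [lia | exact Ht]. }
  transitivity (RInt (fun s => Kinv t (pext T n alpha K1 i (t, s) (x s)))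
    (clamp a b (curve n alpha (i - 1) t)) (clamp a b (curve n alpha i t))).
  - apply RInt_ext; intros s Hs.
    rewrite Rmin_left, Rmax_right in Hs by (apply clamp_mono, Hc).
    rewrite pext_eq; [reflexivity | exact Ht |].
    (* A point s strictly between the truncated limits exists only if they differ, and then both of
       them lie between the two curves. *)
    destruct (clamp_interval a b (curve n alpha (i - 1) t) (curve n alpha i t)); [|lra].
    apply Rlt_trans with s; apply Hs.
  - apply (RInt_blop (Kinv t) (fun s => pext T n alpha K1 i (t, s) (x s))).
    intros s; apply (continuous_slice_r (fun p : R * R => pext T n alpha K1 i p (x (snd p)))).
    apply kernel_continuous; [exact Hi | exact Hx].
Qed.

(** The truncated limits lie in [a,b]. This allows x, continuous on a segment only, to be replaced
    by its total extension through [clamp]. *)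
Lemma Kop_on_ext x y a b t :
  a <= b -> 0 <= t <= T -> (forall s, a <= s <= b -> x s = y s) -> Kon a b x t = Kon a b y t.
Proof.
  intros Hab Ht H; apply sum_n_m_ext_loc; intros i Hi; apply RInt_ext; intros s Hs.
  rewrite H; [reflexivity |].
  pose proof (clamp_in a b (curve n alpha (i - 1) t) Hab) as H1.
  pose proof (clamp_in a b (curve n alpha i t) Hab) as H2.
  unfold clamp in H1, H2.
  destruct Hs as [Hs1 Hs2]; split.
  - apply Rle_trans with (2 := Rlt_le _ _ Hs1); apply Rmin_glb; tauto.
  - apply Rle_trans with (1 := Rlt_le _ _ Hs2); apply Rmax_lub; tauto.
Qed.

Lemma piece_minus_le i x y a b t lam B C :
  (1 <= i <= n)%nat -> (forall s : R, continuous x s) -> (forall s : R, continuous y s) ->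
  0 <= a <= b -> b <= t <= T -> 0 < lam -> 0 <= B -> 0 <= C ->
  (forall t s, 0 <= t <= T -> 0 <= s <= T -> norm (pext T n alpha K1 i (t, s)) <= C) ->
  (forall s, a <= s <= b -> norm (minus (x s) (y s)) <= B * exp (lam * s)) ->
  norm (minus (piece x t a b i) (piece y t a b i)) <= C * B / lam * exp (lam * t).
Proof.
  intros Hi Hx Hy Ha Hb Hlam HB HC Hpext Hxy.
  set (u := clamp a b (curve n alpha (i - 1) t)).
  set (v := clamp a b (curve n alpha i t)).
  assert (Huv : u <= v).
  { apply clamp_mono, (curve_mono T n alpha dalpha hT hn halpha); [lia | lra]. }
  pose proof (clamp_in a b (curve n alpha (i - 1) t) ltac:(lra) : a <= u <= b) as Hu.
  pose proof (clamp_in a b (curve n alpha i t) ltac:(lra) : a <= v <= b) as Hv.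
  assert (Hc : forall z : R -> E1, (forall s : R, continuous z s) ->
            forall s : R, continuous (fun s : R => pext T n alpha K1 i (t, s) (z s)) s).
  { intros z Hz s.
    apply (continuous_slice_r (fun p : R * R => pext T n alpha K1 i p (z (snd p)))).
    apply kernel_continuous; assumption. }
  set (D := (fun s : R => minus (x s) (y s)) : R -> E1).
  assert (HD : forall s : R, continuous D s).
  { intros s; apply (@continuous_minus _ _ E1 x y); [apply Hx | apply Hy]. }
  assert (Heq : minus (piece x t a b i) (piece y t a b i) =
                RInt (fun s : R => pext T n alpha K1 i (t, s) (D s)) u v).
  { unfold piece; fold u v.
    rewrite <- RInt_minus by (apply ex_RInt_cont, Hc; assumption).
    apply RInt_ext; intros s _; symmetry; apply (blop_minus_arg (pext T n alpha K1 i (t, s))). }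
  apply Rle_trans with (1 := Req_le _ _ (f_equal norm Heq)).
  (* The exact integral of C * B * exp (lam * s) over [u,v]: integrating the weight is what produces
     the factor 1 / lam. *)
  apply Rle_trans with (C * B / lam * exp (lam * v) - C * B / lam * exp (lam * u)).
  - apply (norm_RInt_le (fun s : R => pext T n alpha K1 i (t, s) (D s))
             (fun s : R => C * B * exp (lam * s)) u v); [exact Huv | | |].
    + intros s Hs.
      apply Rle_trans with (1 := blop_norm_app_le (pext T n alpha K1 i (t, s)) (D s)).
      rewrite Rmult_assoc; apply Rmult_le_compat.
      * apply (@norm_ge_0 _ (blop_NormedModule E1 E2)).
      * apply (@norm_ge_0 _ E1).
      * apply Hpext; lra.
      * apply Hxy; lra.
    + apply RInt_correct, ex_RInt_cont, Hc, HD.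
    + apply is_RInt_scaled_exp, Hlam.
  - assert (H0 : 0 <= C * B / lam).
    { apply Rmult_le_pos; [apply Rmult_le_pos; assumption |].
      left; apply Rinv_0_lt_compat, Hlam. }
    assert (C * B / lam * exp (lam * v) <= C * B / lam * exp (lam * t)).
    { apply Rmult_le_compat_l; [exact H0 |]; apply exp_mono, Rmult_le_compat_l; lra. }
    assert (0 <= C * B / lam * exp (lam * u)).
    { apply Rmult_le_pos; [exact H0 | left; apply exp_pos]. }
    lra.
Qed.

(** C is fixed before lam, the functions and the segment. One constant thus serves [0,T] and every
    step interval, and lam can be chosen afterwards to make C / lam small. *)
Lemma Kop_on_minus_le :
  exists C, 0 < C /\ forall lam x y a b t B,
    (forall s : R, continuous x s) -> (forall s : R, continuous y s) ->
    0 <= a <= b -> b <= t <= T -> 0 < lam -> 0 <= B ->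
    (forall s, a <= s <= b -> norm (minus (x s) (y s)) <= B * exp (lam * s)) ->
    norm (minus (Kon a b x t) (Kon a b y t)) <= C / lam * B * exp (lam * t).
Proof.
  destruct (@bounded_on_segment (blop_NormedModule E2 E1) (fun u : R => Kinv (cl u)) 0 T)
    as [Cj [HCj HCj']]; [apply Kinv_continuous |].
  destruct (uniform_constant (fun i C => forall t s, 0 <= t <= T -> 0 <= s <= T ->
              norm (pext T n alpha K1 i (t, s)) <= C) n) as [Ck [HCk HCk']].
  { intros i C C' H HCC t s Ht Hs; apply Rle_trans with (1 := H t s Ht Hs), HCC. }
  { intros i Hi.
    apply (@bounded_on_rectangle (blop_NormedModule E1 E2) (pext T n alpha K1 i) 0 T 0 T).
    intros t s; apply (pext_continuous T n alpha dalpha hT hn halpha); [exact Hi | apply hK1, Hi]. }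
  assert (HN : 0 < INR n) by (apply lt_0_INR; lia).
  exists (Cj * (INR n * Ck)); split.
  { apply Rmult_lt_0_compat; [exact HCj |]; apply Rmult_lt_0_compat; assumption. }
  intros lam x y a b t B Hx Hy Ha Hb Hlam HB Hxy.
  rewrite !Kop_on_eq by (assumption || lra).
  apply Rle_trans with (norm (Kinv t (sum_n_m (fun i => minus (piece x t a b i) (piece y t a b i)) 1 n))).
  { apply Req_le, f_equal.
    rewrite <- (@sum_n_m_minus E2 _ _ 1 n); symmetry; exact (blop_minus_arg (Kinv t) _ _). }
  apply Rle_trans with (1 := blop_norm_app_le (Kinv t) _).
  replace (Cj * (INR n * Ck) / lam * B * exp (lam * t))
    with (Cj * (INR n * (Ck * B / lam * exp (lam * t)))) by (field; lra).
  apply Rmult_le_compat.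
  - apply (@norm_ge_0 _ (blop_NormedModule E2 E1)).
  - apply (@norm_ge_0 _ E2).
  - specialize (HCj' t ltac:(lra)); cbv beta in HCj'; rewrite cl_id in HCj' by lra; exact HCj'.
  - apply Rle_trans with (1 := @norm_sum_n_m _ E2 _ 1 n).
    apply sum_n_m_le_const; intros i Hi.
    apply piece_minus_le; try assumption; [lra | apply HCk', Hi].
Qed.

Lemma Kop_on_continuous_on a x :
  0 <= a <= T -> (forall s : R, continuous x s) ->
  continuous_on (Icc a T) (fun t => Kon a t x t).
Proof.
  intros Ha Hx; apply continuous_on_clamp; [lra |]; intros t.
  assert (Hcl : forall u, 0 <= clamp a T u <= T).
  { intros u; pose proof (clamp_in a T u ltac:(lra)); lra. }
  apply (continuous_ext (fun u : R => Kinv (clamp a T u)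
           (sum_n_m (piece x (clamp a T u) a (clamp a T u)) 1 n))).
  { intros u; symmetry; apply Kop_on_eq; [exact Hx | apply Hcl]. }
  apply (@continuous_blop_app _ E2 E1 (fun u : R => Kinv (clamp a T u))).
  - apply (continuous_ext (fun u : R => Kinv (cl (clamp a T u)))).
    + intros u; rewrite cl_id by apply Hcl; reflexivity.
    + apply (continuous_comp (clamp a T) (fun u : R => Kinv (cl u)));
        [apply continuous_clamp_id | apply Kinv_continuous].
  - apply (@continuous_sum_n_m _ E2 (fun i (u : R) => piece x (clamp a T u) a (clamp a T u) i)).
    intros i Hi; unfold piece.
    apply (continuous_RInt_param
      (fun p : R * R => pext T n alpha K1 i (clamp a T (fst p), snd p) (x (snd p)))
      (fun u : R => clamp a (clamp a T u) (curve n alpha (i - 1) (clamp a T u)))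
      (fun u : R => clamp a (clamp a T u) (curve n alpha i (clamp a T u)))).
    + intros u s.
      apply (continuous_comp_2 (fun p : R * R => clamp a T (fst p)) snd
        (fun v w => pext T n alpha K1 i (v, w) (x w))).
      * apply (continuous_comp fst (clamp a T)); [apply continuous_fst | apply continuous_clamp_id].
      * apply continuous_snd.
      * apply (continuous_ext (fun p : R * R => pext T n alpha K1 i p (x (snd p))));
          [intros [v w]; reflexivity |].
        apply kernel_continuous; assumption.
    + apply (continuous_clamp (fun _ => a) (clamp a T)
        (fun u : R => curve n alpha (i - 1) (clamp a T u)));
        [apply continuous_const | apply continuous_clamp_id |].
      apply (continuous_on_comp (Icc 0 T) (curve n alpha (i - 1)) (clamp a T)).
      * apply (curve_continuous_on T n alpha dalpha hn halpha); lia.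
      * intros u; apply Hcl.
      * apply continuous_clamp_id.
    + apply (continuous_clamp (fun _ => a) (clamp a T)
        (fun u : R => curve n alpha i (clamp a T u)));
        [apply continuous_const | apply continuous_clamp_id |].
      apply (continuous_on_comp (Icc 0 T) (curve n alpha i) (clamp a T)).
      * apply (curve_continuous_on T n alpha dalpha hn halpha); lia.
      * intros u; apply Hcl.
      * apply continuous_clamp_id.
Qed.

Lemma Kop_Kop_on x t : 0 <= t <= T -> Kop n alpha K1 Kinv x t = Kon 0 t x t.
Proof.
  intros Ht; apply sum_n_m_ext_loc; intros i Hi.
  change (RInt (fun s => Kinv t (K1 i t s (x s))) (curve n alpha (i - 1) t) (curve n alpha i t) =
    RInt (fun s => Kinv t (K1 i t s (x s)))
      (clamp 0 t (curve n alpha (i - 1) t)) (clamp 0 t (curve n alpha i t))).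
  rewrite !clamp_id; [reflexivity | |];
    apply (curve_bounds T n alpha dalpha hT hn halpha); (lia || exact Ht).
Qed.

Lemma Kop_on_Chasles x a t :
  (forall s : R, continuous x s) -> 0 <= a <= t -> t <= T ->
  Kon 0 t x t = plus (Kon 0 a x t) (Kon a t x t).
Proof.
  intros Hx Ha Ht; rewrite !Kop_on_eq by (assumption || lra).
  transitivity (Kinv t (plus (sum_n_m (piece x t 0 a) 1 n) (sum_n_m (piece x t a t) 1 n)));
    [| exact (linear_plus _ (blop_linear (Kinv t)) _ _)].
  f_equal; rewrite <- (@sum_n_m_plus E2); apply sum_n_m_ext_loc; intros i Hi; unfold piece.
  assert (Hx' : forall u v, ex_RInt (fun s : R => pext T n alpha K1 i (t, s) (x s)) u v).
  { intros u v; apply ex_RInt_cont; intros s.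
    apply (continuous_slice_r (fun p : R * R => pext T n alpha K1 i p (x (snd p)))).
    apply kernel_continuous; assumption. }
  pose proof (curve_bounds T n alpha dalpha hT hn halpha (i - 1) t ltac:(lia) ltac:(lra)) as H0.
  pose proof (curve_bounds T n alpha dalpha hT hn halpha i t ltac:(lia) ltac:(lra)) as H1.
  pose proof (curve_mono T n alpha dalpha hT hn halpha (i - 1) i t ltac:(lia) ltac:(lra)) as H2.
  set (u := curve n alpha (i - 1) t) in *; set (v := curve n alpha i t) in *.
  rewrite (clamp_id 0 t u), (clamp_id 0 t v) by lra.
  (* The cut a lies above the piece [u,v], inside it or below it; in the two outer cases one of the
     truncated integrals degenerates to a point. *)
  destruct (Rle_dec v a) as [Hva | Hva]; [| destruct (Rle_dec u a) as [Hua | Hua]].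
  - assert (clamp a t u = a) as -> by (unfold clamp; rewrite Rmin_right, Rmax_left; lra).
    assert (clamp a t v = a) as -> by (unfold clamp; rewrite Rmin_right, Rmax_left; lra).
    rewrite !clamp_id, RInt_point by lra; vector E2.
  - assert (clamp a t u = a) as -> by (unfold clamp; rewrite Rmin_right, Rmax_left; lra).
    assert (clamp 0 a v = a) as -> by (unfold clamp; rewrite Rmin_left, Rmax_right; lra).
    rewrite !clamp_id by lra; symmetry; apply RInt_Chasles; apply Hx'.
  - assert (clamp 0 a u = a) as -> by (unfold clamp; rewrite Rmin_left, Rmax_right; lra).
    assert (clamp 0 a v = a) as -> by (unfold clamp; rewrite Rmin_left, Rmax_right; lra).
    rewrite !clamp_id, RInt_point by lra; vector E2.
Qed.

(** * Contraction and fixed point on the whole of [0,T] *)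

Definition second_kind_map (fbar x : R -> E1) (t : R) : E1 :=
  plus (minus (opp (A x t)) (Kop n alpha K1 Kinv x t)) (fbar t).

Lemma iter0_second_kind_map fbar k :
  iter0 n alpha dalpha K K1 Kinv fbar k = Nat.iter k (second_kind_map fbar) fbar.
Proof. induction k as [|k IH]; simpl; [reflexivity | rewrite IH; reflexivity]. Qed.

Lemma clamp_total a b x :
  a <= b -> continuous_on (Icc a b) x -> forall s : R, continuous (fun s : R => x (clamp a b s)) s.
Proof. intros Hab Hx; apply continuous_on_clamp; assumption. Qed.

Lemma Kop_clamp x t :
  0 <= t <= T -> Kop n alpha K1 Kinv x t = Kon 0 t (fun s => x (cl s)) t.
Proof.
  intros Ht; rewrite Kop_Kop_on by exact Ht.
  apply Kop_on_ext; [lra | exact Ht |]; intros s Hs; rewrite cl_id by lra; reflexivity.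
Qed.

Lemma second_kind_map_continuous_on fbar x :
  continuous_on (Icc 0 T) fbar -> continuous_on (Icc 0 T) x ->
  continuous_on (Icc 0 T) (second_kind_map fbar x).
Proof.
  intros Hf Hx.
  pose proof (Aop_continuous_on x Hx) as HA.
  pose proof (Kop_on_continuous_on 0 (fun s => x (cl s)) ltac:(lra)
                (clamp_total 0 T x ltac:(lra) Hx)) as HKc.
  apply (continuous_on_ext (Icc 0 T)
    (fun t => plus (minus (opp (A x t)) (Kon 0 t (fun s => x (cl s)) t)) (fbar t))).
  { intros t Ht; unfold second_kind_map; rewrite Kop_clamp by exact Ht; reflexivity. }
  apply continuous_on_clamp; [lra |]; intros t.
  apply (@continuous_plus _ _ E1
    (fun u : R => minus (opp (A x (cl u))) (Kon 0 (cl u) (fun s => x (cl s)) (cl u)))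
    (fun u : R => fbar (cl u))).
  - apply (@continuous_minus _ _ E1 (fun u : R => opp (A x (cl u)))
      (fun u : R => Kon 0 (cl u) (fun s => x (cl s)) (cl u))).
    + apply (@continuous_opp _ _ E1 (fun u : R => A x (cl u))).
      revert t; apply continuous_on_clamp; [lra | exact HA].
    + revert t; apply (continuous_on_clamp 0 T (fun u : R => Kon 0 u (fun s => x (cl s)) u));
        [lra | exact HKc].
  - revert t; apply continuous_on_clamp; [lra | exact Hf].
Qed.

Lemma second_kind_map_contr :
  exists theta lam, 0 <= theta < 1 /\ 0 < lam /\ forall fbar x y B,
    continuous_on (Icc 0 T) x -> continuous_on (Icc 0 T) y ->
    (forall t, 0 <= t <= T -> norm (minus (x t) (y t)) <= B * exp (lam * t)) ->
    forall t, 0 <= t <= T ->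
      norm (minus (second_kind_map fbar x t) (second_kind_map fbar y t))
        <= theta * B * exp (lam * t).
Proof.
  destruct exp_weight_sum as [rho [lam0 [Hrho [Hlam0 Hsum]]]].
  destruct Kop_on_minus_le as [C [HC HKon]].
  (* lam >= lam0 bounds A by the factor rho, and the second summand bounds the Volterra part by (1 -
     rho) / 2; together they give (1 + rho) / 2 < 1. *)
  set (lam := lam0 + 2 * C / (1 - rho)).
  assert (HCr : 0 < 2 * C / (1 - rho)) by (apply Rdiv_lt_0_compat; lra).
  assert (Hlam : 0 < lam) by (unfold lam; lra).
  assert (HClam : C / lam <= (1 - rho) / 2).
  { apply Rle_trans with (C / (2 * C / (1 - rho))).
    - apply Rmult_le_compat_l; [lra |]; apply Rinv_le_contravar; [exact HCr | unfold lam; lra].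
    - right; field; lra. }
  exists ((1 + rho) / 2), lam; split; [lra |]; split; [exact Hlam |].
  intros fbar x y B Hx Hy Hxy t Ht.
  assert (HB : 0 <= B).
  { specialize (Hxy 0 ltac:(lra)); rewrite Rmult_0_r, exp_0, Rmult_1_r in Hxy.
    apply Rle_trans with (2 := Hxy), (@norm_ge_0 _ E1). }
  assert (HA : norm (minus (A x t) (A y t)) <= rho * B * exp (lam * t)).
  { apply Rle_trans with (1 := Aop_minus_le x y t Ht).
    apply Rle_trans with
      (sum_n_m (fun i => mult (B : R_Ring) (weight i t * exp (lam * alpha i t))) 1 (n - 1)).
    - apply sum_n_m_le_loc; intros i Hi.
      pose proof (alpha_in i t ltac:(lia) Ht) as Ha.
      apply Rle_trans with (weight i t * (B * exp (lam * alpha i t))).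
      + apply Rmult_le_compat_l; [apply weight_ge0 | apply Hxy; lra].
      + apply Req_le; change (weight i t * (B * exp (lam * alpha i t)) =
          B * (weight i t * exp (lam * alpha i t))); ring.
    - rewrite (@sum_n_m_mult_l R_Ring).
      replace (rho * B * exp (lam * t)) with (B * (rho * exp (lam * t))) by ring.
      apply Rmult_le_compat_l; [exact HB |]; apply Hsum; [unfold lam; lra | exact Ht]. }
  assert (HKd : norm (minus (Kop n alpha K1 Kinv x t) (Kop n alpha K1 Kinv y t))
                <= (1 - rho) / 2 * B * exp (lam * t)).
  { rewrite !Kop_clamp by exact Ht.
    apply Rle_trans with (C / lam * B * exp (lam * t)).
    - apply HKon; try lra; [apply clamp_total; [lra | exact Hx]
        | apply clamp_total; [lra | exact Hy] |].
      intros s Hs; rewrite cl_id by lra; apply Hxy; lra.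
    - apply Rmult_le_compat_r; [left; apply exp_pos |].
      apply Rmult_le_compat_r; assumption. }
  unfold second_kind_map.
  norm_as E1 (opp (plus (minus (A x t) (A y t))
                (minus (Kop n alpha K1 Kinv x t) (Kop n alpha K1 Kinv y t)))).
  apply Rle_trans with (1 := Req_le _ _ (@norm_opp _ E1 _)).
  apply Rle_trans with (1 := @norm_triangle _ E1 _ _).
  apply Rle_trans with (1 := Rplus_le_compat _ _ _ _ HA HKd); right; field.
Qed.

Lemma exp_weight_bounds lam t : 0 < lam -> 0 <= t <= T -> 1 <= exp (lam * t) <= exp (lam * T).
Proof.
  intros Hlam Ht; split.
  - rewrite <- exp_0; apply exp_mono, Rmult_le_pos; lra.
  - apply exp_mono, Rmult_le_compat_l; lra.
Qed.

Lemma second_kind_solution fbar :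
  continuous_on (Icc 0 T) fbar ->
  exists x, continuous_on (Icc 0 T) x /\
    (forall t, 0 <= t <= T -> second_kind_map fbar x t = x t) /\
    (forall y, continuous_on (Icc 0 T) y ->
       (forall t, 0 <= t <= T -> second_kind_map fbar y t = y t) ->
       forall t, 0 <= t <= T -> y t = x t) /\
    unif_lim_on (Icc 0 T) (iter0 n alpha dalpha K K1 Kinv fbar) x.
Proof.
  intros Hf.
  destruct second_kind_map_contr as [theta [lam [Hth [Hlam Hc]]]].
  assert (Hw : forall t, 0 <= t <= T -> 1 <= exp (lam * t) <= exp (lam * T)).
  { intros t; apply exp_weight_bounds, Hlam. }
  assert (HFc : forall x, continuous_on (Icc 0 T) x ->
            continuous_on (Icc 0 T) (second_kind_map fbar x)).
  { intros x; apply second_kind_map_continuous_on, Hf. }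
  destruct (fixed_point_exists 0 T theta (exp (lam * T)) (fun t => exp (lam * t))
              (second_kind_map fbar) ltac:(lra) Hth Hw HFc (Hc fbar) fbar Hf)
    as [x [Hx Hfix]].
  exists x; split; [exact Hx |]; split; [exact Hfix |]; split.
  - intros y Hy Hfy.
    exact (fixed_point_unique 0 T theta (exp (lam * T)) (fun t => exp (lam * t))
             (second_kind_map fbar) ltac:(lra) Hth Hw HFc (Hc fbar) x y Hx Hfix Hy Hfy).
  - intros e.
    destruct (iter_unif_lim 0 T theta (exp (lam * T)) (fun t => exp (lam * t))
             (second_kind_map fbar) ltac:(lra) Hth Hw HFc (Hc fbar) x fbar Hx Hfix Hf e)
      as [N HN].
    exists N; intros k Hk t Ht; rewrite iter0_second_kind_map; apply HN; assumption.
Qed.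

(** * Successive approximations on one step interval *)

Lemma volterra_iter_iter a g x0 k :
  volterra_iter n alpha K1 Kinv a g x0 k =
  Nat.iter k (fun v t => minus (g t) (Kon a t v t)) x0.
Proof. induction k as [|k IH]; simpl; [reflexivity | rewrite IH; reflexivity]. Qed.

(** The delayed terms belong to the fixed function g, so the Volterra operator alone has to
    contract, and a large lam achieves this on an interval of any length. The solution x is already
    given, so only convergence to it remains. *)
Lemma volterra_iter_unif_lim a b g x x0 :
  0 <= a <= b -> b <= T -> continuous_on (Icc a b) x -> continuous_on (Icc a b) x0 ->
  (forall t, a <= t <= b -> plus (x t) (Kon a t x t) = g t) ->
  unif_lim_on (Icc a b) (volterra_iter n alpha K1 Kinv a g x0) x.
Proof.
  intros Hab HbT Hx Hx0 Hg.
  destruct Kop_on_minus_le as [C [HC HKon]].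
  (* Makes the contraction factor C / lam equal to 1 / 2. *)
  set (lam := 2 * C).
  assert (Hlam : 0 < lam) by (unfold lam; lra).
  assert (Hext : forall v t, a <= t <= b -> Kon a t v t = Kon a t (fun s => v (clamp a b s)) t).
  { intros v t Ht; apply Kop_on_ext; [lra | lra |].
    intros s Hs; rewrite clamp_id by lra; reflexivity. }
  assert (HKc : forall v, continuous_on (Icc a b) v ->
            continuous_on (Icc a b) (fun t => Kon a t v t)).
  { intros v Hv; apply (continuous_on_ext _ (fun t => Kon a t (fun s => v (clamp a b s)) t)).
    { intros t Ht; symmetry; apply Hext, Ht. }
    apply (continuous_on_subset (Icc a T)); [unfold Icc; intros t Ht; lra |].
    apply Kop_on_continuous_on; [lra |]; apply clamp_total; [lra | exact Hv]. }
  (* The continuity of g is read off from the equation that x satisfies. *)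
  assert (Hgc : continuous_on (Icc a b) g).
  { apply (continuous_on_ext _ (fun t => plus (x t) (Kon a t x t))); [exact Hg |].
    apply continuous_on_clamp; [lra |]; intros t.
    apply (@continuous_plus _ _ E1 (fun u : R => x (clamp a b u))
      (fun u : R => Kon a (clamp a b u) x (clamp a b u))).
    - revert t; apply continuous_on_clamp; [lra | exact Hx].
    - revert t; apply (continuous_on_clamp a b (fun t => Kon a t x t)); [lra | apply HKc, Hx]. }
  assert (Hw : forall t, a <= t <= b -> 1 <= exp (lam * t) <= exp (lam * T)).
  { intros t Ht; apply exp_weight_bounds; lra. }
  assert (HFc : forall v : R -> E1, continuous_on (Icc a b) v ->
            continuous_on (Icc a b) (fun t => minus (g t) (Kon a t v t))).
  { intros v Hv; apply continuous_on_clamp; [lra |]; intros t.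
    apply (@continuous_minus _ _ E1 (fun u : R => g (clamp a b u))
      (fun u : R => Kon a (clamp a b u) v (clamp a b u))).
    - revert t; apply continuous_on_clamp; [lra | exact Hgc].
    - revert t; apply (continuous_on_clamp a b (fun t => Kon a t v t)); [lra | apply HKc, Hv]. }
  assert (HFx : forall t, a <= t <= b -> minus (g t) (Kon a t x t) = x t).
  { intros t Ht; rewrite <- (Hg t Ht); vector E1. }
  assert (Hcontr : forall (u v : R -> E1) B,
    continuous_on (Icc a b) u -> continuous_on (Icc a b) v ->
    (forall t, a <= t <= b -> norm (minus (u t) (v t)) <= B * exp (lam * t)) ->
    forall t, a <= t <= b ->
      norm (minus (minus (g t) (Kon a t u t)) (minus (g t) (Kon a t v t)))
        <= 1 / 2 * B * exp (lam * t)).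
  { intros u v B Hu Hv Huv t Ht.
    assert (HB : 0 <= B).
    { specialize (Huv a ltac:(lra)); pose proof (@norm_ge_0 _ E1 (minus (u a) (v a))) as H0.
      apply Rmult_le_reg_r with (exp (lam * a)); [apply exp_pos |]; rewrite Rmult_0_l.
      apply Rle_trans with (2 := Huv), H0. }
    norm_as E1 (opp (minus (Kon a t u t) (Kon a t v t))).
    apply Rle_trans with (1 := Req_le _ _ (@norm_opp _ E1 _)).
    rewrite (Hext u t Ht), (Hext v t Ht).
    replace (1 / 2) with (C / lam) by (unfold lam; field; lra).
    apply HKon; try lra; [apply clamp_total; [lra | exact Hu]
      | apply clamp_total; [lra | exact Hv] |].
    intros s Hs; rewrite clamp_id by lra; apply Huv; lra. }
  intros e.
  destruct (iter_unif_lim a b (1 / 2) (exp (lam * T)) (fun t => exp (lam * t))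
              (fun v t => minus (g t) (Kon a t v t)) ltac:(lra) ltac:(lra) Hw HFc Hcontr
              x x0 Hx HFx Hx0 e) as [N HN].
  exists N; intros k Hk t Ht; rewrite volterra_iter_iter; apply HN; assumption.
Qed.

(** The integral over [0,t] is cut at a, and its part over [0,a] joins A x on the right-hand side.
    With a = h_m, the global solution is seen to satisfy each step equation. *)
Lemma second_kind_restart fbar x a t :
  continuous_on (Icc 0 T) x -> 0 <= a <= t -> t <= T ->
  second_kind_map fbar x t = x t ->
  plus (x t) (Kon a t x t) = step_rhs n alpha dalpha K K1 Kinv fbar a x t.
Proof.
  intros Hx Ha Ht Hfix; unfold step_rhs.
  assert (Hext : forall u v, 0 <= u <= v -> v <= T ->
            Kon u v x t = Kon u v (fun s => x (cl s)) t).
  { intros u v Hu Hv; apply Kop_on_ext; [lra | lra |].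
    intros s Hs; rewrite cl_id by lra; reflexivity. }
  rewrite <- Hfix at 1; unfold second_kind_map.
  rewrite Kop_clamp by lra.
  rewrite (Kop_on_Chasles _ a t (clamp_total 0 T x ltac:(lra) Hx)) by lra.
  rewrite (Hext 0 a), (Hext a t) by lra; vector E1.
Qed.

(** * Equivalence with the equation of the first kind *)

Context (hdK : forall i t s, (1 <= i <= n)%nat -> region T n alpha i (t, s) ->
     is_derive (fun u : R => K i u s) t (K1 i t s)).

Lemma region_intro i t s :
  (1 <= i)%nat -> 0 < t < T -> curve n alpha (i - 1) t < s < curve n alpha i t ->
  region T n alpha i (t, s).
Proof.
  intros Hi Ht Hs; split; [exact Ht |]; split; [| apply Hs].
  destruct (Nat.eqb_spec i 1) as [-> |]; [| apply Hs].
  left; apply Hs.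
Qed.

(** A point strictly between the curves stays so for all nearby times, and there the extension
    coincides with K_i. *)
Lemma pext_derive i x t s :
  (1 <= i <= n)%nat -> 0 < t < T -> curve n alpha (i - 1) t < s < curve n alpha i t ->
  is_derive (fun u : R => pext T n alpha K i (u, s) (x s)) t (pext T n alpha K1 i (t, s) (x s)).
Proof.
  intros Hi Ht Hs.
  rewrite pext_eq by lra.
  apply (is_derive_ext_loc (fun u : R => K i u s (x s))).
  - destruct (proj1 (continuous_line_iff _ t)
      (is_derive_continuous _ t _
        (curve_derive T n alpha dalpha hn halpha (i - 1) t ltac:(lia) Ht))
      (s - curve n alpha (i - 1) t) ltac:(lra)) as [d1 [Hd1 Hd1']].
    destruct (proj1 (continuous_line_iff _ t)
      (is_derive_continuous _ t _
        (curve_derive T n alpha dalpha hn halpha i t ltac:(lia) Ht))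
      (curve n alpha i t - s) ltac:(lra)) as [d2 [Hd2 Hd2']].
    assert (Hr : 0 < Rmin (Rmin d1 d2) (Rmin t (T - t))).
    { apply Rmin_pos; apply Rmin_pos; lra. }
    exists (mkposreal _ Hr); intros u Hu.
    change (Rabs (u - t) < Rmin (Rmin d1 d2) (Rmin t (T - t))) in Hu.
    pose proof (Rlt_le_trans _ _ _ Hu (Rmin_l _ _)) as Hu1.
    pose proof (Rlt_le_trans _ _ _ Hu (Rmin_r _ _)) as Hu2.
    specialize (Hd1' u (Rlt_le_trans _ _ _ Hu1 (Rmin_l _ _))).
    specialize (Hd2' u (Rlt_le_trans _ _ _ Hu1 (Rmin_r _ _))).
    pose proof (Rlt_le_trans _ _ _ Hu2 (Rmin_l _ _)) as Hu3.
    pose proof (Rlt_le_trans _ _ _ Hu2 (Rmin_r _ _)) as Hu4.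
    change (Rabs (curve n alpha (i - 1) u - curve n alpha (i - 1) t)
              < s - curve n alpha (i - 1) t) in Hd1'.
    change (Rabs (curve n alpha i u - curve n alpha i t) < curve n alpha i t - s) in Hd2'.
    apply Rabs_def2 in Hd1'; apply Rabs_def2 in Hd2'.
    apply Rabs_def2 in Hu3; apply Rabs_def2 in Hu4.
    rewrite pext_eq by lra; reflexivity.
  - apply (is_derive_blop_eval (fun u : R => K i u s)).
    apply hdK; [exact Hi |]; apply region_intro; [lia | exact Ht | exact Hs].
Qed.

Lemma first_kind_pext x t :
  0 <= t <= T ->
  first_kind_int n alpha K x t =
  sum_n_m (fun i => RInt (fun s : R => pext T n alpha K i (t, s) (x (cl s)))
                      (curve n alpha (i - 1) t) (curve n alpha i t)) 1 n.
Proof.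
  intros Ht; apply sum_n_m_ext_loc; intros i Hi.
  pose proof (curve_bounds T n alpha dalpha hT hn halpha (i - 1) t ltac:(lia) Ht) as H0.
  pose proof (curve_bounds T n alpha dalpha hT hn halpha i t ltac:(lia) Ht) as H1.
  pose proof (curve_mono T n alpha dalpha hT hn halpha (i - 1) i t ltac:(lia) Ht) as H2.
  rewrite (RInt_pext K i x t) by (exact Ht || exact H2 || (intros; lra)).
  apply RInt_ext; rewrite Rmin_left, Rmax_right by exact H2; intros s Hs.
  rewrite cl_id by lra; reflexivity.
Qed.

Lemma first_kernel_continuous i x (t s : R) :
  (1 <= i <= n)%nat -> (forall s : R, continuous x s) ->
  continuous (fun p : R * R => pext T n alpha K i p (x (snd p))) (t, s).
Proof.
  intros Hi Hx.
  apply (@continuous_blop_app _ E1 E2 (fun p : R * R => pext T n alpha K i p)).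
  - apply (pext_continuous T n alpha dalpha hT hn halpha); [exact Hi | apply hK, Hi].
  - apply (continuous_comp snd x); [apply continuous_snd | apply Hx].
Qed.

Lemma first_kind_continuous_on x :
  continuous_on (Icc 0 T) x -> continuous_on (Icc 0 T) (first_kind_int n alpha K x).
Proof.
  intros Hx; pose proof (clamp_total 0 T x ltac:(lra) Hx) as Hxc.
  apply continuous_on_clamp; [lra |]; intros t.
  apply (continuous_ext (fun u : R =>
    sum_n_m (fun i => RInt (fun s : R => pext T n alpha K i (cl u, s) (x (cl s)))
                      (curve n alpha (i - 1) (cl u)) (curve n alpha i (cl u))) 1 n)).
  { intros u; symmetry; apply first_kind_pext, cl_in. }
  apply (@continuous_sum_n_m _ E2 (fun i (u : R) =>
    RInt (fun s : R => pext T n alpha K i (cl u, s) (x (cl s)))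
         (curve n alpha (i - 1) (cl u)) (curve n alpha i (cl u)))).
  intros i Hi.
  apply (continuous_RInt_param
    (fun p : R * R => pext T n alpha K i (cl (fst p), snd p) (x (cl (snd p))))
    (fun u : R => curve n alpha (i - 1) (cl u)) (fun u : R => curve n alpha i (cl u))).
  - intros u s.
    apply (continuous_comp_2 (fun p : R * R => cl (fst p)) snd
      (fun v w => pext T n alpha K i (v, w) (x (cl w)))).
    + apply (continuous_comp fst cl); [apply continuous_fst | apply continuous_clamp_id].
    + apply continuous_snd.
    + apply (continuous_ext (fun p : R * R => pext T n alpha K i p (x (cl (snd p)))));
        [intros [v w]; reflexivity |].
      apply (first_kernel_continuous i (fun s => x (cl s))); assumption.
  - apply (curve_continuous T n alpha dalpha hT hn halpha); lia.
  - apply (curve_continuous T n alpha dalpha hT hn halpha); lia.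
Qed.

Lemma first_kind_at_0 x : first_kind_int n alpha K x 0 = zero.
Proof.
  rewrite <- (@sum_n_m_const_zero E2 1 n); apply sum_n_m_ext_loc; intros i Hi.
  rewrite !(curve_at_0 T n alpha dalpha hn halpha) by lia; apply RInt_point.
Qed.

(** The Leibniz rule is applied to each piece and the boundary terms are regrouped by curve. On the
    diagonal, of slope 1, the term K_n(t,t) x(t) remains; on the curve 0, of slope 0, nothing; on
    alpha_i, the slope times the jump. Since K_n(t,t) cancels [Kinv t], the sum of the jumps is
    K_n(t,t) applied to A x, and likewise for the integrals of K_i^(1). *)
Lemma first_kind_derive x t :
  continuous_on (Icc 0 T) x -> 0 < t < T ->
  is_derive (first_kind_int n alpha K x) t
    (K n t t (plus (x t) (plus (A x t) (Kop n alpha K1 Kinv x t)))).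
Proof.
  intros Hx Ht; pose proof (clamp_total 0 T x ltac:(lra) Hx) as Hxc.
  pose proof (hKinv t ltac:(lra)) as [_ Hinv].
  set (X := (fun s : R => x (cl s)) : R -> E1) in *.
  set (Q := piece X t 0 t).
  (* [U i] and [W i] are the boundary terms at the upper and lower ends of piece i, and [Q i] is its
     integral of the differentiated kernel. *)
  set (U := (fun i => scal (dcurve n dalpha i t) (K i t (curve n alpha i t) (x (curve n alpha i t)))) : nat -> E2).
  set (W := (fun i => scal (dcurve n dalpha (i - 1) t) (K i t (curve n alpha (i - 1) t) (x (curve n alpha (i - 1) t)))) : nat -> E2).
  assert (Hval : K n t t (plus (x t) (plus (A x t) (Kop n alpha K1 Kinv x t))) =
                 sum_n_m (fun i => plus (Q i) (minus (U i) (W i))) 1 n).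
  { transitivity (plus (K n t t (x t)) (plus (K n t t (A x t)) (K n t t (Kop n alpha K1 Kinv x t)))).
    { transitivity (plus (K n t t (x t)) (K n t t (plus (A x t) (Kop n alpha K1 Kinv x t)))).
      - exact (linear_plus _ (blop_linear (K n t t)) _ _).
      - f_equal; exact (linear_plus _ (blop_linear (K n t t)) _ _). }
    rewrite Kop_clamp by lra; fold X.
    rewrite (Kop_on_eq X 0 t t Hxc) by lra; fold Q.
    unfold Aop; rewrite !Hinv.
    assert (Htel : sum_n_m (fun i => minus (U i) (W i)) 1 n =
              plus (K n t t (x t))
                (sum_n_m (fun i => scal (dalpha i t) (jump i t (x (alpha i t)))) 1 (n - 1))).
    { transitivity (sum_n_m (fun i => minus (U i) (W i)) 1 (S (n - 1))); [f_equal; lia |].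
      transitivity (plus (minus (U (S (n - 1))) (W 1%nat))
        (sum_n_m (fun i => minus (U i) (W (S i))) 1 (n - 1)));
        [exact (@sum_n_m_telescope E2 U W (n - 1)) |].
      replace (S (n - 1)) with n by lia; f_equal.
      - unfold U, W.
        rewrite (curve_last n alpha hn), (dcurve_last n dalpha hn).
        change (dcurve n dalpha (1 - 1) t) with 0; vector E2.
      - apply sum_n_m_ext_loc; intros i Hi; unfold U, W.
        replace (S i - 1)%nat with i by lia.
        rewrite (curve_mid n alpha hn i t), (dcurve_mid n dalpha hn i t) by lia.
        transitivity (scal (dalpha i t) (minus (K i t (alpha i t) (x (alpha i t)))
                                          (K (S i) t (alpha i t) (x (alpha i t)))));
          [vector E2 | reflexivity]. }
    transitivity (plus (sum_n_m Q 1 n) (sum_n_m (fun i => minus (U i) (W i)) 1 n)).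
    - rewrite Htel.
      match goal with |- plus ?a (plus ?b ?c) = _ => change b with
        (sum_n_m (fun i => scal (dalpha i t) (jump i t (x (alpha i t)))) 1 (n - 1)) end.
      vector E2.
    - symmetry; exact (@sum_n_m_plus E2 Q (fun i => minus (U i) (W i)) 1 n). }
  rewrite Hval.
  apply (is_derive_ext_loc (fun u : R =>
    sum_n_m (fun i => RInt (fun s : R => pext T n alpha K i (u, s) (X s))
                      (curve n alpha (i - 1) u) (curve n alpha i u)) 1 n)).
  { assert (Hr : 0 < Rmin t (T - t)) by (apply Rmin_pos; lra).
    exists (mkposreal _ Hr); intros u Hu; symmetry; apply first_kind_pext.
    change (Rabs (u - t) < Rmin t (T - t)) in Hu.
    pose proof (Rlt_le_trans _ _ _ Hu (Rmin_l _ _)) as Hu1.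
    pose proof (Rlt_le_trans _ _ _ Hu (Rmin_r _ _)) as Hu2.
    apply Rabs_def2 in Hu1; apply Rabs_def2 in Hu2; lra. }
  apply (@is_derive_sum_n_m E2 (fun i (u : R) =>
    RInt (fun s : R => pext T n alpha K i (u, s) (X s))
      (curve n alpha (i - 1) u) (curve n alpha i u))
    (fun i => plus (Q i) (minus (U i) (W i)))).
  intros i Hi.
  pose proof (curve_bounds T n alpha dalpha hT hn halpha (i - 1) t ltac:(lia) ltac:(lra)) as H0.
  pose proof (curve_bounds T n alpha dalpha hT hn halpha i t ltac:(lia) ltac:(lra)) as H1.
  assert (Hlt : curve n alpha (i - 1) t < curve n alpha i t).
  { replace i with (S (i - 1)) at 2 by lia; apply (proj1 (proj2 halpha)); [exact Ht | lia]. }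
  assert (HU : U i = scal (dcurve n dalpha i t)
                       (pext T n alpha K i (t, curve n alpha i t) (X (curve n alpha i t)))).
  { unfold U, X; rewrite pext_eq, cl_id by lra; reflexivity. }
  assert (HW : W i = scal (dcurve n dalpha (i - 1) t)
                       (pext T n alpha K i (t, curve n alpha (i - 1) t) (X (curve n alpha (i - 1) t)))).
  { unfold W, X; rewrite pext_eq, cl_id by lra; reflexivity. }
  assert (HQ : Q i = RInt (fun s : R => pext T n alpha K1 i (t, s) (X s))
                       (curve n alpha (i - 1) t) (curve n alpha i t)).
  { unfold Q, piece; rewrite !clamp_id by lra; reflexivity. }
  rewrite HU, HW, HQ.
  apply (is_derive_RInt_leibniz
    (fun p : R * R => pext T n alpha K i p (X (snd p)))
    (fun p : R * R => pext T n alpha K1 i p (X (snd p)))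
    (curve n alpha (i - 1)) (curve n alpha i) t
    (dcurve n dalpha (i - 1) t) (dcurve n dalpha i t) (Rmin t (T - t))).
  - intros u s; apply first_kernel_continuous; assumption.
  - intros u s; apply kernel_continuous; assumption.
  - apply (curve_derive T n alpha dalpha hn halpha); [lia | exact Ht].
  - apply (curve_derive T n alpha dalpha hn halpha); [lia | exact Ht].
  - exact Hlt.
  - apply Rmin_pos; lra.
  - intros u s Hu Hs; cbn [snd]; apply pext_derive; [exact Hi | | exact Hs].
    pose proof (Rlt_le_trans _ _ _ Hu (Rmin_l _ _)) as Hu1.
    pose proof (Rlt_le_trans _ _ _ Hu (Rmin_r _ _)) as Hu2.
    apply Rabs_def2 in Hu1; apply Rabs_def2 in Hu2; lra.
Qed.

Context (f df : R -> E2) (hf : C1_on 0 T f df) (hf0 : f 0 = zero).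

Local Notation fbar := (fun t : R => Kinv t (df t)).

Lemma fbar_continuous_on : continuous_on (Icc 0 T) fbar.
Proof.
  apply continuous_on_clamp; [lra |]; intros t.
  apply (@continuous_blop_app _ E2 E1 (fun u : R => Kinv (cl u)) (fun u : R => df (cl u)));
    [apply Kinv_continuous |].
  revert t; apply continuous_on_clamp; [lra | apply hf].
Qed.

(** Writing f' as K_n(t,t) applied to fbar factors K_n(t,t) out: the defect of the first kind
    equation is differentiated into K_n(t,t) applied to the defect of the second kind equation. Both
    directions of the equivalence rest on this identity. *)
Lemma defect_derive x t :
  continuous_on (Icc 0 T) x -> 0 < t < T ->
  is_derive (fun u => minus (first_kind_int n alpha K x u) (f u)) t
    (K n t t (minus (x t) (second_kind_map fbar x t))).
Proof.
  intros Hx Ht.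
  replace (K n t t (minus (x t) (second_kind_map fbar x t))) with
    (minus (K n t t (plus (x t) (plus (A x t) (Kop n alpha K1 Kinv x t)))) (df t)).
  - apply @is_derive_minus; [apply first_kind_derive; assumption |].
    apply (is_derive_within_interior 0 T); [exact Ht | apply hf; unfold Icc; lra].
  - transitivity (minus (K n t t (plus (x t) (plus (A x t) (Kop n alpha K1 Kinv x t))))
                        (K n t t (Kinv t (df t)))).
    + rewrite (proj2 (hKinv t ltac:(lra))); reflexivity.
    + transitivity (K n t t (minus (plus (x t) (plus (A x t) (Kop n alpha K1 Kinv x t)))
                                   (Kinv t (df t)))).
      * symmetry; exact (blop_minus_arg (K n t t) _ _).
      * f_equal; unfold second_kind_map; vector E1.
Qed.

(** If the first kind defect vanishes, so does its derivative, and K_n(t,t) is injective; the end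
    points follow by continuity. Conversely the first kind defect has zero derivative, and it starts
    from 0 because all curves start at 0 and f(0) = 0. *)
Lemma first_kind_iff_second_kind x :
  continuous_on (Icc 0 T) x ->
  ((forall t, 0 <= t <= T -> first_kind_int n alpha K x t = f t) <->
   (forall t, 0 <= t <= T -> second_kind_map fbar x t = x t)).
Proof.
  intros Hx.
  assert (Hsub : forall (V : CompleteNormedModule R_AbsRing) (u v : V),
            minus u v = zero <-> u = v).
  { intros V u v; split.
    - intros H; replace u with (plus (minus u v) v) by vector V; rewrite H; vector V.
    - intros ->; vector V. }
  split; intros H.
  - assert (Hz : forall t, 0 <= t <= T -> minus (x t) (second_kind_map fbar x t) = zero).
    { apply (@zero_on_closure E1); [exact hT | |].
      - apply continuous_on_clamp; [lra |]; intros t.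
        apply (@continuous_minus _ _ E1 (fun u : R => x (cl u))
                 (fun u : R => second_kind_map fbar x (cl u))).
        + revert t; apply continuous_on_clamp; [lra | exact Hx].
        + revert t; apply continuous_on_clamp; [lra |].
          apply second_kind_map_continuous_on; [apply fbar_continuous_on | exact Hx].
      - intros t Ht.
        assert (Hr : 0 < Rmin t (T - t)) by (apply Rmin_pos; lra).
        assert (Hl : K n t t (minus (x t) (second_kind_map fbar x t)) = zero);
          [apply (fun Hz => @is_derive_locally_zero E2 _ t (Rmin t (T - t)) _ Hr Hz
                              (defect_derive x t Hx Ht)) |
           rewrite <- (proj1 (hKinv t ltac:(lra)) (minus (x t) (second_kind_map fbar x t)));
           rewrite Hl; exact (linear_zero _ (blop_linear (Kinv t)))].
        intros u Hu; apply Hsub, H.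
        pose proof (Rlt_le_trans _ _ _ Hu (Rmin_l _ _)) as Hu1.
        pose proof (Rlt_le_trans _ _ _ Hu (Rmin_r _ _)) as Hu2.
        apply Rabs_def2 in Hu1; apply Rabs_def2 in Hu2; lra. }
    intros t Ht; symmetry; apply Hsub, Hz, Ht.
  - intros t Ht; apply Hsub; revert t Ht.
    apply (@zero_of_derive E2 (fun t => minus (first_kind_int n alpha K x t) (f t)));
      [exact hT | | |].
    + apply continuous_on_clamp; [lra |]; intros t.
      apply (@continuous_minus _ _ E2 (fun u : R => first_kind_int n alpha K x (cl u))
               (fun u : R => f (cl u))).
      * revert t; apply continuous_on_clamp; [lra | apply first_kind_continuous_on, Hx].
      * revert t; apply continuous_on_clamp; [lra | exact (C1_on_continuous 0 T f df hf)].
    + rewrite first_kind_at_0, hf0; vector E2.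
    + intros t Ht.
      assert (Hz : K n t t (minus (x t) (second_kind_map fbar x t)) = zero).
      { rewrite (H t) by lra.
        replace (minus (x t) (x t)) with (zero : E1) by vector E1.
        exact (linear_zero _ (blop_linear (K n t t))). }
      pose proof (defect_derive x t Hx Ht) as Hd; rewrite Hz in Hd; exact Hd.
Qed.

(** * Choice of the step parameters and covering of [0,T] *)

Lemma step_parameters_exist c :
  exists q h1 h eps, step_parameters n alpha dalpha K Kinv T c q h1 h eps.
Proof.
  destruct (proj1 (continuous_line_iff _ 0) (Dfun_continuous 0)
              (1 - Dfun n alpha dalpha K Kinv 0) ltac:(lra)) as [d [Hd Hd']].
  (* Half of the radius keeps the closed segment [0,h1] where |D(t) - D(0)| < 1 - D(0), so that D <
     1 on it. *)
  set (h1 := Rmin (d / 2) T).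
  assert (Hh1 : 0 < h1) by (apply Rmin_pos; lra).
  pose proof (Rmin_l (d / 2) T : h1 <= d / 2) as Hh1d.
  pose proof (Rmin_r (d / 2) T : h1 <= T) as Hh1T.
  destruct (continuity_ab_maj (fun u => Dfun n alpha dalpha K Kinv (cl u)) 0 h1)
    as [m [Hm Hm']]; [lra | |].
  { intros u _; apply continuity_pt_filterlim, Dfun_continuous. }
  rewrite (cl_id m) in Hm by lra.
  (* The maximum of D over [0,h1], attained at m. *)
  set (q := Dfun n alpha dalpha K Kinv m) in *.
  assert (Hq : q < 1).
  { specialize (Hd' m); rewrite Rminus_0_r, Rabs_pos_eq in Hd' by lra.
    specialize (Hd' ltac:(lra)); cbv beta in Hd'; rewrite !cl_id in Hd' by lra.
    change (Rabs (q - Dfun n alpha dalpha K Kinv 0) < 1 - Dfun n alpha dalpha K Kinv 0) in Hd'.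
    apply Rabs_def2 in Hd'; lra. }
  pose proof (Rabs_pos c) as Hc0; pose proof (Rle_abs c) as Hc1.
  (* |c| + 1 is positive whatever the sign of c, and c * h <= (|c| + 1) * h <= (1 - q) / 2 < 1 -
     q. *)
  set (h := Rmin (h1 / 2) ((1 - q) / (2 * (Rabs c + 1)))).
  assert (Hh : 0 < h) by (apply Rmin_pos; [lra | apply Rdiv_lt_0_compat; lra]).
  pose proof (Rmin_l (h1 / 2) ((1 - q) / (2 * (Rabs c + 1))) : h <= h1 / 2) as Hhh.
  assert (Hch : (Rabs c + 1) * h <= (1 - q) / 2).
  { apply Rle_trans with ((Rabs c + 1) * ((1 - q) / (2 * (Rabs c + 1)))).
    - apply Rmult_le_compat_l; [lra | apply Rmin_r].
    - right; field; lra. }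
  destruct (delay_bound h ltac:(lra)) as [C [HC HC']].
  (* The step length eps * h is at most the least delay 1 / C on [h,T]; hence alpha_i(t) <= t - eps
     * h <= h_m for t in I_m. *)
  set (eps := Rmin 1 (/ (C * h))).
  assert (HCh : 0 < C * h) by (apply Rmult_lt_0_compat; assumption).
  assert (Heps : 0 < eps) by (apply Rmin_pos; [lra | apply Rinv_0_lt_compat, HCh]).
  assert (Heps' : eps * h <= / C).
  { apply Rle_trans with (/ (C * h) * h).
    - apply Rmult_le_compat_r; [lra | apply Rmin_r].
    - right; field; lra. }
  exists q, h1, h, eps; split; [exact Hq |]; split; [lra |]; split; [| split; [| split; [| split]]].
  - split.
    + intros t Ht; specialize (Hm t Ht); rewrite cl_id in Hm by lra; exact Hm.
    + exists m; split; [exact Hm' | reflexivity].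
  - lra.
  - nra.
  - split; [exact Heps | apply Rmin_l].
  - intros k t i Hk Ht HtT Hi.
    unfold hstep in *; rewrite S_INR in Ht.
    pose proof (le_INR 1 k Hk) as Hk'; change (INR 1) with 1 in Hk'.
    assert (Hkh : h <= (1 + (INR k - 1) * eps) * h).
    { rewrite <- (Rmult_1_l h) at 1; apply Rmult_le_compat_r; [lra |].
      assert (0 <= (INR k - 1) * eps) by (apply Rmult_le_pos; lra); lra. }
    pose proof (HC' i ltac:(lia)) as HC''; specialize (HC'' t ltac:(lra)).
    pose proof (alpha_in i t Hi ltac:(lra)); lra.
Qed.

End SecondKind.

(** The steps have constant length eps * h, so some index passes T. Descending from it finds M, and
    the descent cannot reach index 1, since h_1 = h < T. *)
Lemma steps_cover h eps T :
  0 < h < T -> 0 < eps ->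
  exists M, (1 <= M)%nat /\ hstep h eps M < T <= hstep h eps (S M).
Proof.
  intros Hh Heps.
  assert (Hind : forall k, T <= hstep h eps (S k) ->
            exists M, (1 <= M)%nat /\ hstep h eps M < T <= hstep h eps (S M)).
  { induction k as [|k IH]; intros Hk.
    - unfold hstep in Hk; rewrite S_INR in Hk; simpl in Hk; lra.
    - destruct (Rle_dec T (hstep h eps (S k))) as [H | H]; [exact (IH H) |].
      exists (S k); split; [lia | lra]. }
  assert (Heh : 0 < eps * h) by (apply Rmult_lt_0_compat; lra).
  destruct (INR_unbounded (T / (eps * h))) as [k Hk].
  apply (Hind k); unfold hstep; rewrite S_INR.
  replace ((1 + (INR k + 1 - 1) * eps) * h) with (h + INR k * (eps * h)) by ring.
  assert (T / (eps * h) * (eps * h) <= INR k * (eps * h)) by (apply Rmult_le_compat_r; lra).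
  replace (T / (eps * h) * (eps * h)) with T in H by (field; lra); lra.
Qed.

(** * Existence, uniqueness and the step method *)

Theorem theorem1
  (E1 E2 : CompleteNormedModule R_AbsRing)
  (T : R) (n : nat) (alpha dalpha : nat -> R -> R)
  (K K1 : nat -> R -> R -> blop E1 E2) (Kinv : R -> blop E2 E1)
  (f df : R -> E2) (c : R)
  (hT : 0 < T) (hn : (1 <= n)%nat)
  (halpha : admissible_curves T n alpha dalpha)
  (hK : forall i, (1 <= i <= n)%nat ->
     continuous_on (closure (region T n alpha i))
       (fun p : R * R => K i (fst p) (snd p)))
  (hdK : forall i t s, (1 <= i <= n)%nat -> region T n alpha i (t, s) ->
     is_derive (fun u : R => K i u s) t (K1 i t s))
  (hK1 : forall i, (1 <= i <= n)%nat ->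
     continuous_on (closure (region T n alpha i))
       (fun p : R * R => K1 i (fst p) (snd p)))
  (hKinv : forall t, 0 <= t <= T -> blop_is_inverse (K n t t) (Kinv t))
  (hf : C1_on 0 T f df) (hf0 : f 0 = zero)
  (hD0 : Dfun n alpha dalpha K Kinv 0 < 1)
  (hc : forall i t s, (1 <= i <= n)%nat -> region T n alpha i (t, s) -> 0 < s ->
     norm (blop_comp (Kinv t) (K i t s)) <= c) :
  exists x : R -> E1,
    (continuous_on (Icc 0 T) x /\
     (forall t, 0 <= t <= T -> first_kind_int n alpha K x t = f t)) /\
    (forall y : R -> E1, continuous_on (Icc 0 T) y ->
       (forall t, 0 <= t <= T -> first_kind_int n alpha K y t = f t) ->
       forall t, 0 <= t <= T -> y t = x t) /\
    (exists q h1 h eps : R,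
       step_parameters n alpha dalpha K Kinv T c q h1 h eps) /\
    (forall q h1 h eps : R,
       step_parameters n alpha dalpha K Kinv T c q h1 h eps ->
       exists (M : nat) (xbar : nat -> R -> E1),
         step_method n alpha dalpha K K1 Kinv T h eps
           (fun t => Kinv t (df t)) M xbar /\
         (forall t, 0 <= t <= T -> xbar M t = x t)).
Proof.
  assert (Hfbar : continuous_on (Icc 0 T) (fun t : R => Kinv t (df t))).
  { apply (fbar_continuous_on T n alpha dalpha K Kinv hT hn halpha hK hKinv f df hf). }
  pose proof (first_kind_iff_second_kind T n alpha dalpha K K1 Kinv hT hn halpha hK hK1 hKinv
                hdK f df hf hf0) as Hiff.
  destruct (second_kind_solution T n alpha dalpha K K1 Kinv hT hn halpha hK hK1 hKinv hD0
              (fun t : R => Kinv t (df t)) Hfbar) as [x [Hx [Hfix [Huniq Hlim]]]].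
  exists x; split; [split; [exact Hx | apply Hiff; assumption] |]; split; [| split].
  - intros y Hy Hyf; apply Huniq; [exact Hy | apply Hiff; assumption].
  - apply step_parameters_exist; assumption.
  - intros q h1 h eps [_ [Hh1 [_ [Hh [_ [Heps _]]]]]].
    destruct (steps_cover h eps T ltac:(lra) ltac:(lra)) as [M [HM HMT]].
    exists M, (fun _ => x); split; [| reflexivity].
    split; [exact HM |]; split; [exact HMT |]; split.
    { intros e; destruct (Hlim e) as [N HN]; exists N; intros k Hk t Ht.
      apply HN; [exact Hk | unfold Icc in *; lra]. }
    intros m Hm; cbv zeta.
    assert (Hhm : h <= hstep h eps m /\ hstep h eps m <= hstep h eps M).
    { unfold hstep; pose proof (le_INR 1 m ltac:(lia)) as H1; change (INR 1) with 1 in H1.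
      pose proof (le_INR m M ltac:(lia)) as H2; split.
      - rewrite <- (Rmult_1_l h) at 1; apply Rmult_le_compat_r; [lra |].
        assert (0 <= (INR m - 1) * eps) by (apply Rmult_le_pos; lra); lra.
      - apply Rmult_le_compat_r; [lra |]; apply Rplus_le_compat_l, Rmult_le_compat_r; lra. }
    (* The last interval is cut at T; it is nonempty because h_m <= h_M < T. *)
    assert (Hend : hstep h eps m <= Rmin (hstep h eps (S m)) T <= T).
    { split; [| apply Rmin_r]; apply Rmin_glb; [| lra].
      unfold hstep; rewrite S_INR; apply Rmult_le_compat_r; [lra |].
      apply Rplus_le_compat_l, Rmult_le_compat_r; lra. }
    assert (Hvolt : forall t, hstep h eps m <= t <= Rmin (hstep h eps (S m)) T ->
      plus (x t) (Kop_on n alpha K1 Kinv (hstep h eps m) t x t) =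
      step_rhs n alpha dalpha K K1 Kinv (fun t : R => Kinv t (df t)) (hstep h eps m) x t).
    { intros t Ht.
      apply (second_kind_restart T n alpha dalpha K K1 Kinv hT hn halpha hK1);
        [exact Hx | lra | lra | apply Hfix; lra]. }
    split; [reflexivity |]; split; [exact Hvolt |]; intros x0 Hx0.
    apply (volterra_iter_unif_lim T n alpha dalpha K K1 Kinv hT hn halpha hK hK1 hKinv);
      [lra | lra | | exact Hx0 | exact Hvolt].
    apply (continuous_on_subset (Icc 0 T)); [unfold Icc; intros t Ht; lra | exact Hx].
Qed.
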